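(* Let $a\ge 0$ be a fixed real number, and for $m\in\mathbb{N}$, $m\ge 1$, and $R^\star>0$ consider the condition $$\mathrm{(Tr)}_{m,R^\star}:\qquad \left(\frac{(m+a)(1+ (R^\star)^2)-2(1- (R^\star)^2)}{(m-a)(1+ (R^\star)^2)+2(1- (R^\star)^2)}\right)^2 \neq \frac{ 1- (R^\star)^3-2m(1+ (R^\star)^2) }{ 1- (R^\star)^3+2m(1+ (R^\star)^2)}.$$ Then: (i) If $a<1$, set $$R_1^{e,+}=\sqrt{\frac{-3+a^2+ 2a}{-3-4a-a^2}}.$$ Provided that $\mathrm{(Tr)}_{1,R_1^{e,+}}$ holds, there exists a nontrivial curve $(R(\eta),\lambda(\eta),f(\eta))$, $\eta\in I$, of solutions of $G_a(R,\lambda,f)(w)=0$ for all $w\in\mathbb{T}$, where $f$ is $1$-fold symmetric, which bifurcates from $R_1^{e,+}$. (ii) Let $m\ge 1$ be an integer with $\sqrt{a^2-2}<m<a+2$ if $a>\sqrt2$, and with $m<a+2$ if $a\le\sqrt2$. Set $$R_m^{e,-}=\sqrt{\frac{ \left(m^2+2-a^2\right)+2\sqrt{3m^2-3+a^2}}{4+4a+a^2-m^2}}.$$ Provided that $\mathrm{(Tr)}_{m,R_m^{e,-}}$ holds, there exists a nontrivial curve $(R(\eta),\lambda(\eta),f(\eta))$, $\eta\in I$, of solutions of $G_a(R,\lambda,f)(w)=0$ for all $w\in\mathbb{T}$, with $m$-fold symmetry, which bifurcates from $R_m^{e,-}$.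
   Context: $\mathbb{T}$ is the unit circle in $\mathbb{C}$. For a function $f:\mathbb{T}\to\mathbb{C}$ with Fourier series $f(w)=\sum_n f_nw^n$, derivatives are with respect to $w$, i.e. $wf'(w)=\sum_n n f_n w^n$ and $w^2f''(w)=\sum_n n(n-1)f_nw^n$. For $a\in\mathbb{R}$, $R>0$, $\lambda\in\mathbb{R}$ and $f\in C^2(\mathbb{T})$ put $$\Omega=\Omega_R+\lambda,\qquad \Omega_R=a+\frac{-1+R^2}{1+R^2},$$ $$G_a(R,\lambda,f)(w)=\Omega R+\Omega f(w)+(1-a)R+(1-a)f(w)+(3-a)wf'(w)+w^2f''(w)-2\frac{(R+\overline{f(w)})(R+f(w)+wf'(w))^2}{1+ R^2+Rf(w)+R\overline{f(w)}+f(w)\overline{f(w)}}.$$ One has $G_a(R,0,0)=0$ for all $R$; these are the trivial solutions. For an integer $m\ge1$, $f$ is called $m$-fold symmetric if it belongs to $$X_m=\Big\{f\in C^2(\mathbb{T}):\ f(w)=\sum_{n\in\mathbb{Z},\,n\ne0}f_nw^{nm},\ f_n\in\mathbb{R}\Big\}.$$ A nontrivial curve of solutions with $m$-fold symmetry bifurcating from $R^\star$ is a continuous map $I\ni\eta\mapsto(R(\eta),\lambda(\eta),f(\eta))\in(0,\infty)\times\mathbb{R}\times X_m$, $I$ an open interval containing $0$, such that $(R(0),\lambda(0),f(0))=(R^\star,0,0)$, every point of the curve solves the equation, and $(\lambda(\eta),f(\eta))\neq(0,0)$ for $\eta\ne0$. (Solutions correspond to solutions $z(t,s)=e^{i\Omega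 t}z_0(s-at)$, $z_0(s)=w(R+f(w))$ with $w=e^{is}$, of $z_t=iz_{ss}-\frac{2i\bar z}{1+|z|^2}z_s^2$, the stereographic form of the Schrödinger map equation into the sphere.) *)

(* Defs.v *)
From Stdlib Require Export Reals ZArith Lra Lia.
From Coquelicot Require Export Coquelicot.

Open Scope R_scope.

(* A function on the unit circle is represented by a map C -> C of which only
   the values at points satisfying [onT] are ever used. *)
Definition onT (w : C) : Prop := Cmod w = 1.

Definition cis (t : R) : C := (cos t, sin t).

Definition Cpowz (w : C) (k : Z) : C :=
  match k with
  | Z0 => RtoC 1
  | Zpos p => Cpow w (Pos.to_nat p)
  | Zneg p => Cinv (Cpow w (Pos.to_nat p))
  end.

(* w f'(w): since d/dt f(w e^{it}) = i w f'(w) at t = 0 when f is a function of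
   w, this is -i times the derivative of f along the circle.  It maps w^n to
   n w^n for every integer n. *)
Definition wder (f : C -> C) (w : C) : C :=
  (- Ci * (Derive (fun t => Re (f (w * cis t)%C)) 0,
           Derive (fun t => Im (f (w * cis t)%C)) 0))%C.

(* w^2 f''(w), from (w d/dw)^2 = w d/dw + w^2 d^2/dw^2.  It maps w^n to
   n (n - 1) w^n. *)
Definition w2der2 (f : C -> C) (w : C) : C :=
  (wder (wder f) w - wder f w)%C.

Definition C2T (f : C -> C) : Prop :=
  forall w : C, onT w ->
    ex_derive (V := C_R_NormedModule) (fun t : R => f (w * cis t)%C) 0 /\
    ex_derive (V := C_R_NormedModule) (fun t : R => wder f (w * cis t)%C) 0 /\
    continuous (U := C_R_NormedModule)
      (fun t : R => wder (wder f) (w * cis t)%C) 0.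

(* The sum over nonzero integers n is the limit of the symmetric partial sums
   over 1 <= |n| <= N. *)
Definition X (m : nat) (f : C -> C) : Prop :=
  C2T f /\
  exists c : Z -> R, forall w : C, onT w ->
    is_series (V := C_R_NormedModule)
      (fun k : nat =>
         let n := Z.of_nat (S k) in
         (RtoC (c n) * Cpowz w (n * Z.of_nat m) +
          RtoC (c (- n)%Z) * Cpowz w (- n * Z.of_nat m))%C)
      (f w).

(* On the circle |w f'| = |f'| and |w^2 f''| = |f''|, so this is closeness in
   the norm max (sup |f|, sup |f'|, sup |f''|) of C^2. *)
Definition C2_close (eps : R) (f g : C -> C) : Prop :=
  forall w : C, onT w ->
    Cmod (f w - g w)%C < eps /\
    Cmod (wder f w - wder g w)%C < eps /\
    Cmod (w2der2 f w - w2der2 g w)%C < eps.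

Definition Omega_R (a R0 : R) : R := a + (-1 + R0 ^ 2) / (1 + R0 ^ 2).

Definition G (a R0 lam : R) (f : C -> C) (w : C) : C :=
  let Om : C := RtoC (Omega_R a R0 + lam) in
  let r : C := RtoC R0 in
  let b : C := RtoC (1 - a) in
  let fw : C := f w in
  (Om * r + Om * fw + b * r + b * fw
   + RtoC (3 - a) * wder f w + w2der2 f w
   - RtoC 2 * ((r + Cconj fw) * Cpow (r + fw + wder f w) 2
          / (RtoC 1 + Cpow r 2 + r * fw + r * Cconj fw + fw * Cconj fw)))%C.

(* The open interval I is ]al, be[, with possibly infinite endpoints; the maps
   [Rc], [lamc] and [fc] are meaningful on I only. *)
Definition bifurcating_curve (a : R) (m : nat) (Rstar : R)
    (al be : Rbar) (Rc lamc : R -> R) (fc : R -> C -> C) : Prop :=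
  let I (eta : R) := Rbar_lt al eta /\ Rbar_lt eta be in
  I 0 /\
  (forall eta, I eta ->
     0 < Rc eta /\
     X m (fc eta) /\
     continuous Rc eta /\
     continuous lamc eta /\
     (forall eps, 0 < eps ->
        locally eta (fun eta' => C2_close eps (fc eta') (fc eta)))) /\
  (Rc 0 = Rstar /\ lamc 0 = 0 /\ forall w, onT w -> fc 0 w = RtoC 0) /\
  (forall eta, I eta ->
     forall w, onT w -> G a (Rc eta) (lamc eta) (fc eta) w = RtoC 0) /\
  (forall eta, I eta -> eta <> 0 ->
     ~ (lamc eta = 0 /\ forall w, onT w -> fc eta w = RtoC 0)).

Definition bifurcates (a : R) (m : nat) (Rstar : R) : Prop :=
  exists (al be : Rbar) (Rc lamc : R -> R) (fc : R -> C -> C),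
    bifurcating_curve a m Rstar al be Rc lamc fc.

Definition Tr (a : R) (m : nat) (Rs : R) : Prop :=
  (((INR m + a) * (1 + Rs ^ 2) - 2 * (1 - Rs ^ 2)) /
   ((INR m - a) * (1 + Rs ^ 2) + 2 * (1 - Rs ^ 2))) ^ 2
  <> (1 - Rs ^ 3 - 2 * INR m * (1 + Rs ^ 2)) /
     (1 - Rs ^ 3 + 2 * INR m * (1 + Rs ^ 2)).

Definition R1_e_plus (a : R) : R :=
  sqrt ((-3 + a ^ 2 + 2 * a) / (-3 - 4 * a - a ^ 2)).

Definition Rm_e_minus (a : R) (m : nat) : R :=
  sqrt (((INR m ^ 2 + 2 - a ^ 2) + 2 * sqrt (3 * INR m ^ 2 - 3 + a ^ 2)) /
        (4 + 4 * a + a ^ 2 - INR m ^ 2)).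

(* Main.v *)
Require Import Defs.
From Stdlib Require Import Classical ClassicalEpsilon.

(** Write [z(s) = w (R + f(w))] with [w = e^(is)].  Multiplied by [w], the
    equation [G = 0] becomes the ordinary differential equation

      [Om z + i a z' - z'' + 2 conj(z) z'^2 / (1 + |z|^2) = 0],

    which says that the stereographic projection of [z] moves on the sphere
    under a constant vertical force and a radial magnetic field: it is the
    motion of a symmetric spinning top, and is integrable.  Hence the curves of
    solutions can be produced without any infinite-dimensional bifurcation
    theorem, as tops nutating with small amplitude.

    In terms of the height [x = (1 - |z|^2) / (1 + |z|^2)], the radius [Rstar]
    gives [h0 = (1 - Rstar^2) / (1 + Rstar^2)], and the small oscillations about
    the uniform precession at height [h] with rate one have squared frequency
    [3 h^2 - 4 a h + a^2 + 1].  The radii of the statement are those for which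
    this equals [m^2]: the height is [a], with [m = 1], in (i), and
    [(2 a - sqrt (a^2 + 3 m^2 - 3)) / 3] in (ii).

    The derivative of the squared frequency with respect to the height is
    [6 h - 4 a].  When it does not vanish, put [x = h + ep cos psi]: then [psi]
    is a pendulum phase, and the nutation period and the azimuthal advance over
    one nutation are integrals of elementary functions of [psi].  Two uses of a
    one-dimensional implicit function theorem ([implicit]) make both equal to
    [2 PI / m] for every small amplitude [ep] ([ex_top_params]); inverting the
    time as a function of [psi] gives a family of waves with [m]-fold symmetry,
    continuous in [ep] ([ex_top_family]).  The notion of differentiability used
    is strict differentiability at one point, which passes through the
    integrals and gives Lipschitz dependence nearby.

    In case (i), and in case (ii) when [a = 0] and [m = 1], the height [h0] is
    [a] and [Om] vanishes at the bifurcation point.  The rotations of the sphere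
    preserve the equation with [Om = 0], and tilting the circle of radius
    [Rstar] gives the curve explicitly ([circles_bifurcate]).

    A family of waves becomes a curve in the sense of the theorem
    ([bifurcates_of_family]) by taking for [R] the mean of [z / w].  The Fourier
    expansion of [f] with real coefficients follows from the invariance under
    conjugation and from pointwise convergence of Fourier series
    ([fourier_series]), which is proved with the Dirichlet kernel and Bessel's
    inequality. *)

(** Read an equation in a normed module based on [R] as one in [R]. *)
Ltac eqR := match goal with |- @eq _ ?s ?t => change (@eq R s t) end.

(** * Strict differentiability *)

(** [sder f x l]: the linear map [l] is the strict derivative of [f] at [x],
    that is [f y - f z = l (y - z) + o(|y - z|)] as [y] and [z] both tend
    to [x]. *)
Definition sder {U V : NormedModule R_AbsRing} (f : U -> V) (x : U)
    (l : U -> V) : Prop :=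
  is_linear l /\
  forall eps : R, 0 < eps -> exists r : R, 0 < r /\
    forall y z : U, norm (minus y x) < r -> norm (minus z x) < r ->
      norm (minus (minus (f y) (f z)) (l (minus y z)))
      <= eps * norm (minus y z).

Lemma ex_derive_continuous_R (f : R -> R) (x : R) :
  ex_derive f x -> continuous f x.
Proof. apply (ex_derive_continuous (K := R_AbsRing) (V := R_NormedModule)). Qed.

Lemma norm_minus_eq {V : NormedModule R_AbsRing} (x : V) :
  norm (minus x x) = 0.
Proof.
  rewrite (minus_eq_zero x). exact norm_zero.
Qed.

Lemma sder_linear {U V : NormedModule R_AbsRing} (l : U -> V) (x : U) :
  is_linear l -> sder l x l.
Proof.
  intros Hl; split; [exact Hl|].
  intros eps Heps; exists 1; split; [lra|]; intros y z _ _.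
  rewrite <- (linear_minus l y z Hl), norm_minus_eq.
  apply Rmult_le_pos; [lra|apply norm_ge_0].
Qed.

Lemma sder_const {U V : NormedModule R_AbsRing} (c : V) (x : U) :
  sder (fun _ => c) x (fun _ => zero).
Proof.
  split; [apply is_linear_zero|].
  intros eps Heps; exists 1; split; [lra|]; intros y z _ _.
  rewrite (minus_eq_zero c), norm_minus_eq.
  apply Rmult_le_pos; [lra|apply norm_ge_0].
Qed.

Lemma norm_triangle_minus {V : NormedModule R_AbsRing} (u v : V) :
  norm u <= norm (minus u v) + norm v.
Proof.
  replace u with (plus (minus u v) v) at 1; [apply norm_triangle|].
  unfold minus; rewrite <- plus_assoc, plus_opp_l; apply plus_zero_r.
Qed.

(** A strictly differentiable map is Lipschitz near the point. *)
Lemma sder_lipschitz {U V : NormedModule R_AbsRing} (f : U -> V) x l :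
  sder f x l -> exists C r : R, 0 < C /\ 0 < r /\
    forall y z, norm (minus y x) < r -> norm (minus z x) < r ->
      norm (minus (f y) (f z)) <= C * norm (minus y z).
Proof.
  intros [Hl H]. destruct (linear_norm l Hl) as [M [HM HlM]].
  destruct (H 1 Rlt_0_1) as [r [Hr Hyz]].
  exists (1 + M), r; split; [lra|split; [exact Hr|]].
  intros y z Hy Hz. specialize (Hyz y z Hy Hz). specialize (HlM (minus y z)).
  generalize (norm_triangle_minus (minus (f y) (f z)) (l (minus y z))). lra.
Qed.

Lemma sder_comp {U V W : NormedModule R_AbsRing} (f : U -> V) (g : V -> W)
    x lf lg :
  sder f x lf -> sder g (f x) lg ->
  sder (fun u => g (f u)) x (fun u => lg (lf u)).
Proof.
  intros Hf Hg. destruct (sder_lipschitz f x lf Hf) as [C [r0 [HC [Hr0 HL]]]].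
  destruct Hf as [Hlf Hf], Hg as [Hlg Hg].
  split; [apply is_linear_comp; assumption|].
  intros eps Heps. destruct (linear_norm lg Hlg) as [M [HM HlM]].
  destruct (Hg (eps / (2 * C))) as [r1 [Hr1 Hg1]].
  { apply Rdiv_lt_0_compat; lra. }
  destruct (Hf (eps / (2 * M))) as [r2 [Hr2 Hf1]].
  { apply Rdiv_lt_0_compat; lra. }
  assert (Hq : 0 < r1 / C) by (apply Rdiv_lt_0_compat; assumption).
  exists (Rmin r0 (Rmin r2 (r1 / C))).
  split; [repeat apply Rmin_pos; assumption|].
  intros y z Hy Hz.
  assert (Hbd : forall t, norm (minus t x) < Rmin r0 (Rmin r2 (r1 / C)) ->
    norm (minus t x) < r0 /\ norm (minus t x) < r2 /\
    norm (minus (f t) (f x)) < r1).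
  { intros t Ht. apply Rmin_Rgt_l in Ht. destruct Ht as [Ht0 Ht].
    apply Rmin_Rgt_l in Ht. destruct Ht as [Ht2 Ht1].
    split; [exact Ht0|split; [exact Ht2|]].
    eapply Rle_lt_trans; [apply HL; [exact Ht0|rewrite norm_minus_eq; exact Hr0]|].
    apply Rgt_lt in Ht1. apply (Rmult_lt_compat_l C) in Ht1; [|exact HC].
    replace (C * (r1 / C)) with r1 in Ht1 by (field; lra). exact Ht1. }
  destruct (Hbd y Hy) as [Hy0 [Hy2 Hy1]], (Hbd z Hz) as [Hz0 [Hz2 Hz1]].
  specialize (Hg1 _ _ Hy1 Hz1). specialize (Hf1 _ _ Hy2 Hz2).
  specialize (HL _ _ Hy0 Hz0).
  set (D := minus (f y) (f z)) in *.
  set (E := minus D (lf (minus y z))) in *.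
  replace (minus (minus (g (f y)) (g (f z))) (lg (lf (minus y z))))
    with (plus (minus (minus (g (f y)) (g (f z))) (lg D)) (lg E)).
  2:{ unfold E. rewrite (linear_minus lg) by assumption.
      unfold minus. rewrite <- !plus_assoc. do 2 f_equal.
      rewrite plus_assoc, plus_opp_l, plus_zero_l. reflexivity. }
  eapply Rle_trans; [apply norm_triangle|].
  assert (H1 : norm (lg E) <= eps / 2 * norm (minus y z)).
  { eapply Rle_trans; [apply HlM|].
    apply (Rmult_le_compat_l M) in Hf1; [|lra].
    replace (eps / 2) with (M * (eps / (2 * M))) by (field; lra). lra. }
  assert (H2 : eps / (2 * C) * norm D <= eps / 2 * norm (minus y z)).
  { apply (Rmult_le_compat_l (eps / (2 * C))) in HL.
    - replace (eps / 2) with (eps / (2 * C) * C) by (field; lra). lra.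
    - apply Rlt_le, Rdiv_lt_0_compat; lra. }
  lra.
Qed.

Lemma norm_pair_le {U V : NormedModule R_AbsRing} (u : U) (v : V) :
  norm ((u, v) : prod_NormedModule _ U V) <= norm u + norm v.
Proof.
  change (sqrt (norm u ^ 2 + norm v ^ 2) <= norm u + norm v).
  generalize (norm_ge_0 u) (norm_ge_0 v); intros.
  apply Rsqr_incr_0_var; [|lra].
  rewrite Rsqr_sqrt; [|nra]. unfold Rsqr; nra.
Qed.

Lemma norm_fst_le {U V : NormedModule R_AbsRing}
    (p : prod_NormedModule _ U V) : norm (fst p) <= norm p.
Proof.
  change (norm (fst p) <= sqrt (norm (fst p) ^ 2 + norm (snd p) ^ 2)).
  generalize (norm_ge_0 (fst p)) (norm_ge_0 (snd p)); intros.
  apply Rsqr_incr_0_var; [|apply sqrt_pos].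
  rewrite Rsqr_sqrt; [|nra]. unfold Rsqr; nra.
Qed.

Lemma sder_pair {U V W : NormedModule R_AbsRing} (f : U -> V) (g : U -> W)
    x lf lg :
  sder f x lf -> sder g x lg ->
  sder (V := prod_NormedModule _ V W) (fun u => (f u, g u)) x
    (fun u => (lf u, lg u)).
Proof.
  intros [Hlf Hf] [Hlg Hg]. split; [apply is_linear_prod; assumption|].
  intros eps Heps.
  destruct (Hf (eps / 2)) as [r1 [Hr1 Hf1]]; [lra|].
  destruct (Hg (eps / 2)) as [r2 [Hr2 Hg1]]; [lra|].
  exists (Rmin r1 r2); split; [apply Rmin_pos; assumption|].
  intros y z Hy Hz. apply Rmin_Rgt_l in Hy, Hz.
  destruct Hy as [Hy1 Hy2], Hz as [Hz1 Hz2].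
  specialize (Hf1 _ _ Hy1 Hz1). specialize (Hg1 _ _ Hy2 Hz2).
  eapply Rle_trans; [apply norm_pair_le|].
  change (norm (minus (minus (f y) (f z)) (lf (minus y z))) +
    norm (minus (minus (g y) (g z)) (lg (minus y z))) <= eps * norm (minus y z)).
  lra.
Qed.

Lemma sder_plus {U : NormedModule R_AbsRing} (f g : U -> R) x lf lg :
  sder (V := R_NormedModule) f x lf -> sder (V := R_NormedModule) g x lg ->
  sder (V := R_NormedModule) (fun u => f u + g u) x (fun u => lf u + lg u).
Proof.
  intros Hf Hg.
  apply (sder_comp (V := prod_NormedModule _ R_NormedModule R_NormedModule)
    (fun u => (f u, g u)) (fun p => plus (fst p) (snd p)) x
    (fun u => (lf u, lg u)) (fun p => plus (fst p) (snd p))).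
  - apply sder_pair; assumption.
  - apply sder_linear, is_linear_plus.
Qed.

Lemma sder_scal {U : NormedModule R_AbsRing} (k : R) (f : U -> R) x lf :
  sder (V := R_NormedModule) f x lf ->
  sder (V := R_NormedModule) (fun u => k * f u) x (fun u => k * lf u).
Proof.
  intros Hf.
  apply (sder_comp (V := R_NormedModule) (W := R_NormedModule)
    f (fun p => scal k p) x lf (fun p => scal k p)); [exact Hf|].
  apply sder_linear, (@is_linear_scal_r R_AbsRing R_NormedModule k). intros; apply Rmult_comm.
Qed.

(** By the mean value theorem. *)
Lemma sder_C1 (f f' : R -> R) (x : R) :
  locally x (fun t => is_derive f t (f' t)) -> continuous f' x ->
  sder (U := R_NormedModule) (V := R_NormedModule) f x (fun u => f' x * u).
Proof.
  intros [d Hd] Hc. split.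
  { apply (is_linear_ext (fun u : R_NormedModule => scal (f' x) u)); [reflexivity|].
    apply (@is_linear_scal_r R_AbsRing R_NormedModule). intros; apply Rmult_comm. }
  intros eps Heps.
  assert (Hc' : locally x (fun t => Rabs (f' t - f' x) < eps)).
  { apply (Hc (fun y => Rabs (y - f' x) < eps)). exists (mkposreal eps Heps).
    intros y Hy. exact Hy. }
  destruct Hc' as [e He].
  exists (Rmin d e); split; [apply Rmin_pos; [apply d|apply e]|].
  assert (Main : forall y z : R, y <= z -> Rabs (y - x) < Rmin d e ->
    Rabs (z - x) < Rmin d e ->
    Rabs (f y - f z - f' x * (y - z)) <= eps * Rabs (y - z)).
  { intros y z Hyz Hy Hz.
    assert (Hin : forall t, y <= t <= z -> Rabs (t - x) < Rmin d e).
    { intros t Ht. apply Rabs_def1; [apply Rabs_def2 in Hz|apply Rabs_def2 in Hy]; lra. }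
    destruct (MVT_gen f y z f') as [c [Hcc Hf]].
    - intros t Ht. rewrite Rmin_left, Rmax_right in Ht by assumption.
      apply Hd. apply (Rlt_le_trans _ (Rmin d e)); [apply Hin; lra|apply Rmin_l].
    - intros t Ht. rewrite Rmin_left, Rmax_right in Ht by assumption.
      apply continuity_pt_filterlim, ex_derive_continuous_R. exists (f' t).
      apply Hd. apply (Rlt_le_trans _ (Rmin d e)); [apply Hin; lra|apply Rmin_l].
    - rewrite Rmin_left, Rmax_right in Hcc by assumption.
      replace (f y - f z - f' x * (y - z)) with ((f' c - f' x) * (y - z)) by lra.
      rewrite Rabs_mult. apply Rmult_le_compat_r; [apply Rabs_pos|].
      apply Rlt_le, He. apply (Rlt_le_trans _ (Rmin d e)); [apply Hin; lra|apply Rmin_r]. }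
  intros y z Hy Hz. change (Rabs (f y - f z - f' x * (y - z)) <= eps * Rabs (y - z)).
  destruct (Rle_dec y z) as [Hyz|Hyz]; [apply Main; assumption|].
  rewrite (Rabs_minus_sym y z).
  replace (f y - f z - f' x * (y - z)) with (- (f z - f y - f' x * (z - y))) by ring.
  rewrite Rabs_Ropp. apply Main; [lra|assumption|assumption].
Qed.

(** By polarisation, from the chain rule for squares. *)
Lemma sder_mult {U : NormedModule R_AbsRing} (f g : U -> R) x lf lg :
  sder (V := R_NormedModule) f x lf -> sder (V := R_NormedModule) g x lg ->
  sder (V := R_NormedModule) (fun u => f u * g u) x
    (fun u => f x * lg u + g x * lf u).
Proof.
  intros Hf Hg.
  assert (Hsq : forall (h : U -> R) lh, sder (V := R_NormedModule) h x lh ->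
    sder (V := R_NormedModule) (fun u => h u ^ 2) x (fun u => 2 * h x * lh u)).
  { intros h lh Hh.
    apply (sder_comp (V := R_NormedModule) (W := R_NormedModule) h (fun t => t ^ 2)
      x lh (fun u => 2 * h x * u)); [exact Hh|].
    apply (sder_C1 (fun t => t ^ 2) (fun t => 2 * t)).
    - exists (mkposreal 1 Rlt_0_1). intros t _. auto_derive; [trivial|ring].
    - apply ex_derive_continuous_R. auto_derive; trivial. }
  pose proof (Hsq _ _ (sder_plus _ _ _ _ _ Hf Hg)) as H1.
  pose proof (Hsq _ _ (sder_plus _ _ _ _ _ Hf (sder_scal (-1) _ _ _ Hg))) as H2.
  pose proof (sder_scal (/4) _ _ _ (sder_plus _ _ _ _ _ H1 (sder_scal (-1) _ _ _ H2))) as H3.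
  cbv beta in H3. destruct H3 as [Hl H3]. split.
  - eapply is_linear_ext; [|exact Hl]. intros u; cbv beta.
    eqR. field.
  - intros eps Heps. destruct (H3 eps Heps) as [r [Hr H]].
    exists r; split; [exact Hr|]. intros y z Hy Hz.
    specialize (H y z Hy Hz).
    refine (Rle_trans _ _ _ (Req_le _ _ _) H). f_equal.
    change (f y * g y - f z * g z - (f x * lg (minus y z) + g x * lf (minus y z)) =
     / 4 * ((f y + g y) ^ 2 + -1 * (f y + -1 * g y) ^ 2) -
     / 4 * ((f z + g z) ^ 2 + -1 * (f z + -1 * g z) ^ 2) -
     / 4 * (2 * (f x + g x) * (lf (minus y z) + lg (minus y z)) +
        -1 * (2 * (f x + -1 * g x) * (lf (minus y z) + -1 * lg (minus y z))))).
    field.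
Qed.

Lemma sder_inv {U : NormedModule R_AbsRing} (f : U -> R) x lf :
  sder (V := R_NormedModule) f x lf -> f x <> 0 ->
  sder (V := R_NormedModule) (fun u => / f u) x
    (fun u => - / f x ^ 2 * lf u).
Proof.
  intros Hf H0.
  apply (sder_comp (V := R_NormedModule) (W := R_NormedModule) f Rinv
      x lf (fun u => - / f x ^ 2 * u)); [exact Hf|].
  apply (sder_C1 Rinv (fun t => - / t ^ 2)).
  - assert (Hp : 0 < Rabs (f x)) by (apply Rabs_pos_lt; exact H0).
    exists (mkposreal _ Hp). intros t Ht. 
    auto_derive; [|field].
    + intros ->. change (Rabs (0 - f x) < Rabs (f x)) in Ht.
      rewrite Rabs_minus_sym, Rminus_0_r in Ht. lra.
    + intros ->. change (Rabs (0 - f x) < Rabs (f x)) in Ht.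
      rewrite Rabs_minus_sym, Rminus_0_r in Ht. lra.
  - apply ex_derive_continuous_R. auto_derive. rewrite Rmult_1_r. 
    apply Rmult_integral_contrapositive_currified; assumption.
Qed.

Lemma sder_sqrt {U : NormedModule R_AbsRing} (f : U -> R) x lf :
  sder (V := R_NormedModule) f x lf -> 0 < f x ->
  sder (V := R_NormedModule) (fun u => sqrt (f u)) x
    (fun u => / (2 * sqrt (f x)) * lf u).
Proof.
  intros Hf H0.
  apply (sder_comp (V := R_NormedModule) (W := R_NormedModule) f sqrt
      x lf (fun u => / (2 * sqrt (f x)) * u)); [exact Hf|].
  apply (sder_C1 sqrt (fun t => / (2 * sqrt t))).
  - exists (mkposreal _ H0). intros t Ht. change (Rabs (t - f x) < f x) in Ht.
    apply Rabs_def2 in Ht.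
    auto_derive; [lra|]. field. apply Rgt_not_eq, sqrt_lt_R0; lra.
  - apply ex_derive_continuous_R. auto_derive.
    generalize (sqrt_lt_R0 _ H0); lra.
Qed.

(** * An implicit function theorem *)

(** The strict derivative along the first coordinate is the partial
    derivative. *)
Lemma sder_partial {V : NormedModule R_AbsRing} (F : R * V -> R)
    (x0 : R) (q0 : V) l d :
  sder (U := prod_NormedModule _ R_NormedModule V) (V := R_NormedModule)
    F (x0, q0) l ->
  is_derive (fun x => F (x, q0)) x0 d -> l (1, zero) = d.
Proof.
  intros Hl Hd.
  assert (H1 : is_derive (fun x => F (x, q0)) x0 (l (1, zero))).
  { split; [apply is_linear_scal_l|].
    intros x Hx. apply (is_filter_lim_locally_unique (V := R_NormedModule)) in Hx. subst x.
    intros eps. destruct Hl as [Hl H]. destruct (H eps (cond_pos eps)) as [r [Hr Hyz]].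
    exists (mkposreal r Hr). intros y Hy. change (Rabs (y - x0) < r) in Hy.
    assert (Hn : forall t : R, norm (minus ((t, q0) : prod_NormedModule _ R_NormedModule V) (x0, q0)) <= Rabs (t - x0)).
    { intros t. eapply Rle_trans; [apply norm_pair_le|].
      change (Rabs (t - x0) + norm (minus q0 q0) <= Rabs (t - x0)).
      rewrite (norm_minus_eq q0), Rplus_0_r. apply Rle_refl. }
    specialize (Hyz (y, q0) (x0, q0)).
    assert (H1 := Hn y). assert (H2 := Hn x0). rewrite Rminus_diag, Rabs_R0 in H2.
    assert (E : l (minus ((y, q0) : prod_NormedModule _ R_NormedModule V) (x0, q0))
        = scal (y - x0) (l (1, zero))).
    { rewrite <- (linear_scal l Hl). f_equal.
      change ((minus y x0, minus q0 q0) = ((y - x0) * 1, scal (y - x0) (@zero V))).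
      f_equal; [rewrite Rmult_1_r; reflexivity|].
      etransitivity; [exact (minus_eq_zero q0)|symmetry; exact (scal_zero_r _)]. }
    rewrite E in Hyz.
    eapply Rle_trans; [apply Hyz|].
    + eapply Rle_lt_trans; [apply H1|exact Hy].
    + eapply Rle_lt_trans; [apply H2|exact Hr].
    + apply Rmult_le_compat_l; [apply Rlt_le, cond_pos|]. apply H1. }
  apply is_derive_unique in H1. apply is_derive_unique in Hd.
  rewrite <- H1. exact Hd.
Qed.

(** The equation [F (x, q) = 0] in the unknown [x], normalised to unit slope.
    A root exists by the intermediate value theorem; it is unique, and strictly
    differentiable in [q], because [F] varies at unit rate in [x]. *)
Lemma implicit_unit {V : NormedModule R_AbsRing} (F : R * V -> R)
    (x0 : R) (q0 : V) l :
  sder (U := prod_NormedModule _ R_NormedModule V) (V := R_NormedModule)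
    F (x0, q0) l ->
  F (x0, q0) = 0 -> l (1, zero) = 1 ->
  exists (X : V -> R) lX, X q0 = x0 /\ sder (V := R_NormedModule) X q0 lX /\
    exists r : R, 0 < r /\ forall q : V, norm (minus q q0) < r ->
      F (X q, q) = 0 /\
      forall x, Rabs (x - x0) < r -> F (x, q) = 0 -> x = X q.
Proof.
  intros [Hl HF] HF0 Hl1.
  pose (LQ := fun u : V => l (0, u)).
  assert (HLQ : is_linear (V := R_NormedModule) LQ).
  { apply (is_linear_comp (V := prod_NormedModule _ R_NormedModule V)
      (fun u : V => (zero, u)) l); [|exact Hl].
    apply is_linear_prod; [apply is_linear_zero|apply is_linear_id]. }
  assert (Hdec : forall (h : R) (u : V), l (h, u) = h + LQ u).
  { intros h u. unfold LQ.
    replace ((h, u) : R * V) with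
      (plus (scal h ((1, zero) : prod_NormedModule _ R_NormedModule V)) (0, u)).
    - rewrite (linear_plus l Hl), (linear_scal l Hl), Hl1.
      change (h * 1 + l (0, u) = h + l (0, u)). ring.
    - change ((h * 1 + 0, plus (scal h zero) u) = (h, u)).
      f_equal; [ring|].
      transitivity (plus (@zero V) u); [|exact (plus_zero_l u)].
      f_equal. exact (scal_zero_r h). }
  (* Strict differentiability, in terms of the two increments. *)
  assert (K : forall eps, 0 < eps -> exists r, 0 < r /\ forall (x x' : R) (q q' : V),
    Rabs (x - x0) < r -> Rabs (x' - x0) < r -> norm (minus q q0) < r ->
    norm (minus q' q0) < r ->
    Rabs (F (x, q) - F (x', q') - ((x - x') + LQ (minus q q')))
      <= eps * (Rabs (x - x') + norm (minus q q'))).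
  { intros eps Heps. destruct (HF eps Heps) as [r [Hr H]].
    assert (Hr2 : 0 < r / 2) by lra.
    exists (r / 2). split; [exact Hr2|]. intros x x' q q' Hx Hx' Hq Hq'.
    rewrite <- Hdec.
    specialize (H (x, q) (x', q')).
    eapply Rle_trans; [apply H|].
    - eapply Rle_lt_trans; [apply norm_pair_le|].
      change (Rabs (x - x0) + norm (minus q q0) < r). lra.
    - eapply Rle_lt_trans; [apply norm_pair_le|].
      change (Rabs (x' - x0) + norm (minus q' q0) < r). lra.
    - apply Rmult_le_compat_l; [lra|]. exact (norm_pair_le (U := R_NormedModule) (V := V) (x - x') (minus q q')). }
  assert (HLz : forall q : V, LQ (minus q q) = 0).
  { intros q. transitivity (LQ zero); [|exact (linear_zero LQ HLQ)].
    apply (f_equal LQ). exact (minus_eq_zero q). }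
  destruct (linear_norm LQ HLQ) as [M [HM HMb]].
  assert (HMb' : forall u, Rabs (LQ u) <= M * norm u) by exact HMb.
  destruct (K (/2)) as [r0 [Hr0 K0]]; [lra|].
  pose (rho := r0 / 2). assert (Hrho : 0 < rho < r0) by (unfold rho; lra).
  pose (r1 := Rmin r0 (rho / (2 * M + 1))).
  assert (Hr1 : 0 < r1).
  { apply Rmin_pos; [exact Hr0|apply Rdiv_lt_0_compat; lra]. }
  assert (Hr1b : forall n, n < r1 -> n < r0 /\ n * (2 * M + 1) < rho).
  { intros n Hn. apply Rmin_Rgt_l in Hn. destruct Hn as [Hn1 Hn2]. split; [exact Hn1|].
    apply Rgt_lt, (Rmult_lt_compat_r (2 * M + 1)) in Hn2; [|lra].
    replace (rho / (2 * M + 1) * (2 * M + 1)) with rho in Hn2 by (field; lra). exact Hn2. }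
  assert (Hn0 : norm (minus q0 q0) = 0) by apply norm_minus_eq.
  assert (Hx00 : Rabs (x0 - x0) = 0) by (rewrite Rminus_diag; apply Rabs_R0).
  assert (Hroot : forall q : V, norm (minus q q0) < r1 ->
    exists x, Rabs (x - x0) < r0 /\ F (x, q) = 0).
  { intros q Hq. destruct (Hr1b _ Hq) as [Hq0 Hq1].
    assert (HB := HMb' (minus q q0)). assert (Hge := norm_ge_0 (minus q q0)).
    destruct (Ranalysis5.IVT_interv (fun x => F (x, q)) (x0 - rho) (x0 + rho)) as [x [Hx HFx]].
    - intros b Hb.
      assert (Hb' : Rabs (b - x0) < r0) by (apply Rabs_def1; lra).
      intros eps Heps.
      assert (Hgap : 0 < r0 - Rabs (b - x0)) by lra.
      exists (Rmin (eps / 2) (r0 - Rabs (b - x0))). split; [apply Rmin_pos; lra|].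
      intros c0 [_ Hc]. set (c := c0 : R). change c0 with c in Hc |- *. simpl in Hc |- *. unfold Rdist in Hc |- *.
      clearbody c.
      apply Rmin_Rgt_l in Hc. destruct Hc as [Hc1 Hc2].
      assert (Hc' : Rabs (c - x0) < r0).
      { replace (c - x0) with ((c - b) + (b - x0)) by ring.
        eapply Rle_lt_trans; [apply Rabs_triang|]. lra. }
      specialize (K0 c b q q Hc' Hb' Hq0 Hq0).
      assert (Hnz := norm_minus_eq q).
      rewrite HLz, Hnz in K0.
      pose proof (Rabs_triang (F (c, q) - F (b, q) - (c - b + 0)) (c - b)) as Ht.
      replace (F (c, q) - F (b, q) - (c - b + 0) + (c - b)) with
        (F (c, q) - F (b, q)) in Ht by ring.
      lra.
    - lra.
    - assert (Ha : Rabs (x0 - rho - x0) = rho).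
      { replace (x0 - rho - x0) with (- rho) by ring. rewrite Rabs_Ropp. apply Rabs_pos_eq; lra. }
      specialize (K0 (x0 - rho) x0 q q0). rewrite Hn0, Hx00, Ha, HF0 in K0.
      specialize (K0 ltac:(lra) ltac:(lra) ltac:(lra) ltac:(lra)).
      apply Rabs_le_between in K0. apply Rabs_le_between in HB. nra.
    - assert (Ha : Rabs (x0 + rho - x0) = rho).
      { replace (x0 + rho - x0) with rho by ring. apply Rabs_pos_eq; lra. }
      specialize (K0 (x0 + rho) x0 q q0). rewrite Hn0, Hx00, Ha, HF0 in K0.
      specialize (K0 ltac:(lra) ltac:(lra) ltac:(lra) ltac:(lra)).
      apply Rabs_le_between in K0. apply Rabs_le_between in HB. nra.
    - exists x. split; [apply Rabs_def1; lra|exact HFx]. }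
  assert (Huniq : forall (q : V) (x x' : R), norm (minus q q0) < r1 -> Rabs (x - x0) < r0 ->
    Rabs (x' - x0) < r0 -> F (x, q) = 0 -> F (x', q) = 0 -> x = x').
  { intros q x x' Hq Hx Hx' H1 H2. destruct (Hr1b _ Hq) as [Hq0 _].
    specialize (K0 x x' q q Hx Hx' Hq0 Hq0). assert (Hnz := norm_minus_eq q).
    rewrite HLz, Hnz, H1, H2 in K0.
    replace (0 - 0 - (x - x' + 0)) with (- (x - x')) in K0 by ring.
    rewrite Rabs_Ropp in K0.
    destruct (Req_dec (x - x') 0) as [E|E]; [lra|].
    apply Rabs_pos_lt in E. lra. }
  pose (X := fun q : V => epsilon (inhabits x0) (fun x => Rabs (x - x0) < r0 /\ F (x, q) = 0)).
  assert (HX : forall q : V, norm (minus q q0) < r1 -> Rabs (X q - x0) < r0 /\ F (X q, q) = 0).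
  { intros q Hq. apply epsilon_spec. exact (Hroot q Hq). }
  assert (HX0 : X q0 = x0).
  { destruct (HX q0) as [H1 H2]; [lra|].
    apply (Huniq q0); try assumption; lra. }
  assert (Hlip : forall q q' : V, norm (minus q q0) < r1 -> norm (minus q' q0) < r1 ->
    Rabs (X q - X q') <= (2 * M + 1) * norm (minus q q')).
  { intros q q' Hq Hq'. destruct (HX q Hq) as [Hx1 Hx2], (HX q' Hq') as [Hx1' Hx2'].
    destruct (Hr1b _ Hq) as [Hq0 _], (Hr1b _ Hq') as [Hq0' _].
    specialize (K0 (X q) (X q') q q' Hx1 Hx1' Hq0 Hq0').
    rewrite Hx2, Hx2' in K0. specialize (HMb' (minus q q')).
    apply Rabs_le_between in HMb'.
    apply Rabs_le_between in K0.
    assert (HA : Rabs (X q - X q') <= M * norm (minus q q') + / 2 * (Rabs (X q - X q') + norm (minus q q'))).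
    { apply Rabs_le; lra. }
    lra. }
  exists X, (fun u => - 1 * LQ u). split; [exact HX0|split].
  - split.
    { apply (is_linear_comp (W := R_NormedModule) LQ (fun u => scal (-1) u)); [exact HLQ|].
      apply (@is_linear_scal_r R_AbsRing R_NormedModule). intros; apply Rmult_comm. }
    intros eps Heps.
    destruct (K (eps / (2 * M + 2))) as [r2 [Hr2 K2]]; [apply Rdiv_lt_0_compat; lra|].
    assert (Hr3 : 0 < r2 / (2 * M + 1)) by (apply Rdiv_lt_0_compat; lra).
    exists (Rmin r1 (Rmin r2 (r2 / (2 * M + 1)))). split; [apply Rmin_pos; [exact Hr1|apply Rmin_pos; assumption]|].
    assert (Hin : forall q : V, norm (minus q q0) < Rmin r1 (Rmin r2 (r2 / (2 * M + 1))) ->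
      norm (minus q q0) < r1 /\ norm (minus q q0) < r2 /\ Rabs (X q - x0) < r2).
    { intros q Hq. apply Rmin_Rgt_l in Hq. destruct Hq as [Hqa Hq].
      apply Rmin_Rgt_l in Hq. destruct Hq as [Hqb Hqc].
      split; [exact Hqa|split; [exact Hqb|]].
      specialize (Hlip q q0 Hqa ltac:(lra)). rewrite HX0 in Hlip.
      eapply Rle_lt_trans; [exact Hlip|].
      apply Rgt_lt, (Rmult_lt_compat_l (2 * M + 1)) in Hqc; [|lra].
      replace ((2 * M + 1) * (r2 / (2 * M + 1))) with r2 in Hqc by (field; lra). exact Hqc. }
    intros q q' Hq Hq'.
    destruct (Hin q Hq) as [Hqa [Hqb Hqc]], (Hin q' Hq') as [Hqa' [Hqb' Hqc']].
    specialize (K2 (X q) (X q') q q' Hqc Hqc' Hqb Hqb').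
    destruct (HX q Hqa) as [_ Hx2], (HX q' Hqa') as [_ Hx2'].
    rewrite Hx2, Hx2' in K2. specialize (Hlip q q' Hqa Hqa').
    change (Rabs (X q - X q' - (-1 * LQ (minus q q'))) <= eps * norm (minus q q')).
    replace (X q - X q' - (-1 * LQ (minus q q'))) with
      (- (0 - 0 - (X q - X q' + LQ (minus q q')))) by ring.
    rewrite Rabs_Ropp. eapply Rle_trans; [exact K2|].
    replace (eps * norm (minus q q')) with
      (eps / (2 * M + 2) * ((2 * M + 1) * norm (minus q q') + norm (minus q q'))) by (field; lra).
    apply Rmult_le_compat_l; [apply Rlt_le, Rdiv_lt_0_compat; lra|]. lra.
  - exists r1. split; [exact Hr1|]. intros q Hq. destruct (HX q Hq) as [Hx1 Hx2].
    split; [exact Hx2|]. intros x Hx HFx.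
    apply (Huniq q); try assumption. destruct (Hr1b _ Hx); lra.
Qed.

(** Implicit function theorem in one unknown, for strict differentiability. *)
Lemma implicit {V : NormedModule R_AbsRing} (F : R * V -> R)
    (x0 : R) (q0 : V) l d :
  sder (U := prod_NormedModule _ R_NormedModule V) (V := R_NormedModule)
    F (x0, q0) l ->
  F (x0, q0) = 0 -> is_derive (fun x => F (x, q0)) x0 d -> d <> 0 ->
  exists (X : V -> R) lX, X q0 = x0 /\ sder (V := R_NormedModule) X q0 lX /\
    exists r : R, 0 < r /\ forall q : V, norm (minus q q0) < r ->
      F (X q, q) = 0 /\
      forall x, Rabs (x - x0) < r -> F (x, q) = 0 -> x = X q.
Proof.
  intros Hs HF0 Hd Hd0.
  assert (Hl1 := sder_partial F x0 q0 l d Hs Hd).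
  destruct (implicit_unit (fun p => / d * F p) x0 q0 (fun u => / d * l u))
    as [X [lX [HX0 [HX [r [Hr H]]]]]].
  - apply sder_scal. exact Hs.
  - cbv beta. rewrite HF0. ring.
  - cbv beta. rewrite Hl1. eqR. field. exact Hd0.
  - exists X, lX. split; [exact HX0|split; [exact HX|]].
    exists r. split; [exact Hr|]. intros q Hq. destruct (H q Hq) as [H1 H2].
    assert (Hi : / d <> 0) by (apply Rinv_neq_0_compat; exact Hd0).
    split.
    + apply Rmult_integral in H1. destruct H1; [contradiction|assumption].
    + intros x Hx HFx. apply H2; [exact Hx|]. rewrite HFx. ring.
Qed.

(** Strict differentiability with the derivative left unspecified. *)
Definition sd {U : NormedModule R_AbsRing} (f : U -> R) (x : U) : Prop :=
  exists l, sder (V := R_NormedModule) f x l.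

Lemma sd_const {U : NormedModule R_AbsRing} (c : R) (x : U) :
  sd (fun _ => c) x.
Proof. eexists. apply (sder_const (V := R_NormedModule)). Qed.

Lemma sd_plus {U : NormedModule R_AbsRing} (f g : U -> R) x :
  sd f x -> sd g x -> sd (fun u => f u + g u) x.
Proof. intros [lf Hf] [lg Hg]. eexists. apply sder_plus; eassumption. Qed.

Lemma sd_mult {U : NormedModule R_AbsRing} (f g : U -> R) x :
  sd f x -> sd g x -> sd (fun u => f u * g u) x.
Proof. intros [lf Hf] [lg Hg]. eexists. apply sder_mult; eassumption. Qed.

Lemma sd_minus {U : NormedModule R_AbsRing} (f g : U -> R) x :
  sd f x -> sd g x -> sd (fun u => f u - g u) x.
Proof.
  intros [lf Hf] [lg Hg]. exists (fun u => lf u + -1 * lg u).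
  destruct (sder_plus _ _ _ _ _ Hf (sder_scal (-1) _ _ _ Hg)) as [Hl H].
  split; [exact Hl|]. intros eps Heps. destruct (H eps Heps) as [r [Hr Hyz]].
  exists r; split; [exact Hr|]. intros y z Hy Hz. specialize (Hyz y z Hy Hz).
  refine (Rle_trans _ _ _ (Req_le _ _ _) Hyz). f_equal.
  change (f y - g y - (f z - g z) - (lf (minus y z) + -1 * lg (minus y z)) =
    f y + -1 * g y - (f z + -1 * g z) - (lf (minus y z) + -1 * lg (minus y z))).
  ring.
Qed.

Lemma sd_inv {U : NormedModule R_AbsRing} (f : U -> R) x :
  sd f x -> f x <> 0 -> sd (fun u => / f u) x.
Proof. intros [lf Hf] H. eexists. apply sder_inv; eassumption. Qed.

Lemma sd_div {U : NormedModule R_AbsRing} (f g : U -> R) x :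
  sd f x -> sd g x -> g x <> 0 -> sd (fun u => f u / g u) x.
Proof. intros Hf Hg H. apply sd_mult; [exact Hf|apply sd_inv; assumption]. Qed.

Lemma sd_sqrt {U : NormedModule R_AbsRing} (f : U -> R) x :
  sd f x -> 0 < f x -> sd (fun u => sqrt (f u)) x.
Proof. intros [lf Hf] H. eexists. apply sder_sqrt; eassumption. Qed.

Lemma sd_linear {U : NormedModule R_AbsRing} (f : U -> R) x :
  is_linear (V := R_NormedModule) f -> sd f x.
Proof. intros H. exists f. apply sder_linear; exact H. Qed.

Lemma sd_comp {U V : NormedModule R_AbsRing} (f : U -> V) (g : V -> R) x lf :
  sder f x lf -> sd g (f x) -> sd (fun u => g (f u)) x.
Proof.
  intros Hf [lg Hg]. eexists.
  apply (sder_comp (W := R_NormedModule) f g); eassumption.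
Qed.

(** * Integrals of functions of [e cos t] *)

Section CosineIntegral.

Context {V : NormedModule R_AbsRing} (k : V * R -> R) (en : V -> R) (p0 : V).
Context (lk : prod_NormedModule _ V R_NormedModule -> R).
Hypothesis Hen : is_linear (V := R_NormedModule) en.
Hypothesis Hen0 : en p0 = 0.
Hypothesis Hk : sder (U := prod_NormedModule _ V R_NormedModule)
  (V := R_NormedModule) k (p0, 0) lk.

(* [k] is differentiated at [(p0, 0)]; the amplitude [en] vanishes at [p0]. *)
Let kc (p : V) (t : R) : R := k (p, en p * cos t).

Lemma Rabs_cos_le t : Rabs (cos t) <= 1.
Proof. apply Rabs_le. apply COS_bound. Qed.

Lemma en_bound : exists M, 0 < M /\ forall p q : V,
  Rabs (en p - en q) <= M * norm (minus p q).
Proof.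
  destruct (linear_norm en Hen) as [M [HM H]]. exists M; split; [exact HM|].
  intros p q. specialize (H (minus p q)). rewrite (linear_minus en) in H by exact Hen.
  exact H.
Qed.

Lemma cos_lip t t' : Rabs (cos t - cos t') <= Rabs (t - t').
Proof.
  destruct (MVT_gen cos t' t (fun x => - sin x)) as [c [_ Hc]].
  - intros; auto_derive; [trivial|ring].
  - intros. apply continuity_cos.
  - rewrite Hc, Rabs_mult, Rabs_Ropp.
    rewrite <- (Rmult_1_l (Rabs (t - t'))) at 2.
    apply Rmult_le_compat_r; [apply Rabs_pos|]. apply Rabs_le, SIN_bound.
Qed.

Lemma kc_near : forall r, 0 < r -> exists r', 0 < r' /\
  forall (p : V) (t : R), norm (minus p p0) < r' ->
  norm (minus ((p, en p * cos t) : prod_NormedModule _ V R_NormedModule) (p0, 0)) < r.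
Proof.
  intros r Hr. destruct en_bound as [M [HM HMb]].
  exists (r / (1 + M)). split; [apply Rdiv_lt_0_compat; lra|].
  intros p t Hp. eapply Rle_lt_trans; [apply norm_pair_le|].
  change (norm (minus p p0) + Rabs (en p * cos t - 0) < r).
  specialize (HMb p p0). rewrite Hen0 in HMb.
  rewrite Rminus_0_r in *. rewrite Rabs_mult.
  apply (Rmult_lt_compat_r (1 + M)) in Hp; [|lra].
  replace (r / (1 + M) * (1 + M)) with r in Hp by (field; lra).
  generalize (Rabs_cos_le t) (Rabs_pos (cos t)) (Rabs_pos (en p)). nra.
Qed.

(** Lipschitz bound in the parameter and the phase, uniform in the phase. *)
Lemma kc_lip : exists C r, 0 < C /\ 0 < r /\ forall (p p' : V) (t t' : R),
  norm (minus p p0) < r -> norm (minus p' p0) < r ->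
  Rabs (kc p t - kc p' t') <= C * (norm (minus p p') + Rabs (t - t')).
Proof.
  destruct en_bound as [M [HM HMb]].
  destruct (sder_lipschitz _ _ _ Hk) as [C [r [HC [Hr HL]]]].
  destruct (kc_near r Hr) as [r' [Hr' Hnear]].
  exists (C * (1 + M + M * r')), r'.
  split; [apply Rmult_lt_0_compat; nra|split; [exact Hr'|]].
  intros p p' t t' Hp Hp'.
  specialize (HL (p, en p * cos t) (p', en p' * cos t') (Hnear _ _ Hp) (Hnear _ _ Hp')).
  eapply Rle_trans; [exact HL|]. rewrite Rmult_assoc. apply Rmult_le_compat_l; [lra|].
  eapply Rle_trans; [apply norm_pair_le|].
  change (norm (minus p p') + Rabs (en p * cos t - en p' * cos t') <=
    (1 + M + M * r') * (norm (minus p p') + Rabs (t - t'))).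
  replace (en p * cos t - en p' * cos t') with
    ((en p - en p') * cos t + en p' * (cos t - cos t')) by ring.
  pose proof (Rabs_triang ((en p - en p') * cos t) (en p' * (cos t - cos t'))) as HT.
  rewrite !Rabs_mult in HT.
  pose proof (HMb p p') as H1. pose proof (HMb p' p0) as H2.
  rewrite Hen0, Rminus_0_r in H2.
  pose proof (cos_lip t t') as H3. pose proof (Rabs_cos_le t) as H4.
  assert (H5 : Rabs (en p - en p') * Rabs (cos t) <= M * norm (minus p p')).
  { generalize (Rabs_pos (en p - en p')) (Rabs_pos (cos t)). nra. }
  assert (H6 : Rabs (en p') * Rabs (cos t - cos t') <= M * r' * Rabs (t - t')).
  { apply Rmult_le_compat; try apply Rabs_pos; [|exact H3].
    apply Rle_trans with (1 := H2). apply Rmult_le_compat_l; lra. }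
  assert (H7 : 0 <= norm (minus p p')) by apply norm_ge_0.
  assert (H8 := Rabs_pos (t - t')).
  assert (0 < M * r') by (apply Rmult_lt_0_compat; assumption).
  nra.
Qed.

Lemma lip_continuous (f : R -> R) (C x : R) :
  (forall y, Rabs (f y - f x) <= C * Rabs (y - x)) -> continuous f x.
Proof.
  intros H. apply filterlim_locally. intros eps.
  assert (HC : 0 < Rabs C + 1) by (generalize (Rabs_pos C); lra).
  assert (Hd : 0 < eps / (Rabs C + 1)).
  { apply Rdiv_lt_0_compat; [apply cond_pos|exact HC]. }
  exists (mkposreal _ Hd). intros y Hy. change (Rabs (y - x) < eps / (Rabs C + 1)) in Hy.
  change (Rabs (f y - f x) < eps).
  apply (Rmult_lt_compat_r (Rabs C + 1)) in Hy; [|exact HC].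
  replace (eps / (Rabs C + 1) * (Rabs C + 1)) with (pos eps) in Hy by (field; lra).
  generalize (H y) (Rle_abs C) (Rabs_pos (y - x)). nra.
Qed.

Lemma kc_continuous : exists r, 0 < r /\
  forall (p : V) (t : R), norm (minus p p0) < r -> continuous (kc p) t.
Proof.
  destruct kc_lip as [C [r [HC [Hr H]]]]. exists r; split; [exact Hr|].
  intros p t Hp. apply (lip_continuous _ C). intros y.
  specialize (H p p y t Hp Hp).
  assert (E := norm_minus_eq p). rewrite E, Rplus_0_l in H. exact H.
Qed.

(** The integral over a half period is strictly differentiable; the variation
    of the argument [e cos t] contributes nothing, the cosine having mean
    zero. *)
Lemma sder_RInt_cos :
  sder (V := R_NormedModule) (fun p => RInt (kc p) 0 PI) p0
    (fun u => PI * lk (u, 0)).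
Proof.
  assert (Hpi := PI_RGT_0).
  destruct Hk as [Hlk HF].
  assert (Hlk' : exists c, forall (u : V) (s : R), lk (u, s) = lk (u, 0) + s * c).
  { exists (lk (zero, 1)). intros u s.
    replace ((u, s) : V * R) with
      (plus ((u, 0) : prod_NormedModule _ V R_NormedModule)
        (scal s ((zero, 1) : prod_NormedModule _ V R_NormedModule))).
    - pose proof (linear_plus (V := R_NormedModule) lk Hlk (u, 0) (scal s (zero, 1))) as E.
      pose proof (linear_scal (V := R_NormedModule) lk Hlk s (zero, 1)) as E2.
      etransitivity; [exact E|]. apply f_equal. exact E2.
    - change ((plus u (scal s zero), 0 + s * 1) = (u, s)).
      f_equal; [|ring]. transitivity (plus u (@zero V)); [|exact (plus_zero_r u)].
      f_equal. exact (scal_zero_r s). }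
  destruct Hlk' as [c Hlk']. split.
  { apply (is_linear_comp (V := R_NormedModule) (W := R_NormedModule)
      (fun u => lk (u, 0)) (fun x => scal PI x)).
    - apply (is_linear_comp (V := prod_NormedModule _ V R_NormedModule)
        (W := R_NormedModule) (fun u : V => (u, zero)) lk); [|exact Hlk].
      apply is_linear_prod; [apply is_linear_id|apply is_linear_zero].
    - apply (@is_linear_scal_r R_AbsRing R_NormedModule). intros; apply Rmult_comm. }
  intros eps Heps.
  destruct en_bound as [M [HM HMb]].
  destruct (HF (eps / (PI * (1 + M)))) as [r [Hr H]].
  { apply Rdiv_lt_0_compat; [exact Heps|apply Rmult_lt_0_compat; lra]. }
  destruct (kc_near r Hr) as [r1 [Hr1 Hnear]].
  destruct kc_continuous as [r2 [Hr2 Hcont]].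
  exists (Rmin r1 r2). split; [apply Rmin_pos; assumption|].
  intros p q Hp Hq. apply Rmin_Rgt_l in Hp, Hq.
  destruct Hp as [Hp1 Hp2], Hq as [Hq1 Hq2].
  set (u := minus p q : V).
  assert (Hi : forall p : V, norm (minus p p0) < r2 -> is_RInt (kc p) 0 PI (RInt (kc p) 0 PI)).
  { intros p' Hp'. apply (RInt_correct (V := R_CompleteNormedModule)).
    apply (ex_RInt_continuous (V := R_CompleteNormedModule)).
    intros; apply Hcont; exact Hp'. }
  assert (Hcos : is_RInt (fun t => lk (u, (en p - en q) * cos t)) 0 PI (PI * lk (u, 0))).
  { apply (is_RInt_ext (fun t => lk (u, 0) + (en p - en q) * c * cos t)).
    { intros t _. symmetry. etransitivity; [apply Hlk'|]. eqR. ring. }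
    replace (PI * lk (u, 0)) with
      (plus (scal (PI - 0) (lk (u, 0)))
         (scal ((en p - en q) * c) (minus (sin PI) (sin 0)))).
    - apply (is_RInt_plus (V := R_NormedModule)); [apply (is_RInt_const (V := R_NormedModule))|].
      apply (is_RInt_scal (V := R_NormedModule)).
      apply (is_RInt_derive sin cos).
      + intros; auto_derive; [trivial|ring].
      + intros; apply continuous_cos.
    - rewrite sin_PI, sin_0.
      change ((PI - 0) * lk (u, 0) + (en p - en q) * c * (0 - 0) = PI * lk (u, 0)).
      ring. }
  assert (Hall := is_RInt_minus (V := R_NormedModule) _ _ _ _ _ _
    (is_RInt_minus (V := R_NormedModule) _ _ _ _ _ _ (Hi p Hp2) (Hi q Hq2)) Hcos).
  refine (Rle_trans _ _ _ (norm_RInt_le_const (V := R_NormedModule) _ 0 PI _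
    (eps / (PI * (1 + M)) * ((1 + M) * norm u)) (Rlt_le _ _ Hpi) _ Hall) _).
  - intros t Ht. specialize (H (p, en p * cos t) (q, en q * cos t) (Hnear _ _ Hp1) (Hnear _ _ Hq1)).
    assert (E : lk (minus ((p, en p * cos t) : prod_NormedModule _ V R_NormedModule) (q, en q * cos t))
      = lk (u, (en p - en q) * cos t)).
    { f_equal. change ((minus p q, en p * cos t - en q * cos t) = (u, (en p - en q) * cos t)).
      f_equal. ring. }
    rewrite E in H.
    eapply Rle_trans; [exact H|]. apply Rmult_le_compat_l.
    { apply Rlt_le, Rdiv_lt_0_compat; [exact Heps|apply Rmult_lt_0_compat; lra]. }
    eapply Rle_trans; [apply norm_pair_le|].
    change (norm u + Rabs (en p * cos t - en q * cos t) <= (1 + M) * norm u).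
    replace (en p * cos t - en q * cos t) with ((en p - en q) * cos t) by ring.
    rewrite Rabs_mult. specialize (HMb p q). fold u in HMb.
    generalize (Rabs_cos_le t) (Rabs_pos (cos t)) (Rabs_pos (en p - en q)). nra.
  - apply Req_le. fold u. field. lra.
Qed.

End CosineIntegral.

(** * Nutations of a spherical top with prescribed periods *)

(** The height of the top oscillates as [x = h + e], [e = ep cos psi], about the
    mean turning height [h] with amplitude [ep], while [psi] and the azimuth
    obey [psi'^2 = B - 2 Om e] and [phi' = (M - a e) / (1 - x^2)].  Here [M] is
    the vertical angular momentum at height [h], expressed through the
    precession rate [om]; the angular velocity [Om] and the squared speed
    [E] at height [h] solve the linear system that makes
    [h - ep] and [h + ep] the turning heights: see [top_eq1] and [top_eq2]. *)
Definition top_M (om h : R) : R := om * (1 - h ^ 2).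
Definition top_D (h ep : R) : R := (1 - h ^ 2 - ep ^ 2) ^ 2 - 4 * h ^ 2 * ep ^ 2.
Definition top_Om (a om h ep : R) : R :=
  ((1 - h ^ 2 - ep ^ 2) * a * top_M om h
   - h * (top_M om h ^ 2 + ep ^ 2 * a ^ 2)) / top_D h ep.
Definition top_E (a om h ep : R) : R :=
  ((1 - h ^ 2 - ep ^ 2) * (top_M om h ^ 2 + ep ^ 2 * a ^ 2)
   - 4 * h * ep ^ 2 * a * top_M om h) / top_D h ep.
Definition top_B (a om h ep : R) : R :=
  top_E a om h ep - 4 * h * top_Om a om h ep + a ^ 2.
Definition top_rate2 (a om h ep e : R) : R :=
  top_B a om h ep - 2 * top_Om a om h ep * e.
(** The densities of time and of azimuth with respect to [psi]. *)
Definition top_k1 (a om h ep e : R) : R := / sqrt (top_rate2 a om h ep e).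
Definition top_k2 (a om h ep e : R) : R :=
  (top_M om h - a * e) / (1 - (h + e) ^ 2) * top_k1 a om h ep e.

(** The spaces of [(h, ep)], of [(om, (h, ep))] and of [((om, (h, ep)), e)]. *)
Definition V2 := prod_NormedModule _ R_NormedModule R_NormedModule.
Definition V3 := prod_NormedModule _ R_NormedModule V2.
Definition V4 := prod_NormedModule _ V3 R_NormedModule.

(** A function of [om], [h], [ep] and [e] as a function on [V4]. *)
Definition lift4 (g : R -> R -> R -> R -> R) (p : V4) : R :=
  g (fst (fst p)) (fst (snd (fst p))) (snd (snd (fst p))) (snd p).

Lemma lin4_1 : is_linear (U := V4) (V := R_NormedModule) (fun p => fst (fst p)).
Proof. apply (is_linear_comp (U := V4) (V := V3) (W := R_NormedModule) fst fst);
  [exact is_linear_fst|exact is_linear_fst]. Qed.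
Lemma lin4_2 : is_linear (U := V4) (V := R_NormedModule) (fun p => fst (snd (fst p))).
Proof.
  apply (is_linear_comp (U := V4) (V := V2) (W := R_NormedModule) (fun p => snd (fst p)) fst);
  [|exact is_linear_fst].
  apply (is_linear_comp (U := V4) (V := V3) (W := V2) fst snd);
  [exact is_linear_fst|exact is_linear_snd]. Qed.
Lemma lin4_3 : is_linear (U := V4) (V := R_NormedModule) (fun p => snd (snd (fst p))).
Proof.
  apply (is_linear_comp (U := V4) (V := V2) (W := R_NormedModule) (fun p => snd (fst p)) snd);
  [|exact is_linear_snd].
  apply (is_linear_comp (U := V4) (V := V3) (W := V2) fst snd);
  [exact is_linear_fst|exact is_linear_snd]. Qed.
Lemma lin4_4 : is_linear (U := V4) (V := R_NormedModule) (fun p => snd p).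
Proof. exact is_linear_snd. Qed.
Lemma lin3_3 : is_linear (U := V3) (V := R_NormedModule) (fun p => snd (snd p)).
Proof. apply (is_linear_comp (U := V3) (V := V2) (W := R_NormedModule) snd snd);
  [exact is_linear_snd|exact is_linear_snd]. Qed.

Lemma sd_pow2 {U : NormedModule R_AbsRing} (f : U -> R) x :
  sd f x -> sd (fun u => f u ^ 2) x.
Proof.
  intros H. simpl. apply sd_mult; [exact H|].
  apply sd_mult; [exact H|apply sd_const].
Qed.

(* Matching on the head operation avoids unfolding [Rminus] into [Rplus]. *)
Ltac sd_step :=
  lazymatch goal with
  | |- sd (fun u => @?f u - @?g u) ?x => apply (sd_minus f g x)
  | |- sd (fun u => @?f u + @?g u) ?x => apply (sd_plus f g x)
  | |- sd (fun u => @?f u / @?g u) ?x => apply (sd_div f g x)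
  | |- sd (fun u => @?f u * @?g u) ?x => apply (sd_mult f g x)
  | |- sd (fun u => @?f u ^ 2) ?x => apply (sd_pow2 f x)
  | |- sd (fun u => fst (fst u)) _ => apply sd_linear, lin4_1
  | |- sd (fun u => fst (snd (fst u))) _ => apply sd_linear, lin4_2
  | |- sd (fun u => snd (snd (fst u))) _ => apply sd_linear, lin4_3
  | |- sd (fun u => snd u) _ => apply sd_linear, lin4_4
  | |- sd (fun u => ?c) _ => apply sd_const
  end.
Ltac sd_tac := cbv beta; repeat (sd_step; cbv beta).

Section TopPeriods.

Context (a h0 mu : R).
Hypothesis Hmu : 0 < mu.
Hypothesis Hh0 : 0 < 1 - h0 ^ 2.
(* The small oscillations about the height [h0] have frequency [mu], and this
   frequency varies with the height. *)
Hypothesis Hdisp : 3 * h0 ^ 2 - 4 * a * h0 + a ^ 2 + 1 = mu ^ 2.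
Hypothesis Hslope : 3 * h0 <> 2 * a.

Let p3 : V3 := (1, (h0, 0)).
Let p4 : V4 := (p3, 0).

Lemma sd_D : sd (lift4 (fun _ h ep _ => top_D h ep)) p4.
Proof. unfold lift4, top_D. sd_tac. Qed.

Lemma top_D_0 h : top_D h 0 = (1 - h ^ 2) ^ 2.
Proof. unfold top_D. ring. Qed.

Lemma sd_Om : sd (lift4 (fun om h ep _ => top_Om a om h ep)) p4.
Proof.
  unfold lift4, top_Om, top_M. apply sd_div; [sd_tac|exact sd_D|].
  simpl. rewrite top_D_0. nra.
Qed.

Lemma sd_E : sd (lift4 (fun om h ep _ => top_E a om h ep)) p4.
Proof.
  unfold lift4, top_E, top_M. apply sd_div; [sd_tac|exact sd_D|].
  simpl. rewrite top_D_0. nra.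
Qed.

Lemma sd_rate2 : sd (lift4 (top_rate2 a)) p4.
Proof.
  unfold lift4, top_rate2, top_B.
  repeat first [exact sd_E | exact sd_Om | sd_step; cbv beta].
Qed.

Lemma top_Om_0 om h : 1 - h ^ 2 <> 0 -> top_Om a om h 0 = a * om - h * om ^ 2.
Proof. intros H. unfold top_Om. rewrite top_D_0. unfold top_M. field. exact H. Qed.

Lemma top_rate2_0 om h : 1 - h ^ 2 <> 0 ->
  top_rate2 a om h 0 0 = om ^ 2 * (1 + 3 * h ^ 2) - 4 * a * h * om + a ^ 2.
Proof.
  intros H. unfold top_rate2, top_B. rewrite top_Om_0 by exact H.
  unfold top_E. rewrite top_D_0. unfold top_M. field. exact H.
Qed.

Lemma top_rate2_base : top_rate2 a 1 h0 0 0 = mu ^ 2.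
Proof. rewrite top_rate2_0 by lra. rewrite <- Hdisp. ring. Qed.

Lemma sd_k1 : sd (lift4 (top_k1 a)) p4.
Proof.
  assert (H := top_rate2_base).
  assert (0 < mu ^ 2) by nra.
  unfold lift4, top_k1. apply sd_inv; [apply sd_sqrt; [exact sd_rate2|]|];
    simpl; rewrite H; [assumption|].
  apply Rgt_not_eq, sqrt_lt_R0. assumption.
Qed.

Lemma sd_k2 : sd (lift4 (top_k2 a)) p4.
Proof.
  unfold lift4, top_k2. apply sd_mult; [|exact sd_k1].
  apply sd_div; [unfold top_M; sd_tac|sd_tac|]. simpl. simpl in Hh0. lra.
Qed.

(** The half period of nutation, and the azimuthal advance during it. *)
Definition top_T (om h ep : R) : R :=
  RInt (fun t => top_k1 a om h ep (ep * cos t)) 0 PI.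
Definition top_Phi (om h ep : R) : R :=
  RInt (fun t => top_k2 a om h ep (ep * cos t)) 0 PI.

Lemma sd_RInt_lift4 (k : R -> R -> R -> R -> R) :
  sd (lift4 k) p4 ->
  sd (U := V3) (fun p => RInt (fun t => k (fst p) (fst (snd p)) (snd (snd p))
    (snd (snd p) * cos t)) 0 PI) p3.
Proof.
  intros [l Hl]. eexists.
  apply (sder_RInt_cos (lift4 k) (fun p : V3 => snd (snd p)) p3 l);
    [exact lin3_3|reflexivity|exact Hl].
Qed.

Lemma top_T0 om h : top_T om h 0 = PI * top_k1 a om h 0 0.
Proof.
  unfold top_T. rewrite (RInt_ext _ (fun _ => top_k1 a om h 0 0)).
  - rewrite RInt_const. change ((PI - 0) * top_k1 a om h 0 0 = PI * top_k1 a om h 0 0). ring.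
  - intros; rewrite Rmult_0_l; reflexivity.
Qed.

Lemma top_Phi0 om h : 1 - h ^ 2 <> 0 ->
  top_Phi om h 0 = PI * (om * top_k1 a om h 0 0).
Proof.
  intros H. unfold top_Phi. rewrite (RInt_ext _ (fun _ => om * top_k1 a om h 0 0)).
  - rewrite RInt_const.
    change ((PI - 0) * (om * top_k1 a om h 0 0) = PI * (om * top_k1 a om h 0 0)). ring.
  - intros; rewrite Rmult_0_l. unfold top_k2, top_M. rewrite Rplus_0_r, Rmult_0_r.
    f_equal. field. exact H.
Qed.

Lemma near_lt (f : R -> R) (x : R) : continuous f x -> 0 < f x ->
  exists r, 0 < r /\ forall y, Rabs (y - x) < r -> 0 < f y.
Proof.
  intros Hc Hp.
  assert (L : locally x (fun y => 0 < f y)).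
  { apply Hc. apply (open_gt 0). exact Hp. }
  destruct L as [d Hd]. exists d; split; [apply cond_pos|].
  intros y Hy. apply Hd. exact Hy.
Qed.

(** The precession rate for which azimuth and time advance equally; it is [1]
    at amplitude zero. *)
Lemma ex_om : exists (W : V2 -> R) lW, W (h0, 0) = 1 /\
  sder (U := V2) (V := R_NormedModule) W (h0, 0) lW /\
  exists r, 0 < r /\ forall q : V2, norm (minus q ((h0, 0) : V2)) < r ->
    top_Phi (W q) (fst q) (snd q) = top_T (W q) (fst q) (snd q) /\
    (snd q = 0 -> W q = 1).
Proof.
  pose (F := fun p : V3 => top_Phi (fst p) (fst (snd p)) (snd (snd p))
              - top_T (fst p) (fst (snd p)) (snd (snd p))).
  assert (Hsd : sd F p3).
  { apply sd_minus; [apply (sd_RInt_lift4 _ sd_k2)|apply (sd_RInt_lift4 _ sd_k1)]. }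
  destruct Hsd as [l Hl].
  destruct (near_lt (fun h => 1 - h ^ 2) h0) as [rh [Hrh Hpos]].
  { apply ex_derive_continuous_R. auto_derive; trivial. }
  { exact Hh0. }
  assert (HF1 : forall h, Rabs (h - h0) < rh -> F (1, (h, 0)) = 0).
  { intros h Hh. specialize (Hpos h Hh). unfold F; simpl.
    rewrite top_T0, top_Phi0 by (simpl in *; lra). ring. }
  destruct (implicit (V := V2) F 1 (h0, 0) l (PI / mu)) as [W [lW [HW0 [HW [r [Hr HWr]]]]]].
  - exact Hl.
  - apply HF1. rewrite Rminus_diag, Rabs_R0. exact Hrh.
  - apply (is_derive_ext (fun x => PI * (x - 1) *
      / sqrt (x ^ 2 * (1 + 3 * h0 ^ 2) - 4 * a * h0 * x + a ^ 2))).
    { intros t. unfold F. simpl fst. simpl snd.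
      rewrite top_T0, top_Phi0 by lra. unfold top_k1. rewrite top_rate2_0 by lra.
      eqR. ring. }
    assert (E : 1 ^ 2 * (1 + 3 * h0 ^ 2) - 4 * a * h0 * 1 + a ^ 2 = mu ^ 2).
    { rewrite <- Hdisp. ring. }
    assert (0 < mu ^ 2) by nra.
    auto_derive.
    + match goal with |- context [sqrt ?X] => replace X with (mu ^ 2) by (rewrite <- E; ring) end.
      split; [|split; [|trivial]]; [rewrite <- E in *; nra|].
      apply Rgt_not_eq, sqrt_lt_R0. assumption.
    + match goal with |- context [sqrt ?X] => replace X with (mu ^ 2) by (rewrite <- E; ring) end.
      rewrite sqrt_pow2 by lra. field. lra.
  - apply Rgt_not_eq, Rdiv_lt_0_compat; [apply PI_RGT_0|exact Hmu].
  - exists W, lW. split; [exact HW0|split; [exact HW|]].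
    exists (Rmin r rh). split; [apply Rmin_pos; assumption|].
    intros q Hq. apply Rmin_Rgt_l in Hq. destruct Hq as [Hq1 Hq2].
    destruct (HWr q Hq1) as [H1 H2]. split.
    + apply Rminus_diag_uniq. exact H1.
    + destruct q as [h ep]. simpl. intros ->. symmetry. apply H2.
      * rewrite Rminus_diag, Rabs_R0. exact Hr.
      * apply HF1. eapply Rle_lt_trans; [|exact Hq2].
        exact (norm_fst_le (U := R_NormedModule) (V := R_NormedModule) (minus ((h, 0) : V2) (h0, 0))).
Qed.

(** For every small amplitude [ep], a height and a precession rate for which
    both the nutation period and the azimuthal advance over it are
    [2 PI / mu]. *)
Lemma ex_top_params : exists om h : R -> R,
  om 0 = 1 /\ h 0 = h0 /\
  (exists l, sder (U := R_NormedModule) (V := V3) (fun ep => (om ep, (h ep, ep))) 0 l) /\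
  exists r, 0 < r /\ forall ep, Rabs ep < r ->
    top_T (om ep) (h ep) ep = PI / mu /\ top_Phi (om ep) (h ep) ep = PI / mu.
Proof.
  destruct ex_om as [W [lW [HW0 [HW [r [Hr HWr]]]]]].
  pose (F := fun q : V2 => top_T (W q) (fst q) (snd q) - PI / mu).
  assert (HWp : sder (U := V2) (V := V3) (fun q => (W q, q)) (h0, 0) (fun q => (lW q, q))).
  { apply (sder_pair (V := R_NormedModule) (W := V2)); [exact HW|].
    apply (sder_linear (fun q : V2 => q)), is_linear_id. }
  assert (Hsd : sd F (h0, 0)).
  { apply sd_minus; [|apply sd_const].
    apply (sd_comp (V := V3) (fun q : V2 => (W q, q))
      (fun p : V3 => top_T (fst p) (fst (snd p)) (snd (snd p))) (h0, 0) _ HWp).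
    rewrite HW0. apply (sd_RInt_lift4 _ sd_k1). }
  destruct Hsd as [l Hl].
  assert (Hmu2 : 0 < mu ^ 2) by nra.
  destruct (near_lt (fun h => 1 - h ^ 2) h0) as [rh [Hrh Hpos]].
  { apply ex_derive_continuous_R. auto_derive; trivial. }
  { exact Hh0. }
  assert (Hx : forall x, Rabs (x - h0) < Rmin rh r ->
    PI * / sqrt (1 + 3 * x ^ 2 - 4 * a * x + a ^ 2) - PI / mu = F (x, 0)).
  { intros x Hx. apply Rmin_Rgt_l in Hx. destruct Hx as [Hx1 Hx2].
    specialize (Hpos x Hx1). unfold F. 
    destruct (HWr (x, 0)) as [_ E].
    { eapply Rle_lt_trans; [apply (norm_pair_le (U := R_NormedModule) (V := R_NormedModule))|].
      change (Rabs (x - h0) + Rabs (0 - 0) < r). rewrite Rminus_diag, Rabs_R0. lra. }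
    rewrite E by reflexivity. simpl fst; simpl snd. rewrite top_T0. unfold top_k1.
    rewrite top_rate2_0 by lra. f_equal. f_equal. f_equal. f_equal. ring. }
  assert (Hb : 1 + 3 * h0 ^ 2 - 4 * a * h0 + a ^ 2 = mu ^ 2) by lra.
  destruct (implicit (V := R_NormedModule) F h0 0 l
    (- PI * (3 * h0 - 2 * a) / mu ^ 3)) as [h [lh [Hh00 [Hh [r2 [Hr2 Hhr]]]]]].
  - exact Hl.
  - rewrite <- Hx.
    + rewrite Hb, sqrt_pow2 by lra. field. lra.
    + rewrite Rminus_diag, Rabs_R0. apply Rmin_pos; assumption.
  - apply (is_derive_ext_loc (fun x => PI * / sqrt (1 + 3 * x ^ 2 - 4 * a * x + a ^ 2) - PI / mu)).
    { exists (mkposreal (Rmin rh r) (Rmin_pos _ _ Hrh Hr)). intros y Hy. apply Hx. exact Hy. }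
    auto_derive.
    + match goal with |- context [sqrt ?X] => replace X with (mu ^ 2) by (rewrite <- Hb; ring) end.
      split; [|split; [|trivial]]; [rewrite <- Hb in *; nra|].
      apply Rgt_not_eq, sqrt_lt_R0. assumption.
    + match goal with |- context [sqrt ?X] => replace X with (mu ^ 2) by (rewrite <- Hb; ring) end.
      rewrite sqrt_pow2 by lra. field. lra.
  - assert (0 < mu ^ 3) by (apply pow_lt; exact Hmu).
    intros E. apply (Rmult_eq_compat_r (mu ^ 3)) in E.
    unfold Rdiv in E. rewrite Rmult_assoc, Rinv_l, Rmult_0_l in E by lra.
    generalize PI_RGT_0; intros. assert (3 * h0 - 2 * a = 0) by nra. lra.
  - assert (Hq : sder (U := R_NormedModule) (V := V2) (fun ep => (h ep, ep)) 0 (fun u => (lh u, u))).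
    { apply (sder_pair (V := R_NormedModule) (W := R_NormedModule)); [exact Hh|].
      apply (sder_linear (fun q : R_NormedModule => q)), is_linear_id. }
    assert (Hp : sder (U := R_NormedModule) (V := V3) (fun ep => (W (h ep, ep), (h ep, ep))) 0
       (fun u => (lW (lh u, u), (lh u, u)))).
    { rewrite <- Hh00 in HWp at 1.
      exact (sder_comp (U := R_NormedModule) (V := V2) (W := V3)
        (fun ep => (h ep, ep)) (fun q => (W q, q)) 0
        (fun u => (lh u, u)) (fun q => (lW q, q)) Hq HWp). }
    destruct (sder_lipschitz _ _ _ Hq) as [C [r3 [HC [Hr3 HL]]]].
    exists (fun ep => W (h ep, ep)), h.
    split; [rewrite Hh00; exact HW0|split; [exact Hh00|]].
    split; [eexists; exact Hp|].
    exists (Rmin r2 (Rmin r3 (r / C))).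
    split; [repeat apply Rmin_pos; try assumption; apply Rdiv_lt_0_compat; assumption|].
    intros ep Hep. apply Rmin_Rgt_l in Hep. destruct Hep as [He2 Hep].
    apply Rmin_Rgt_l in Hep. destruct Hep as [He3 Hep].
    assert (N : forall t : R, norm (minus (t : R_NormedModule) 0) = Rabs t).
    { intros t. change (Rabs (t - 0) = Rabs t). rewrite Rminus_0_r. reflexivity. }
    destruct (Hhr ep) as [H1 _]; [rewrite N; exact He2|].
    apply Rminus_diag_uniq in H1. simpl in H1.
    destruct (HWr (h ep, ep)) as [H2 _].
    { specialize (HL ep 0). rewrite !N, Rabs_R0, Hh00 in HL. 
      specialize (HL He3 Hr3).
      eapply Rle_lt_trans; [exact HL|].
      apply Rgt_lt, (Rmult_lt_compat_l C) in Hep; [|exact HC].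
      replace (C * (r / C)) with r in Hep by (field; lra). exact Hep. }
    simpl in H2. split; [exact H1|]. etransitivity; [exact H2|exact H1].
Qed.

End TopPeriods.

(** * Primitives and their inverses, with a parameter *)

(** Continuity in the pair of the parameter and the variable. *)
Definition jcont (f : R -> R -> R) (e s : R) : Prop :=
  continuous (fun p : R * R => f (fst p) (snd p)) (e, s).

(** Continuity in the variable, and a Lipschitz bound in the parameter. *)
Lemma jcont_intro (f : R -> R -> R) e s C r :
  0 < r -> continuous (f e) s ->
  (forall e' s', Rabs (e' - e) < r -> 
     Rabs (f e' s' - f e s') <= C * Rabs s' * Rabs (e' - e)) ->
  jcont f e s.
Proof.
  intros Hr Hc H. apply filterlim_locally. intros eps.
  assert (He2 : 0 < eps / 2) by (generalize (cond_pos eps); lra).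
  assert (L : locally s (fun s' => Rabs (f e s' - f e s) < eps / 2)).
  { apply (Hc (fun y => Rabs (y - f e s) < eps / 2)). exists (mkposreal _ He2). intros y Hy; exact Hy. }
  destruct L as [d Hd].
  pose (C' := (Rabs C + 1) * (Rabs s + 1)).
  assert (HC' : 0 < C').
  { unfold C'. generalize (Rabs_pos C) (Rabs_pos s); intros. apply Rmult_lt_0_compat; lra. }
  assert (Hq : 0 < eps / 2 / C') by (apply Rdiv_lt_0_compat; assumption).
  assert (Hm : 0 < Rmin (Rmin d 1) (Rmin r (eps / 2 / C'))).
  { repeat apply Rmin_pos; try assumption; [apply cond_pos|lra]. }
  exists (mkposreal _ Hm). intros [e' s'] [H1 H2]. simpl in H1, H2 |- *.
  change (Rabs (e' - e) < Rmin (Rmin d 1) (Rmin r (eps / 2 / C'))) in H1.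
  change (Rabs (s' - s) < Rmin (Rmin d 1) (Rmin r (eps / 2 / C'))) in H2.
  change (Rabs (f e' s' - f e s) < eps).
  apply Rmin_Rgt_l in H1, H2. destruct H1 as [_ H1], H2 as [H2 _].
  apply Rmin_Rgt_l in H1, H2. destruct H1 as [H1 H3], H2 as [H2 H4].
  specialize (H e' s' H1). specialize (Hd s' H2). cbv beta in Hd.
  assert (Hs' : Rabs s' <= Rabs s + 1).
  { replace s' with ((s' - s) + s) by ring.
    eapply Rle_trans; [apply Rabs_triang|]. lra. }
  assert (HB : C * Rabs s' * Rabs (e' - e) <= C' * Rabs (e' - e)).
  { apply Rmult_le_compat_r; [apply Rabs_pos|]. unfold C'.
    generalize (Rle_abs C) (Rabs_pos C) (Rabs_pos s') (Rabs_pos s); intros.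
    apply Rle_trans with (Rabs C * Rabs s'); nra. }
  apply Rgt_lt, (Rmult_lt_compat_l C') in H3; [|exact HC'].
  replace (C' * (eps / 2 / C')) with (eps / 2) in H3 by (field; lra).
  replace (f e' s' - f e s) with ((f e' s' - f e s') + (f e s' - f e s)) by ring.
  eapply Rle_lt_trans; [apply Rabs_triang|]. lra.
Qed.

Lemma is_derive_continuity_pt (f : R -> R) x l :
  is_derive f x l -> continuity_pt f x.
Proof.
  intros H. apply continuity_pt_filterlim.
  apply (ex_derive_continuous (K := R_AbsRing) (V := R_NormedModule) f).
  exists l. exact H.
Qed.

(** The primitive vanishing at [0]. *)
Definition prim (k : R -> R) (x : R) : R := RInt k 0 x.

Lemma prim_derive (k : R -> R) x : (forall t, continuous k t) ->
  is_derive (prim k) x (k x).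
Proof.
  intros Hk. apply (is_derive_RInt (V := R_NormedModule) k (prim k) 0 x); [|apply Hk].
  apply filter_forall. intros y. apply (RInt_correct (V := R_CompleteNormedModule)).
  apply (ex_RInt_continuous (V := R_CompleteNormedModule)). intros; apply Hk.
Qed.

(** Two functions with the same derivative and a common value agree. *)
Lemma eq_of_derive (f g f' : R -> R) :
  (forall x, is_derive f x (f' x)) -> (forall x, is_derive g x (f' x)) ->
  forall x0, f x0 = g x0 -> forall x, f x = g x.
Proof.
  intros Hf Hg x0 H0 x.
  assert (Hd : forall t, is_derive (fun t => f t - g t) t 0).
  { intros t. replace 0 with (minus (f' t) (f' t)) by (apply (minus_eq_zero (G := R_AbelianGroup))).
    apply (is_derive_minus (V := R_NormedModule)); [apply Hf|apply Hg]. }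
  destruct (MVT_gen (fun t => f t - g t) x0 x (fun _ => 0)) as [c [_ Hc]].
  - intros; apply Hd.
  - intros. eapply is_derive_continuity_pt, Hd.
  - rewrite Rmult_0_l, H0 in Hc. lra.
Qed.

Lemma prim_0 k : prim k 0 = 0.
Proof. apply (RInt_point (V := R_CompleteNormedModule)). Qed.

Lemma is_derive_neg (f : R -> R) x l :
  is_derive f (- x) l -> is_derive (fun t => f (- t)) x (- l).
Proof.
  intros H. replace (- l) with (scal (-1) l) by (change (-1 * l = - l); ring).
  apply (is_derive_comp (V := R_NormedModule) f (fun t => - t)); [exact H|].
  auto_derive; [trivial|ring].
Qed.

Lemma is_derive_shift (f : R -> R) c x l :
  is_derive f (x + c) l -> is_derive (fun t => f (t + c)) x l.
Proof.
  intros H. replace l with (scal 1 l) by (change (1 * l = l); ring).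
  apply (is_derive_comp (V := R_NormedModule) f (fun t => t + c)); [exact H|].
  auto_derive; [trivial|ring].
Qed.

Lemma prim_odd k : (forall t, continuous k t) -> (forall t, k (- t) = k t) ->
  forall x, prim k (- x) = - prim k x.
Proof.
  intros Hk He. 
  apply (eq_of_derive _ _ (fun x => - k x)) with (x0 := 0).
  - intros x. apply is_derive_neg. rewrite <- (He x). apply prim_derive; exact Hk.
  - intros x. apply (is_derive_opp (V := R_NormedModule)), prim_derive, Hk.
  - rewrite Ropp_0, prim_0. ring.
Qed.

(** The increment over a full period is twice the integral over half of it. *)
Lemma prim_shift k P : (forall t, continuous k t) -> (forall t, k (- t) = k t) ->
  (forall t, k (t + 2 * P) = k t) ->
  forall x, prim k (x + 2 * P) = prim k x + 2 * prim k P.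
Proof.
  intros Hk He Hp.
  apply (eq_of_derive _ _ k) with (x0 := - P).
  - intros x. apply is_derive_shift. rewrite <- (Hp x). apply prim_derive; exact Hk.
  - intros x. replace (k x) with (plus (k x) 0) by apply (plus_zero_r (k x)).
    apply (is_derive_plus (V := R_NormedModule)); [apply prim_derive, Hk|].
    apply (is_derive_const (V := R_NormedModule)).
  - rewrite prim_odd by assumption. replace (- P + 2 * P) with P by ring. ring.
Qed.

Lemma prim_param (k : R -> R -> R) C e e' x :
  (forall t, continuous (k e) t) -> (forall t, continuous (k e') t) ->
  (forall t, Rabs (k e' t - k e t) <= C * Rabs (e' - e)) ->
  Rabs (prim (k e') x - prim (k e) x) <= C * Rabs x * Rabs (e' - e).
Proof.
  intros H1 H2 H.
  destruct (MVT_gen (fun t => prim (k e') t - prim (k e) t) 0 x (fun t => k e' t - k e t))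
    as [c [_ Hc]].
  - intros t _. apply (is_derive_minus (V := R_NormedModule)); apply prim_derive; assumption.
  - intros t _. eapply is_derive_continuity_pt; apply (is_derive_minus (V := R_NormedModule)); apply prim_derive; assumption.
  - rewrite !prim_0 in Hc. replace (prim (k e') x - prim (k e) x) with
     ((k e' c - k e c) * (x - 0)) by lra.
    rewrite Rabs_mult, Rminus_0_r. specialize (H c). generalize (Rabs_pos x). nra.
Qed.

Section Inverse.

Context (k : R -> R) (c : R).
Hypothesis Hc : 0 < c.
Hypothesis Hk : forall t, continuous k t.
Hypothesis Hkc : forall t, c <= k t.

Lemma prim_expand x y : c * Rabs (x - y) <= Rabs (prim k x - prim k y).
Proof.
  destruct (MVT_gen (prim k) y x k) as [t [_ Ht]].
  - intros; apply prim_derive, Hk.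
  - intros. eapply is_derive_continuity_pt; apply prim_derive, Hk.
  - rewrite Ht, Rabs_mult. apply Rmult_le_compat_r; [apply Rabs_pos|].
    specialize (Hkc t). rewrite Rabs_pos_eq; lra.
Qed.

Lemma prim_surj s : exists x, prim k x = s.
Proof.
  pose (N := Rabs s / c). 
  assert (HN : 0 <= N) by (apply Rdiv_le_0_compat; [apply Rabs_pos|exact Hc]).
  assert (Hm : forall x, 0 <= x -> c * x <= prim k x).
  { intros x Hx. destruct (MVT_gen (prim k) 0 x k) as [t [_ Ht]].
    - intros; apply prim_derive, Hk.
    - intros. eapply is_derive_continuity_pt; apply prim_derive, Hk.
    - rewrite prim_0 in Ht. specialize (Hkc t). nra. }
  assert (Hm' : forall x, x <= 0 -> prim k x <= c * x).
  { intros x Hx. destruct (MVT_gen (prim k) 0 x k) as [t [_ Ht]].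
    - intros; apply prim_derive, Hk.
    - intros. eapply is_derive_continuity_pt; apply prim_derive, Hk.
    - rewrite prim_0 in Ht. specialize (Hkc t). nra. }
  destruct (IVT_gen (prim k) (- N) N s) as [x [_ Hx]].
  - intros t. eapply is_derive_continuity_pt; apply prim_derive, Hk.
  - specialize (Hm N HN). specialize (Hm' (- N) ltac:(lra)).
    assert (E : c * N = Rabs s) by (unfold N; field; lra).
    generalize (Rle_abs s) (Rle_abs (- s)). rewrite Rabs_Ropp. intros.
    rewrite Rmin_left, Rmax_right by lra. lra.
  - exists x; exact Hx.
Qed.

(** The inverse of the primitive, which is a bijection of [R] since [k] is
    bounded below by [c]. *)
Definition prim_inv (s : R) : R := epsilon (inhabits 0) (fun x => prim k x = s).

Lemma prim_invK s : prim k (prim_inv s) = s.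
Proof. apply (epsilon_spec (inhabits 0) (fun x => prim k x = s)), prim_surj. Qed.

Lemma prim_inj x y : prim k x = prim k y -> x = y.
Proof.
  intros E. generalize (prim_expand x y). rewrite E, Rminus_diag, Rabs_R0.
  intros H. destruct (Req_dec x y) as [Hxy|Hxy]; [exact Hxy|].
  assert (0 < Rabs (x - y)) by (apply Rabs_pos_lt; lra). nra.
Qed.

Lemma prim_inv_lip s t : Rabs (prim_inv s - prim_inv t) <= / c * Rabs (s - t).
Proof.
  generalize (prim_expand (prim_inv s) (prim_inv t)). rewrite !prim_invK. intros H.
  apply (Rmult_le_reg_l c); [exact Hc|]. rewrite <- Rmult_assoc, Rinv_r, Rmult_1_l by lra.
  exact H.
Qed.

Lemma prim_inv_derive s : is_derive prim_inv s (/ k (prim_inv s)).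
Proof.
  set (x := prim_inv s).
  assert (Hkx : c <= k x) by apply Hkc.
  split; [apply is_linear_scal_l|].
  intros t Ht. apply (is_filter_lim_locally_unique (V := R_NormedModule)) in Ht. subst t.
  intros eps.
  assert (Hd := prim_derive k x Hk). destruct Hd as [_ Hd].
  assert (He : 0 < eps * (c * c)).
  { apply Rmult_lt_0_compat; [apply cond_pos|nra]. }
  specialize (Hd x (fun P H => H) (mkposreal _ He)). destruct Hd as [d Hd].
  assert (Hd2 : 0 < d * c) by (apply Rmult_lt_0_compat; [apply cond_pos|exact Hc]).
  exists (mkposreal _ Hd2). intros y Hy. change (Rabs (y - s) < d * c) in Hy.
  change (Rabs (prim_inv y - x - (y - s) * / k x) <= eps * Rabs (y - s)).
  assert (HL := prim_inv_lip y s). fold x in HL.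
  assert (Hb : Rabs (prim_inv y - x) < d).
  { eapply Rle_lt_trans; [exact HL|]. apply (Rmult_lt_reg_l c); [exact Hc|].
    rewrite <- Rmult_assoc, Rinv_r, Rmult_1_l by lra. lra. }
  specialize (Hd (prim_inv y) Hb).
  change (Rabs (prim k (prim_inv y) - prim k x - (prim_inv y - x) * k x)
    <= eps * (c * c) * Rabs (prim_inv y - x)) in Hd.
  rewrite prim_invK in Hd. unfold x at 1 in Hd. rewrite prim_invK in Hd.
  replace (prim_inv y - x - (y - s) * / k x) with
    (- / k x * (y - s - (prim_inv y - x) * k x)) by (field; lra).
  rewrite Rabs_mult, Rabs_Ropp, Rabs_inv, (Rabs_pos_eq (k x)) by lra.
  assert (Hik : 0 < / k x <= / c).
  { split; [apply Rinv_0_lt_compat; lra|apply Rinv_le_contravar; lra]. }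
  apply Rle_trans with (/ c * (eps * (c * c) * (/ c * Rabs (y - s)))).
  - apply Rmult_le_compat; [lra|apply Rabs_pos|lra|].
    eapply Rle_trans; [exact Hd|]. apply Rmult_le_compat_l; [lra|exact HL].
  - apply Req_le. field. lra.
Qed.

Lemma prim_inv_odd : (forall t, k (- t) = k t) -> forall s, prim_inv (- s) = - prim_inv s.
Proof.
  intros He s. apply prim_inj. rewrite prim_invK, prim_odd, prim_invK by assumption.
  reflexivity.
Qed.

Lemma prim_inv_shift P : (forall t, k (- t) = k t) ->
  (forall t, k (t + 2 * P) = k t) ->
  forall s, prim_inv (s + 2 * prim k P) = prim_inv s + 2 * P.
Proof.
  intros He Hp s. apply prim_inj. rewrite prim_invK, prim_shift, prim_invK by assumption.
  reflexivity.
Qed.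

End Inverse.

(** The inverse depends on the parameter in a Lipschitz way. *)
Lemma prim_inv_param (k : R -> R -> R) c C e e' s : 0 < c ->
  (forall t, continuous (k e) t) -> (forall t, continuous (k e') t) ->
  (forall t, c <= k e t) -> (forall t, c <= k e' t) ->
  (forall t, Rabs (k e' t - k e t) <= C * Rabs (e' - e)) ->
  Rabs (prim_inv (k e') s - prim_inv (k e) s) <= / c * C * / c * Rabs s * Rabs (e' - e).
Proof.
  intros Hc H1 H2 Hc1 Hc2 H.
  set (x := prim_inv (k e) s).
  assert (Hx : Rabs x <= / c * Rabs s).
  { assert (E0 : prim_inv (k e) 0 = 0).
    { apply (prim_inj (k e) c Hc H1 Hc1). rewrite (prim_invK (k e) c) by assumption.
      symmetry; apply prim_0. }
    generalize (prim_inv_lip (k e) c Hc H1 Hc1 s 0). rewrite E0, !Rminus_0_r.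
    intros HH; exact HH. }
  assert (HE := prim_expand (k e') c Hc H2 Hc2 (prim_inv (k e') s) x).
  rewrite (prim_invK (k e') c) in HE by assumption.
  assert (Hs : s = prim (k e) x) by (symmetry; apply (prim_invK (k e) c); assumption).
  rewrite Hs in HE at 2. rewrite Rabs_minus_sym in HE.
  rewrite Rabs_minus_sym in HE.
  assert (HP := prim_param k C e e' x H1 H2 H). rewrite Rabs_minus_sym in HP.
  assert (HC : 0 <= C * Rabs (e' - e)).
  { eapply Rle_trans; [apply Rabs_pos|apply (H 0)]. }
  apply (Rmult_le_reg_l c); [exact Hc|].
  eapply Rle_trans; [exact HE|]. eapply Rle_trans; [exact HP|].
  replace (c * (/ c * C * / c * Rabs s * Rabs (e' - e))) with
    ((C * Rabs (e' - e)) * (/ c * Rabs s)) by (field; lra).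
  replace (C * Rabs x * Rabs (e' - e)) with ((C * Rabs (e' - e)) * Rabs x) by ring.
  apply Rmult_le_compat_l; assumption.
Qed.

(** * Complex-valued functions of a real variable *)

(** [l] is the derivative at [t] of the curve [f], read on components. *)
Definition Cder (f : R -> C) (t : R) (l : C) : Prop :=
  is_derive (fun x => Re (f x)) t (Re l) /\ is_derive (fun x => Im (f x)) t (Im l).

(** Joint continuity of a complex-valued family, read on components. *)
Definition jcontC (f : R -> R -> C) (e s : R) : Prop :=
  jcont (fun e s => Re (f e s)) e s /\ jcont (fun e s => Im (f e s)) e s.

Lemma Cder_const (c : C) t : Cder (fun _ => c) t (RtoC 0).
Proof. split; apply (is_derive_const (V := R_NormedModule)). Qed.

Lemma Cder_plus f g t l m : Cder f t l -> Cder g t m ->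
  Cder (fun x => f x + g x)%C t (l + m)%C.
Proof.
  intros [H1 H2] [H3 H4]. split; apply (is_derive_plus (V := R_NormedModule)); assumption.
Qed.

Lemma is_derive_mult_R (f g : R -> R) t l m : is_derive f t l -> is_derive g t m ->
  is_derive (fun x => f x * g x) t (l * g t + f t * m).
Proof. intros H1 H2. apply (is_derive_mult f g); [exact H1|exact H2|intros; apply Rmult_comm]. Qed.

Lemma Cder_mult f g t l m : Cder f t l -> Cder g t m ->
  Cder (fun x => f x * g x)%C t (l * g t + f t * m)%C.
Proof.
  intros [H1 H2] [H3 H4]. split.
  - pose proof (is_derive_minus (V := R_NormedModule) _ _ _ _ _
      (is_derive_mult_R _ _ _ _ _ H1 H3) (is_derive_mult_R _ _ _ _ _ H2 H4)) as H.
    match type of H with is_derive _ _ ?d => replace (Re (l * g t + f t * m)%C) with d end;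
      [exact H|].
    destruct l, m, (f t), (g t). unfold Re, Im, minus, plus, opp; simpl. ring.
  - pose proof (is_derive_plus (V := R_NormedModule) _ _ _ _ _
      (is_derive_mult_R _ _ _ _ _ H1 H4) (is_derive_mult_R _ _ _ _ _ H2 H3)) as H.
    match type of H with is_derive _ _ ?d => replace (Im (l * g t + f t * m)%C) with d end;
      [exact H|].
    destruct l, m, (f t), (g t). unfold Re, Im, minus, plus, opp; simpl. ring.
Qed.

Lemma Cder_RtoC (g : R -> R) t d : is_derive g t d -> Cder (fun x => RtoC (g x)) t (RtoC d).
Proof. intros H. split; [exact H|]. apply (is_derive_const (V := R_NormedModule) (0 : R)). Qed.

Lemma Cder_comp f (g : R -> R) t l d : Cder f (g t) l -> is_derive g t d ->
  Cder (fun x => f (g x)) t (RtoC d * l)%C.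
Proof.
  intros [H1 H2] H. split.
  - replace (Re (RtoC d * l)%C) with (scal d (Re l)).
    + apply (is_derive_comp (V := R_NormedModule) (fun x => Re (f x)) g); assumption.
    + destruct l; unfold Re, scal; simpl; unfold mult; simpl; ring.
  - replace (Im (RtoC d * l)%C) with (scal d (Im l)).
    + apply (is_derive_comp (V := R_NormedModule) (fun x => Im (f x)) g); assumption.
    + destruct l; unfold Im, scal; simpl; unfold mult; simpl; ring.
Qed.

Lemma Cder_cis t : Cder cis t (Ci * cis t)%C.
Proof.
  split; unfold Re, Im; simpl; auto_derive; trivial; ring.
Qed.

Lemma Cder_eq f t l l' : Cder f t l -> l = l' -> Cder f t l'.
Proof. intros H <-; exact H. Qed.

Lemma cis_plus s t : cis (s + t) = (cis s * cis t)%C.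
Proof. unfold cis, Cmult; simpl. rewrite cos_plus, sin_plus. f_equal; ring. Qed.

Lemma cis_conj s : Cconj (cis s) = cis (- s).
Proof. unfold cis, Cconj; simpl. rewrite cos_neg, sin_neg. reflexivity. Qed.

Lemma cis_0 : cis 0 = RtoC 1.
Proof. unfold cis. rewrite cos_0, sin_0. reflexivity. Qed.

Lemma cis_mult_neg s : (cis s * cis (- s))%C = RtoC 1.
Proof. rewrite <- cis_plus, Rplus_opp_r. apply cis_0. Qed.

(** * The motion of the top *)

(** The equation of a travelling and rotating wave, for a curve [z] with first
    and second derivatives [z1] and [z2]. *)
Definition wave_eq (a Om : R) (z z1 z2 : C) : Prop :=
  (RtoC Om * z + Ci * RtoC a * z1 - z2
   + RtoC 2 * Cconj z * z1 ^ 2 / (RtoC 1 + z * Cconj z))%C = RtoC 0.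

(** The two linear equations say that the polynomials of degree three
    [(ep^2 - e^2) (B - 2 Om e)] and [(1 - (h + e)^2) (E - 2 Om e) - (M - a e)^2]
    in [e] coincide. *)
Lemma top_eq1 a om h ep : top_D h ep <> 0 ->
  h * top_E a om h ep + (1 - h ^ 2 - ep ^ 2) * top_Om a om h ep = a * top_M om h.
Proof. intros H. unfold top_E, top_Om. unfold top_D in *. field. exact H. Qed.

Lemma top_eq2 a om h ep : top_D h ep <> 0 ->
  (1 - h ^ 2 - ep ^ 2) * top_E a om h ep + 4 * h * ep ^ 2 * top_Om a om h ep
  = top_M om h ^ 2 + ep ^ 2 * a ^ 2.
Proof. intros H. unfold top_E, top_Om. unfold top_D in *. field. exact H. Qed.

Section Motion.

Context (a om h ep : R) (psi phi : R -> R).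

Let Om := top_Om a om h ep.
Let En := top_E a om h ep.
Let M := top_M om h.
Let e (s : R) := ep * cos (psi s).
Let x (s : R) := h + e s.
Let q (s : R) := sqrt (top_rate2 a om h ep (e s)).
Let J (s : R) := M - a * e s.
Let w (s : R) := 1 - x s ^ 2.

Hypothesis HD : top_D h ep <> 0.
Hypothesis Hrate : forall s, 0 < top_rate2 a om h ep (e s).
Hypothesis Hw : forall s, 0 < w s.
Hypothesis Hpsi : forall s, is_derive psi s (q s).
Hypothesis Hphi : forall s, is_derive phi s (J s / w s).

Let xp (s : R) := - ep * sin (psi s) * q s.
Let xpp (s : R) := - e s * (top_B a om h ep - 2 * Om * e s) - Om * (ep ^ 2 - e s ^ 2).

Lemma is_derive_eq (f : R -> R) (t l l' : R) : is_derive f t l -> l = l' -> is_derive f t l'.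
Proof. intros H <-; exact H. Qed.

Lemma e_derive s : is_derive e s (xp s).
Proof.
  unfold e. eapply is_derive_eq.
  - auto_derive; [exists (q s); apply Hpsi|reflexivity].
  - change (Derive (fun x0 => psi x0) s) with (Derive psi s).
    rewrite (is_derive_unique psi s (q s)) by apply Hpsi.
    unfold xp. ring.
Qed.

Lemma x_derive s : is_derive x s (xp s).
Proof.
  unfold x. eapply is_derive_eq.
  - apply (is_derive_plus (V := R_NormedModule) (fun _ => h) e);
      [apply (is_derive_const (V := R_NormedModule))|apply e_derive].
  - apply (plus_zero_l (G := R_AbelianGroup)).
Qed.

Lemma q_derive s : is_derive q s (Om * ep * sin (psi s)).
Proof.
  assert (Hq := sqrt_lt_R0 _ (Hrate s)).
  assert (He := e_derive s).
  unfold q, top_rate2. eapply is_derive_eq.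
  - auto_derive; [split; [exists (xp s); exact He|split; [|trivial]]|reflexivity].
    generalize (Hrate s). unfold top_rate2, Om. lra.
  - change (Derive (fun x0 => e x0) s) with (Derive e s).
    rewrite (is_derive_unique _ _ _ He). unfold xp. fold Om.
    unfold q. unfold top_rate2 at 1. fold Om.
    unfold top_rate2 in Hq; fold Om in Hq.
    match goal with |- context [sqrt ?X] => match goal with |- context [/ (2 * sqrt ?Y)] => replace Y with X by ring end end.
    field. lra.
Qed.

Lemma xp_derive s : is_derive xp s (xpp s).
Proof.
  assert (Hq := q_derive s).
  unfold xp. eapply is_derive_eq.
  - apply is_derive_mult_R; [|exact Hq].
    auto_derive; [exists (q s); apply Hpsi|reflexivity].
  - change (Derive (fun x0 => psi x0) s) with (Derive psi s).
    rewrite (is_derive_unique psi s (q s)) by apply Hpsi.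
    assert (Hq2 : q s * q s = top_rate2 a om h ep (e s)).
    { apply sqrt_sqrt. generalize (Hrate s); lra. }
    assert (Hs : ep ^ 2 - e s ^ 2 = ep ^ 2 * sin (psi s) ^ 2).
    { unfold e. generalize (sin2_cos2 (psi s)). unfold Rsqr. intros E.
      replace (ep ^ 2) with (ep ^ 2 * (sin (psi s) * sin (psi s) + cos (psi s) * cos (psi s))) at 1
        by (rewrite E; ring). ring. }
    unfold xpp. rewrite Hs. change (top_B a om h ep - 2 * Om * e s) with (top_rate2 a om h ep (e s)).
    rewrite <- Hq2. unfold e. ring.
Qed.

(** Conservation of energy. *)
Lemma top_energy s : xp s ^ 2 + J s ^ 2 = w s * (En - 2 * Om * e s).
Proof.
  assert (Hq2 : q s ^ 2 = top_rate2 a om h ep (e s)).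
  { simpl. rewrite Rmult_1_r. apply sqrt_sqrt. generalize (Hrate s); lra. }
  assert (Hs : (- ep * sin (psi s)) ^ 2 = ep ^ 2 - e s ^ 2).
  { unfold e. generalize (sin2_cos2 (psi s)). unfold Rsqr. intros E.
    replace (ep ^ 2) with (ep ^ 2 * (sin (psi s) * sin (psi s) + cos (psi s) * cos (psi s))) at 1
      by (rewrite E; ring). ring. }
  unfold xp. rewrite Rpow_mult_distr, Hs, Hq2.
  assert (H1 := top_eq1 a om h ep HD). assert (H2 := top_eq2 a om h ep HD).
  unfold top_rate2, top_B, J, w, x. fold M Om En in H1, H2 |- *.
  generalize (e s). intros y.
  apply Rminus_diag_uniq.
  transitivity ((M ^ 2 + ep ^ 2 * a ^ 2 - ((1 - h ^ 2 - ep ^ 2) * En + 4 * h * ep ^ 2 * Om))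
    + 2 * y * (h * En + (1 - h ^ 2 - ep ^ 2) * Om - a * M)).
  - ring.
  - rewrite H1, H2. ring.
Qed.

(** The second-order equation for the height. *)
Lemma top_height s : Om * w s - a * J s + xpp s + x s * (En - 2 * Om * e s) = 0.
Proof.
  assert (H1 := top_eq1 a om h ep HD).
  unfold xpp, top_B, J, w, x. fold M Om En in H1 |- *.
  generalize (e s). intros y.
  transitivity (h * En + (1 - h ^ 2 - ep ^ 2) * Om - a * M); [ring|].
  rewrite H1. ring.
Qed.

(** The curve [top_z] is the stereographic projection of the point at height
    [x] and azimuth [phi].  Its logarithmic derivative [top_mu] satisfies the
    Riccati equation [mu' = Om + i a mu - x mu^2], which is the wave equation
    divided by [z]. *)
Definition top_mu (s : R) : C := (- xp s / w s, J s / w s).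
Definition top_z (s : R) : C := (RtoC (sqrt ((1 - x s) / (1 + x s))) * cis (phi s))%C.
Definition top_z1 (s : R) : C := (top_mu s * top_z s)%C.
Definition top_mu1 (s : R) : C :=
  (RtoC Om + Ci * RtoC a * top_mu s - RtoC (x s) * top_mu s ^ 2)%C.
Definition top_z2 (s : R) : C := ((top_mu s ^ 2 + top_mu1 s) * top_z s)%C.

Lemma x_bounds s : 0 < 1 - x s /\ 0 < 1 + x s.
Proof. generalize (Hw s). unfold w. intros H. split; nra. Qed.

Lemma top_z_derive s : Cder top_z s (top_z1 s).
Proof.
  destruct (x_bounds s) as [Hx1 Hx2]. assert (Hws := Hw s). assert (Hx := x_derive s).
  assert (Hpos : 0 < (1 - x s) / (1 + x s)) by (apply Rdiv_lt_0_compat; assumption).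
  assert (Hsq := sqrt_lt_R0 _ Hpos).
  assert (Hr : is_derive (fun s => sqrt ((1 - x s) / (1 + x s))) s
    (sqrt ((1 - x s) / (1 + x s)) * (- xp s / w s))).
  { eapply is_derive_eq.
    - apply (is_derive_comp (V := R_NormedModule) sqrt (fun s => (1 - x s) / (1 + x s))).
      + auto_derive; [exact Hpos|reflexivity].
      + auto_derive; [|reflexivity].
        repeat split; try (exists (xp s); exact Hx). lra.
    - change (Derive (fun x0 => x x0) s) with (Derive x s).
      rewrite (is_derive_unique _ _ _ Hx).
      assert (E : (1 - x s) / (1 + x s) = sqrt ((1 - x s) / (1 + x s)) ^ 2).
      { simpl. rewrite Rmult_1_r, sqrt_sqrt; lra. }
      set (r := sqrt ((1 - x s) / (1 + x s))) in *.
      assert (E2 : 1 - x s = r ^ 2 * (1 + x s)).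
      { rewrite <- E. field. lra. }
      unfold w. replace (1 - x s ^ 2) with ((1 - x s) * (1 + x s)) by ring.
      rewrite E2. unfold scal; simpl; unfold mult; simpl.
      field. lra. }
  eapply Cder_eq.
  - apply Cder_mult; [apply Cder_RtoC; exact Hr|].
    apply Cder_comp; [apply Cder_cis|apply Hphi].
  - unfold top_z1, top_z, top_mu.
    generalize (sqrt ((1 - x s) / (1 + x s))) (cis (phi s)). intros r c.
    destruct c as [c1 c2]. unfold Cmult, Cplus, RtoC, Ci; simpl. f_equal; ring.
Qed.

Lemma top_mu_derive s : Cder top_mu s (top_mu1 s).
Proof.
  assert (Hws := Hw s). assert (Hx := x_derive s). assert (Hxp := xp_derive s).
  assert (He := e_derive s).
  assert (Hdw : is_derive w s (- 2 * x s * xp s)).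
  { unfold w. eapply is_derive_eq; [auto_derive; [exists (xp s); exact Hx|reflexivity]|].
    change (Derive (fun x0 => x x0) s) with (Derive x s).
    rewrite (is_derive_unique _ _ _ Hx). ring. }
  assert (HdJ : is_derive J s (- a * xp s)).
  { unfold J. eapply is_derive_eq; [auto_derive; [exists (xp s); exact He|reflexivity]|].
    change (Derive (fun x0 => e x0) s) with (Derive e s).
    rewrite (is_derive_unique _ _ _ He). ring. }
  assert (H1 := top_energy s). assert (H2 := top_height s).
  split.
  - eapply is_derive_eq.
    + unfold Re, top_mu; simpl.
      apply (is_derive_div (fun s => - xp s) w); [|exact Hdw|lra].
      apply (is_derive_opp (V := R_NormedModule)). exact Hxp.
    + unfold top_mu1, top_mu, Cminus, Cplus, Cmult, Copp, RtoC, Ci, Re; simpl. unfold opp; simpl.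
      assert (E : En - 2 * Om * e s = (xp s ^ 2 + J s ^ 2) / w s).
      { rewrite H1. field. lra. }
      rewrite E in H2.
      assert (Exx : xpp s = a * J s - Om * w s - x s * ((xp s ^ 2 + J s ^ 2) / w s)) by lra.
      rewrite Exx. field. lra.
  - eapply is_derive_eq.
    + unfold Im, top_mu; simpl.
      apply (is_derive_div J w); [exact HdJ|exact Hdw|lra].
    + unfold top_mu1, top_mu, Cminus, Cplus, Cmult, Copp, RtoC, Ci, Im; simpl.
      field. lra.
Qed.

Lemma top_z1_derive s : Cder top_z1 s (top_z2 s).
Proof.
  eapply Cder_eq.
  - apply Cder_mult; [apply top_mu_derive|apply top_z_derive].
  - unfold top_z2, top_z1. ring.
Qed.

Lemma top_z_norm2 s : (top_z s * Cconj (top_z s))%C = RtoC ((1 - x s) / (1 + x s)).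
Proof.
  destruct (x_bounds s) as [Hx1 Hx2].
  assert (Hpos : 0 < (1 - x s) / (1 + x s)) by (apply Rdiv_lt_0_compat; assumption).
  unfold top_z. set (r2 := (1 - x s) / (1 + x s)) in *.
  generalize (sin2_cos2 (phi s)). unfold Rsqr. intros E.
  assert (Er : sqrt r2 * sqrt r2 = r2) by (apply sqrt_sqrt; lra).
  unfold Cconj, Cmult, RtoC, cis; simpl. f_equal.
  - transitivity ((sqrt r2 * sqrt r2) * (sin (phi s) * sin (phi s) + cos (phi s) * cos (phi s)));
      [ring|]. rewrite E, Er. ring.
  - ring.
Qed.

Lemma top_wave s : wave_eq a Om (top_z s) (top_z1 s) (top_z2 s).
Proof.
  destruct (x_bounds s) as [Hx1 Hx2].
  unfold wave_eq. rewrite top_z_norm2.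
  assert (E : (RtoC 2 * Cconj (top_z s) * top_z1 s ^ 2 / (RtoC 1 + RtoC ((1 - x s) / (1 + x s))) )%C
     = (RtoC (1 - x s) * top_mu s ^ 2 * top_z s)%C).
  { rewrite <- RtoC_plus. 
    replace (1 + (1 - x s) / (1 + x s)) with (2 / (1 + x s)) by (field; lra).
    unfold top_z1.
    replace (RtoC 2 * Cconj (top_z s) * (top_mu s * top_z s) ^ 2)%C with
      (RtoC 2 * (top_z s * Cconj (top_z s)) * top_mu s ^ 2 * top_z s)%C by ring.
    rewrite top_z_norm2. rewrite !RtoC_div, RtoC_plus by lra.
    assert (RtoC 1 + RtoC (x s) <> 0)%C.
    { rewrite <- RtoC_plus. intros K. apply RtoC_inj in K. lra. }
    field. assumption. }
  rewrite E. unfold top_z2, top_mu1, top_z1. rewrite RtoC_minus. ring.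
Qed.

End Motion.

(** * Joint continuity *)

Lemma jcont_param (f : R -> R) e s : continuous f e -> jcont (fun e _ => f e) e s.
Proof.
  intros H. apply (continuous_comp (fun p : R * R => fst p) f); [|exact H].
  apply continuous_fst.
Qed.

Lemma jcont_var (f : R -> R) e s : continuous f s -> jcont (fun _ s => f s) e s.
Proof.
  intros H. apply (continuous_comp (fun p : R * R => snd p) f); [|exact H].
  apply continuous_snd.
Qed.

Lemma jcont_plus f g e s : jcont f e s -> jcont g e s ->
  jcont (fun e s => f e s + g e s) e s.
Proof. intros Hf Hg. apply (continuous_plus (V := R_NormedModule)); assumption. Qed.

Lemma jcont_minus f g e s : jcont f e s -> jcont g e s ->
  jcont (fun e s => f e s - g e s) e s.
Proof. intros Hf Hg. apply (continuous_minus (V := R_NormedModule)); assumption. Qed.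

Lemma jcont_opp f e s : jcont f e s -> jcont (fun e s => - f e s) e s.
Proof. intros Hf. apply (continuous_opp (V := R_NormedModule)); assumption. Qed.

Lemma jcont_mult f g e s : jcont f e s -> jcont g e s ->
  jcont (fun e s => f e s * g e s) e s.
Proof. intros Hf Hg. apply (continuous_mult (K := R_AbsRing)); assumption. Qed.

Lemma jcont_comp (g : R -> R) f e s : jcont f e s -> continuous g (f e s) ->
  jcont (fun e s => g (f e s)) e s.
Proof. intros Hf Hg. apply (continuous_comp (fun p : R * R => f (fst p) (snd p)) g); assumption. Qed.

Lemma jcont_comp2 g f e s : jcont f e s -> jcont g e (f e s) ->
  jcont (fun e s => g e (f e s)) e s.
Proof.
  intros Hf Hg.
  apply (continuous_comp_2 (fun p : R * R => fst p) (fun p : R * R => f (fst p) (snd p)) g);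
    [apply continuous_fst|exact Hf|exact Hg].
Qed.

Lemma jcont_pow2 f e s : jcont f e s -> jcont (fun e s => f e s ^ 2) e s.
Proof.
  intros Hf. apply (jcont_comp (fun t => t ^ 2)); [exact Hf|].
  apply ex_derive_continuous_R. auto_derive; trivial.
Qed.

Lemma jcont_div f g e s : jcont f e s -> jcont g e s -> g e s <> 0 ->
  jcont (fun e s => f e s / g e s) e s.
Proof.
  intros Hf Hg H. apply jcont_mult; [exact Hf|].
  apply (jcont_comp Rinv); [exact Hg|]. apply continuous_Rinv. exact H.
Qed.

Lemma jcont_id_param e s : jcont (fun e _ => e) e s.
Proof. apply (jcont_param (fun e => e)). apply continuous_id. Qed.

Lemma jcont_ext f g e s : (forall e s, f e s = g e s) -> jcont f e s -> jcont g e s.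
Proof.
  intros E H. apply (continuous_ext (fun p : R * R => f (fst p) (snd p))); [|exact H].
  intros p; apply E.
Qed.

Lemma jcontC_RtoC f e s : jcont f e s -> jcontC (fun e s => RtoC (f e s)) e s.
Proof. intros H. split; [exact H|apply (jcont_param (fun _ => 0)), continuous_const]. Qed.

Lemma jcontC_const c e s : jcontC (fun _ _ => c) e s.
Proof. split; apply (jcont_param (fun _ => _)), continuous_const. Qed.

Lemma jcontC_mult f g e s : jcontC f e s -> jcontC g e s ->
  jcontC (fun e s => f e s * g e s)%C e s.
Proof.
  intros [H1 H2] [H3 H4]. split.
  - apply (jcont_minus _ _ _ _ (jcont_mult _ _ _ _ H1 H3) (jcont_mult _ _ _ _ H2 H4)).
  - apply (jcont_plus _ _ _ _ (jcont_mult _ _ _ _ H1 H4) (jcont_mult _ _ _ _ H2 H3)).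
Qed.

Lemma jcontC_plus f g e s : jcontC f e s -> jcontC g e s ->
  jcontC (fun e s => f e s + g e s)%C e s.
Proof. intros [H1 H2] [H3 H4]. split; apply jcont_plus; assumption. Qed.

Lemma jcontC_minus f g e s : jcontC f e s -> jcontC g e s ->
  jcontC (fun e s => f e s - g e s)%C e s.
Proof.
  intros [H1 H2] [H3 H4]. split.
  - apply (jcont_minus _ _ _ _ H1 H3).
  - apply (jcont_minus _ _ _ _ H2 H4).
Qed.

Lemma jcontC_cis f e s : jcont f e s -> jcontC (fun e s => cis (f e s)) e s.
Proof.
  intros H. split; simpl.
  - apply (jcont_comp cos); [exact H|apply continuous_cos].
  - apply (jcont_comp sin); [exact H|apply continuous_sin].
Qed.

(** * Families of waves *)

(** For [|e| < r], [z e] is a travelling and rotating wave with angular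
    velocity [Om e] (its derivatives being [z1 e] and [z2 e]), jointly
    continuous with its derivatives, equivariant under the rotation by
    [2 PI / mu] and under conjugation, and of non-constant modulus unless
    [e = 0]. *)
Definition wave_family (a mu r : R) (Om : R -> R) (z z1 z2 : R -> R -> C) : Prop :=
  forall e, Rabs e < r ->
    continuous Om e /\
    (forall s, Cder (z e) s (z1 e s) /\ Cder (z1 e) s (z2 e s) /\
       wave_eq a (Om e) (z e s) (z1 e s) (z2 e s)) /\
    (forall s, jcontC z e s /\ jcontC z1 e s /\ jcontC z2 e s) /\
    (forall s, z e (s + 2 * PI / mu) = (cis (2 * PI / mu) * z e s)%C) /\
    (forall s, z e (- s) = Cconj (z e s)) /\
    (e <> 0 -> exists s, Cmod (z e s) <> Cmod (z e 0)).

(** * The family of nutating tops *)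

(** A quantity depending on strictly differentiable parameters is Lipschitz in
    amplitude and phase. *)
Lemma lip_param (P : R -> V3) l (g : V4 -> R) :
  sder (U := R_NormedModule) (V := V3) P 0 l -> snd (snd (P 0)) = 0 ->
  (forall e, snd (snd (P e)) = e) ->
  sd g (P 0, 0) ->
  exists C r, 0 < C /\ 0 < r /\ forall e e' t t', Rabs e < r -> Rabs e' < r ->
    Rabs (g (P e, e * cos t) - g (P e', e' * cos t')) <= C * (Rabs (e - e') + Rabs (t - t')).
Proof.
  intros HP HP0 HPe [lg Hg].
  destruct (sder_lipschitz _ _ _ HP) as [C1 [r1 [HC1 [Hr1 H1]]]].
  destruct (kc_lip g (fun p : V3 => snd (snd p)) (P 0) lg) as [C2 [r2 [HC2 [Hr2 H2]]]].
  - exact lin3_3.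
  - exact HP0.
  - exact Hg.
  - exists (C2 * (C1 + 1)), (Rmin r1 (r2 / C1)).
    split; [apply Rmult_lt_0_compat; lra|].
    split; [apply Rmin_pos; [exact Hr1|apply Rdiv_lt_0_compat; assumption]|].
    assert (N : forall t u : R, norm (minus (t : R_NormedModule) u) = Rabs (t - u)) by reflexivity.
    assert (Hin : forall e, Rabs e < Rmin r1 (r2 / C1) ->
      Rabs e < r1 /\ norm (minus (P e) (P 0)) < r2).
    { intros e He. apply Rmin_Rgt_l in He. destruct He as [He1 He2]. split; [exact He1|].
      eapply Rle_lt_trans; [apply H1|].
      - rewrite N, Rminus_0_r. exact He1.
      - rewrite N, Rminus_0_r, Rabs_R0. exact Hr1.
      - rewrite N, Rminus_0_r. apply Rgt_lt, (Rmult_lt_compat_l C1) in He2; [|exact HC1].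
        replace (C1 * (r2 / C1)) with r2 in He2 by (field; lra). exact He2. }
    intros e e' t t' He He'. destruct (Hin e He) as [He1 He2], (Hin e' He') as [He1' He2'].
    specialize (H2 (P e) (P e') t t' He2 He2'). cbv beta in H2.
    rewrite !HPe in H2. eapply Rle_trans; [exact H2|].
    rewrite Rmult_assoc. apply Rmult_le_compat_l; [lra|].
    assert (H1' : norm (minus (P e) (P e')) <= C1 * Rabs (e - e')).
    { apply H1; rewrite N, Rminus_0_r; assumption. }
    eapply Rle_trans; [apply Rplus_le_compat_r; exact H1'|].
    generalize (Rabs_pos (e - e')) (Rabs_pos (t - t')). nra.
Qed.

(** A lower bound at amplitude zero persists for small amplitudes, at every
    phase. *)
Lemma pos_param (G : R -> R -> R) C r c : 0 < C -> 0 < r -> c < G 0 0 ->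
  (forall e e' t t', Rabs e < r -> Rabs e' < r ->
    Rabs (G e t - G e' t') <= C * (Rabs (e - e') + Rabs (t - t'))) ->
  (forall t, G 0 t = G 0 0) ->
  exists r', 0 < r' /\ r' <= r /\ forall e t, Rabs e < r' -> c < G e t.
Proof.
  intros HC Hr Hp HL H0.
  exists (Rmin r ((G 0 0 - c) / C)).
  split; [apply Rmin_pos; [exact Hr|apply Rdiv_lt_0_compat; lra]|].
  split; [apply Rmin_l|]. intros e t He. apply Rmin_Rgt_l in He. destruct He as [He1 He2].
  specialize (HL e 0 t t He1). rewrite Rabs_R0 in HL. specialize (HL Hr).
  rewrite (Rminus_diag t), Rabs_R0, Rminus_0_r, Rplus_0_r, H0 in HL.
  apply Rgt_lt, (Rmult_lt_compat_l C) in He2; [|exact HC].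
  replace (C * ((G 0 0 - c) / C)) with (G 0 0 - c) in He2 by (field; lra).
  apply Rabs_le_between in HL. lra.
Qed.

Lemma lip_continuous_1 (f : R -> R) C r e : Rabs e < r ->
  (forall e e', Rabs e < r -> Rabs e' < r -> Rabs (f e - f e') <= C * Rabs (e - e')) ->
  continuous f e.
Proof.
  intros He H. apply filterlim_locally. intros eps.
  assert (HC : 0 < Rabs C + 1) by (generalize (Rabs_pos C); lra).
  assert (Hd : 0 < Rmin (r - Rabs e) (eps / (Rabs C + 1))).
  { apply Rmin_pos; [lra|]. apply Rdiv_lt_0_compat; [apply cond_pos|exact HC]. }
  exists (mkposreal _ Hd). intros y Hy.
  change (Rabs (y - e) < Rmin (r - Rabs e) (eps / (Rabs C + 1))) in Hy.
  change (Rabs (f y - f e) < eps). apply Rmin_Rgt_l in Hy. destruct Hy as [Hy1 Hy].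
  assert (Hyr : Rabs y < r).
  { replace y with ((y - e) + e) by ring. eapply Rle_lt_trans; [apply Rabs_triang|]. lra. }
  apply Rgt_lt, (Rmult_lt_compat_r (Rabs C + 1)) in Hy; [|exact HC].
  replace (eps / (Rabs C + 1) * (Rabs C + 1)) with (pos eps) in Hy by (field; lra).
  generalize (H y e Hyr He) (Rle_abs C) (Rabs_pos (y - e)). nra.
Qed.

Section TopFamily.

Context (a h0 mu : R) (om h : R -> R).
Context (r C c : R).
Let K1 (e t : R) := top_k1 a (om e) (h e) e (e * cos t).
Let K2 (e t : R) := top_k2 a (om e) (h e) e (e * cos t).
Let Om (e : R) := top_Om a (om e) (h e) e.
Hypothesis Hmu : 0 < mu.
Hypothesis Hc : 0 < c.
Hypothesis Hom0 : om 0 = 1.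
Hypothesis Hh0 : h 0 = h0.
Hypothesis Hr : 0 < r.
Hypothesis Hdisp : 3 * h0 ^ 2 - 4 * a * h0 + a ^ 2 + 1 = mu ^ 2.
Hypothesis HomC : forall e, Rabs e < r -> continuous om e.
Hypothesis HhC : forall e, Rabs e < r -> continuous h e.
Hypothesis HOmC : forall e, Rabs e < r -> continuous Om e.
Hypothesis HD : forall e, Rabs e < r -> top_D (h e) e <> 0.
Hypothesis Hrate : forall e t, Rabs e < r -> 0 < top_rate2 a (om e) (h e) e (e * cos t).
Hypothesis Hw : forall e t, Rabs e < r -> 0 < 1 - (h e + e * cos t) ^ 2.
Hypothesis HK1c : forall e t, Rabs e < r -> c <= K1 e t.
Hypothesis HK1 : forall e e' t t', Rabs e < r -> Rabs e' < r ->
  Rabs (K1 e t - K1 e' t') <= C * (Rabs (e - e') + Rabs (t - t')).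
Hypothesis HK2 : forall e e' t t', Rabs e < r -> Rabs e' < r ->
  Rabs (K2 e t - K2 e' t') <= C * (Rabs (e - e') + Rabs (t - t')).
Hypothesis HT : forall e, Rabs e < r -> prim (K1 e) PI = PI / mu.
Hypothesis HPhi : forall e, Rabs e < r -> prim (K2 e) PI = PI / mu.

(* The phase as a function of time, and the azimuth. *)
Let psi (e s : R) := prim_inv (K1 e) s.
Let phi (e s : R) := prim (K2 e) (psi e s).

Lemma kernel_cont K e : (forall e e' t t', Rabs e < r -> Rabs e' < r ->
  Rabs (K e t - K e' t') <= C * (Rabs (e - e') + Rabs (t - t'))) -> Rabs e < r ->
  forall t, continuous (K e) t.
Proof.
  intros H He t. apply (lip_continuous _ C). intros y.
  specialize (H e e y t He He). rewrite Rminus_diag, Rabs_R0, Rplus_0_l in H. exact H.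
Qed.

Lemma kernel_jcont K e t : (forall e e' t t', Rabs e < r -> Rabs e' < r ->
  Rabs (K e t - K e' t') <= C * (Rabs (e - e') + Rabs (t - t'))) -> Rabs e < r ->
  jcont K e t.
Proof.
  intros H He.
  apply filterlim_locally. intros eps.
  assert (HC : 0 < Rabs C + 1) by (generalize (Rabs_pos C); lra).
  assert (Hd : 0 < Rmin (r - Rabs e) (eps / 2 / (Rabs C + 1))).
  { apply Rmin_pos; [lra|]. apply Rdiv_lt_0_compat; [|exact HC]. generalize (cond_pos eps); lra. }
  exists (mkposreal _ Hd). intros [e' t'] [H1 H2]. simpl in H1, H2 |- *.
  change (Rabs (e' - e) < Rmin (r - Rabs e) (eps / 2 / (Rabs C + 1))) in H1.
  change (Rabs (t' - t) < Rmin (r - Rabs e) (eps / 2 / (Rabs C + 1))) in H2.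
  change (Rabs (K e' t' - K e t) < eps). apply Rmin_Rgt_l in H1, H2.
  destruct H1 as [H0 H1], H2 as [_ H2].
  assert (He' : Rabs e' < r).
  { replace e' with ((e' - e) + e) by ring. eapply Rle_lt_trans; [apply Rabs_triang|]. lra. }
  specialize (H e' e t' t He' He).
  apply Rgt_lt, (Rmult_lt_compat_r (Rabs C + 1)) in H1; [|exact HC].
  apply Rgt_lt, (Rmult_lt_compat_r (Rabs C + 1)) in H2; [|exact HC].
  replace (eps / 2 / (Rabs C + 1) * (Rabs C + 1)) with (eps / 2) in * by (field; lra).
  generalize (Rle_abs C) (Rabs_pos (e' - e)) (Rabs_pos (t' - t)). nra.
Qed.

Lemma kernel_param K e e' : (forall e e' t t', Rabs e < r -> Rabs e' < r ->
  Rabs (K e t - K e' t') <= C * (Rabs (e - e') + Rabs (t - t'))) -> Rabs e < r ->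
  Rabs e' < r -> forall t, Rabs (K e' t - K e t) <= C * Rabs (e' - e).
Proof.
  intros H He He' t. specialize (H e' e t t He' He).
  rewrite (Rminus_diag t), Rabs_R0, Rplus_0_r in H. exact H.
Qed.

Lemma K1_even e t : K1 e (- t) = K1 e t.
Proof. unfold K1. rewrite cos_neg. reflexivity. Qed.
Lemma K2_even e t : K2 e (- t) = K2 e t.
Proof. unfold K2. rewrite cos_neg. reflexivity. Qed.
Lemma cos_add_2PI t : cos (t + 2 * PI) = cos t.
Proof. rewrite cos_plus, cos_2PI, sin_2PI. ring. Qed.
Lemma K1_per e t : K1 e (t + 2 * PI) = K1 e t.
Proof. unfold K1. rewrite cos_add_2PI. reflexivity. Qed.
Lemma K2_per e t : K2 e (t + 2 * PI) = K2 e t.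
Proof. unfold K2. rewrite cos_add_2PI. reflexivity. Qed.

Lemma psi_derive e s : Rabs e < r ->
  is_derive (psi e) s (sqrt (top_rate2 a (om e) (h e) e (e * cos (psi e s)))).
Proof.
  intros He. eapply is_derive_eq.
  - apply (prim_inv_derive (K1 e) c Hc); [apply kernel_cont; [exact HK1|exact He]|].
    intros t; apply HK1c; exact He.
  - fold (psi e s). unfold K1, top_k1. apply Rinv_inv.
Qed.

Lemma phi_derive e s : Rabs e < r ->
  is_derive (phi e) s ((top_M (om e) (h e) - a * (e * cos (psi e s)))
    / (1 - (h e + e * cos (psi e s)) ^ 2)).
Proof.
  intros He. eapply is_derive_eq.
  - apply (is_derive_comp (V := R_NormedModule) (prim (K2 e)) (psi e)).
    + apply prim_derive, kernel_cont; [exact HK2|exact He].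
    + apply psi_derive; exact He.
  - unfold K2, top_k2, top_k1, scal; simpl; unfold mult; simpl.
    assert (H1 := sqrt_lt_R0 _ (Hrate e (psi e s) He)). assert (H2 := Hw e (psi e s) He).
    simpl in H2. field. lra.
Qed.

Lemma psi_jcont e s : Rabs e < r -> jcont psi e s.
Proof.
  intros He. apply (jcont_intro _ _ _ (/ c * C * / c) (r - Rabs e)); [lra| |].
  - apply ex_derive_continuous_R.
    eexists. apply psi_derive. exact He.
  - intros e' s' He'.
    assert (Her : Rabs e' < r).
    { replace e' with ((e' - e) + e) by ring. eapply Rle_lt_trans; [apply Rabs_triang|]. lra. }
    apply prim_inv_param; try assumption; try (apply kernel_cont; assumption);
      try (intros; apply HK1c; assumption).
    apply kernel_param; assumption.
Qed.

Lemma phi_jcont e s : Rabs e < r -> jcont phi e s.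
Proof.
  intros He. apply (jcont_comp2 (fun e x => prim (K2 e) x)); [apply psi_jcont; exact He|].
  apply (jcont_intro _ _ _ C (r - Rabs e)); [lra| |].
  - apply ex_derive_continuous_R.
    eexists. apply prim_derive, kernel_cont; [exact HK2|exact He].
  - intros e' s' He'.
    assert (Her : Rabs e' < r).
    { replace e' with ((e' - e) + e) by ring. eapply Rle_lt_trans; [apply Rabs_triang|]. lra. }
    apply prim_param; try (apply kernel_cont; assumption). apply kernel_param; assumption.
Qed.

Lemma psi_odd e s : Rabs e < r -> psi e (- s) = - psi e s.
Proof.
  intros He. apply (prim_inv_odd (K1 e) c Hc);
    [apply kernel_cont; [exact HK1|exact He]|intros; apply HK1c; exact He|apply K1_even].
Qed.

Lemma psi_shift e s : Rabs e < r -> psi e (s + 2 * PI / mu) = psi e s + 2 * PI.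
Proof.
  intros He. replace (2 * PI / mu) with (2 * (PI / mu)) by (field; lra).
  rewrite <- (HT e He).
  apply (prim_inv_shift (K1 e) c Hc);
    [apply kernel_cont; [exact HK1|exact He]|intros; apply HK1c; exact He|apply K1_even|apply K1_per].
Qed.

Lemma phi_odd e s : Rabs e < r -> phi e (- s) = - phi e s.
Proof.
  intros He. unfold phi. rewrite psi_odd by exact He.
  apply prim_odd; [apply kernel_cont; [exact HK2|exact He]|apply K2_even].
Qed.

Lemma phi_shift e s : Rabs e < r -> phi e (s + 2 * PI / mu) = phi e s + 2 * PI / mu.
Proof.
  intros He. unfold phi. rewrite psi_shift by exact He.
  rewrite prim_shift; [|apply kernel_cont; [exact HK2|exact He]|apply K2_even|apply K2_per].
  rewrite (HPhi e He). field. lra.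
Qed.

Lemma top_family_waves :
  wave_family a mu r Om
    (fun e => top_z (h e) e (psi e) (phi e))
    (fun e => top_z1 a (om e) (h e) e (psi e) (phi e))
    (fun e => top_z2 a (om e) (h e) e (psi e) (phi e)).
Proof.
  intros e He.
  assert (Hx : forall s, 0 < 1 + (h e + e * cos (psi e s)) /\ 0 < 1 - (h e + e * cos (psi e s))).
  { intros s. generalize (Hw e (psi e s) He). intros. split; nra. }
  assert (Jpsi : forall s, jcont psi e s) by (intros; apply psi_jcont; exact He).
  assert (Je : forall s, jcont (fun e s => e * cos (psi e s)) e s).
  { intros s. apply jcont_mult; [apply jcont_id_param|].
    apply (jcont_comp cos); [apply Jpsi|apply continuous_cos]. }
  assert (Jx : forall s, jcont (fun e s => h e + e * cos (psi e s)) e s).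
  { intros s. apply jcont_plus; [apply jcont_param, HhC, He|apply Je]. }
  assert (Jw : forall s, jcont (fun e s => 1 - (h e + e * cos (psi e s)) ^ 2) e s).
  { intros s. apply jcont_minus; [apply jcont_param, continuous_const|apply jcont_pow2, Jx]. }
  assert (Jq : forall s, jcont (fun e s => sqrt (top_rate2 a (om e) (h e) e (e * cos (psi e s)))) e s).
  { intros s. apply (jcont_ext (fun e s => / K1 e (psi e s))).
    { intros; apply Rinv_inv. }
    apply (jcont_comp Rinv).
    - apply (jcont_comp2 K1); [apply Jpsi|apply kernel_jcont; [exact HK1|exact He]].
    - apply continuous_Rinv. generalize (HK1c e (psi e s) He). lra. }
  assert (Jmu : forall s, jcontC (fun e s => top_mu a (om e) (h e) e (psi e) s) e s).
  { intros s. assert (Hws := Hw e (psi e s) He). split; unfold top_mu; simpl Re; simpl Im.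
    - apply jcont_div; [|apply Jw|lra]. apply jcont_opp. apply jcont_mult; [|apply Jq].
      apply jcont_mult; [apply jcont_opp, jcont_id_param|].
      apply (jcont_comp sin); [apply Jpsi|apply continuous_sin].
    - apply jcont_div; [|apply Jw|lra]. apply jcont_minus.
      + unfold top_M. apply jcont_mult; [apply jcont_param, HomC, He|].
        apply jcont_minus; [apply jcont_param, continuous_const|].
        apply jcont_pow2, jcont_param, HhC, He.
      + apply jcont_mult; [apply jcont_param, continuous_const|apply Je]. }
  assert (Jz : forall s, jcontC (fun e s => top_z (h e) e (psi e) (phi e) s) e s).
  { intros s. destruct (Hx s) as [Hx1 Hx2]. unfold top_z. apply jcontC_mult.
    - apply jcontC_RtoC. apply (jcont_comp sqrt); [|apply continuous_sqrt].
      apply jcont_div; [|apply jcont_plus; [apply jcont_param, continuous_const|apply Jx]|lra].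
      apply jcont_minus; [apply jcont_param, continuous_const|apply Jx].
    - apply jcontC_cis, phi_jcont. exact He. }
  assert (Hcs : forall s, cos (psi e (- s)) = cos (psi e s)).
  { intros s. rewrite psi_odd by exact He. apply cos_neg. }
  assert (Hcp : forall s, cos (psi e (s + 2 * PI / mu)) = cos (psi e s)).
  { intros s. rewrite psi_shift by exact He. apply cos_add_2PI. }
  split; [apply HOmC; exact He|]. split; [|split; [|split; [|split]]].
  - intros s.
    assert (HDe := HD e He).
    assert (Hr' : forall s, 0 < top_rate2 a (om e) (h e) e (e * cos (psi e s))) by (intros; apply Hrate, He).
    assert (Hw' : forall s, 0 < 1 - (h e + e * cos (psi e s)) ^ 2) by (intros; apply Hw, He).
    assert (Hps : forall s, is_derive (psi e) s (sqrt (top_rate2 a (om e) (h e) e (e * cos (psi e s)))))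
      by (intros; apply psi_derive, He).
    assert (Hph := fun s => phi_derive e s He).
    split; [apply top_z_derive; assumption|].
    split; [apply top_z1_derive; assumption|apply top_wave; assumption].
  - intros s. split; [apply Jz|]. 
    assert (J1 : jcontC (fun e s => top_z1 a (om e) (h e) e (psi e) (phi e) s) e s).
    { unfold top_z1. apply jcontC_mult; [apply Jmu|apply Jz]. }
    split; [exact J1|]. unfold top_z2, top_mu1.
    assert (Jmu2 : jcontC (fun e s => top_mu a (om e) (h e) e (psi e) s ^ 2)%C e s).
    { simpl. apply jcontC_mult; [apply Jmu|]. apply jcontC_mult; [apply Jmu|apply jcontC_const]. }
    apply jcontC_mult; [|apply Jz]. apply jcontC_plus; [exact Jmu2|].
    apply jcontC_minus.
    + apply jcontC_plus; [apply jcontC_RtoC, (jcont_param Om), HOmC, He|].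
      apply jcontC_mult; [|apply Jmu]. apply jcontC_const.
    + apply jcontC_mult; [|exact Jmu2]. apply jcontC_RtoC, Jx.
  - intros s. unfold top_z. rewrite Hcp, phi_shift by exact He.
    rewrite (Rplus_comm (phi e s)), cis_plus. ring.
  - intros s. unfold top_z. rewrite Hcs, phi_odd by exact He.
    rewrite <- cis_conj. unfold Cconj, Cmult, RtoC; simpl. f_equal; ring.
  - (* The heights at the times [0] and [PI / mu] are the turning heights. *)
    intros He0. exists (PI / mu).
    assert (E0 : psi e 0 = 0).
    { generalize (psi_odd e 0 He). rewrite Ropp_0. lra. }
    assert (E1 : psi e (PI / mu) = PI).
    { rewrite <- (HT e He). apply (prim_inj (K1 e) c Hc).
      - apply kernel_cont; [exact HK1|exact He].
      - intros; apply HK1c, He.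
      - apply (prim_invK (K1 e) c Hc).
        + apply kernel_cont; [exact HK1|exact He].
        + intros; apply HK1c, He. }
    assert (Hmod : forall s, Cmod (top_z (h e) e (psi e) (phi e) s) =
      sqrt ((1 - (h e + e * cos (psi e s))) / (1 + (h e + e * cos (psi e s))))).
    { intros s. unfold top_z. rewrite Cmod_mult.
      assert (Ec : Cmod (cis (phi e s)) = 1).
      { unfold Cmod, cis; simpl. rewrite !Rmult_1_r.
        rewrite Rplus_comm. generalize (sin2_cos2 (phi e s)). unfold Rsqr. intros ->. apply sqrt_1. }
      rewrite Ec, Cmod_R, Rmult_1_r. apply Rabs_pos_eq, sqrt_pos. }
    rewrite !Hmod, E0, E1, cos_0, cos_PI.
    destruct (Hx 0) as [Hx1 Hx2], (Hx (PI / mu)) as [Hx3 Hx4].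
    rewrite E0, cos_0 in Hx1, Hx2. rewrite E1, cos_PI in Hx3, Hx4.
    intros E. apply sqrt_inj in E; try (apply Rlt_le, Rdiv_lt_0_compat; assumption).
    apply (Rmult_eq_compat_r ((1 + (h e + e * -1)) * (1 + (h e + e * 1)))) in E.
    field_simplify in E; [|lra|lra]. apply He0. nra.
Qed.

Lemma top_family_0 s : 0 < 1 - h0 ^ 2 ->
  top_z (h 0) 0 (psi 0) (phi 0) s = (RtoC (sqrt ((1 - h0) / (1 + h0))) * cis s)%C.
Proof.
  intros H. unfold top_z. rewrite Hh0, Rmult_0_l, Rplus_0_r. f_equal. f_equal.
  assert (EK : forall t, K1 0 t = / mu).
  { intros t. unfold K1, top_k1. rewrite Hom0, Hh0, Rmult_0_l, top_rate2_0 by lra.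
    replace (1 ^ 2 * (1 + 3 * h0 ^ 2) - 4 * a * h0 * 1 + a ^ 2) with (mu ^ 2) by (rewrite <- Hdisp; ring).
    rewrite sqrt_pow2 by lra. reflexivity. }
  assert (EK2 : forall t, K2 0 t = K1 0 t).
  { intros t. unfold K2, top_k2. fold (K1 0 t). rewrite Hom0, Hh0, Rmult_0_l. unfold top_M.
    rewrite Rplus_0_r. field. lra. }
  assert (H0r : Rabs 0 < r) by (rewrite Rabs_R0; exact Hr).
  unfold phi. transitivity (prim (K1 0) (psi 0 s)).
  - unfold prim. apply RInt_ext. intros; apply EK2.
  - apply (prim_invK (K1 0) c Hc); [apply kernel_cont; [exact HK1|exact H0r]|].
    intros; apply HK1c, H0r.
Qed.

End TopFamily.

(** Tops nutating with small amplitude about a height [h0] where the small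
    oscillations have frequency [mu]. *)
Lemma ex_top_family (a h0 mu : R) : 0 < mu -> 0 < 1 - h0 ^ 2 ->
  3 * h0 ^ 2 - 4 * a * h0 + a ^ 2 + 1 = mu ^ 2 -> 3 * h0 <> 2 * a ->
  exists r Om z z1 z2, 0 < r /\ wave_family a mu r Om z z1 z2 /\
    Om 0 = a - h0 /\
    forall s, z 0 s = (RtoC (sqrt ((1 - h0) / (1 + h0))) * cis s)%C.
Proof.
  intros Hmu Hh Hdisp Hslope.
  destruct (ex_top_params a h0 mu Hmu Hh Hdisp Hslope)
    as [om [h [Hom0 [Hh0 [[l HP] [r0 [Hr0 Hper]]]]]]].
  set (P := fun e => (om e, (h e, e)) : V3) in HP.
  assert (HP0 : P 0 = (1, (h0, 0))) by (unfold P; rewrite Hom0, Hh0; reflexivity).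
  assert (L : forall g, sd (lift4 g) ((1, (h0, 0)) : V3, 0) ->
    exists C r, 0 < C /\ 0 < r /\ forall e e' t t', Rabs e < r -> Rabs e' < r ->
    Rabs (g (om e) (h e) e (e * cos t) - g (om e') (h e') e' (e' * cos t'))
      <= C * (Rabs (e - e') + Rabs (t - t'))).
  { intros g Hg. apply (lip_param P l (lift4 g) HP); [reflexivity|reflexivity|].
    rewrite HP0. exact Hg. }
  destruct (L _ (sd_k1 a h0 mu Hmu Hh Hdisp)) as [C1 [r1 [HC1 [Hr1 L1]]]].
  destruct (L _ (sd_k2 a h0 mu Hmu Hh Hdisp)) as [C2 [r2 [HC2 [Hr2 L2]]]].
  destruct (L _ (sd_rate2 a h0 Hh)) as [C3 [r3 [HC3 [Hr3 L3]]]].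
  destruct (L _ (sd_D h0)) as [C4 [r4 [HC4 [Hr4 L4]]]].
  destruct (L _ (sd_Om a h0 Hh)) as [C5 [r5 [HC5 [Hr5 L5]]]].
  destruct (L (fun om _ _ _ => om)) as [C6 [r6 [HC6 [Hr6 L6]]]].
  { unfold lift4. sd_tac. }
  destruct (L (fun _ h _ _ => h)) as [C7 [r7 [HC7 [Hr7 L7]]]].
  { unfold lift4. sd_tac. }
  destruct (L (fun _ h _ e => 1 - (h + e) ^ 2)) as [C8 [r8 [HC8 [Hr8 L8]]]].
  { unfold lift4. sd_tac. }
  assert (Hmu2 : 0 < mu ^ 2) by nra.
  destruct (pos_param (fun e t => top_k1 a (om e) (h e) e (e * cos t)) C1 r1 (/ mu / 2) HC1 Hr1)
    as [s1 [Hs1 [Hsr1 P1]]]; [| exact L1| |].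
  { cbv beta. rewrite Hom0, Hh0, Rmult_0_l. unfold top_k1. rewrite (top_rate2_base a h0 mu Hh Hdisp).
    rewrite sqrt_pow2 by lra. assert (0 < / mu) by (apply Rinv_0_lt_compat; lra). lra. }
  { intros; rewrite !Rmult_0_l; reflexivity. }
  destruct (pos_param (fun e t => top_rate2 a (om e) (h e) e (e * cos t)) C3 r3 0 HC3 Hr3)
    as [s3 [Hs3 [Hsr3 P3]]]; [| exact L3| |].
  { cbv beta. rewrite Hom0, Hh0, Rmult_0_l. rewrite (top_rate2_base a h0 mu Hh Hdisp). lra. }
  { intros; rewrite !Rmult_0_l; reflexivity. }
  destruct (pos_param (fun e t => top_D (h e) e) C4 r4 0 HC4 Hr4)
    as [s4 [Hs4 [Hsr4 P4]]]; [| exact L4| |].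
  { cbv beta. rewrite Hh0, top_D_0. nra. }
  { reflexivity. }
  destruct (pos_param (fun e t => 1 - (h e + e * cos t) ^ 2) C8 r8 0 HC8 Hr8)
    as [s8 [Hs8 [Hsr8 P8]]]; [| exact L8| |].
  { cbv beta. rewrite Hh0, Rmult_0_l, Rplus_0_r. lra. }
  { intros; rewrite !Rmult_0_l; reflexivity. }
  pose (r := Rmin (Rmin (Rmin r0 s1) (Rmin r2 s3)) (Rmin (Rmin s4 s8) (Rmin r5 (Rmin r6 r7)))).
  assert (Hr : 0 < r) by (unfold r; repeat apply Rmin_pos; assumption).
  assert (Hin : forall e, Rabs e < r -> Rabs e < r0 /\ Rabs e < s1 /\ Rabs e < r2 /\
    Rabs e < s3 /\ Rabs e < s4 /\ Rabs e < s8 /\ Rabs e < r5 /\ Rabs e < r6 /\ Rabs e < r7).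
  { intros e He. unfold r in He.
    apply Rlt_gt in He.
    repeat match goal with H : Rmin _ _ > Rabs e |- _ =>
      apply Rmin_Rgt_l in H; destruct H end.
    repeat split; apply Rgt_lt; assumption. }
  assert (Hcont1 : forall (f : R -> R) C' r', r <= r' ->
    (forall e e' t t' : R, Rabs e < r' -> Rabs e' < r' ->
      Rabs (f e - f e') <= C' * (Rabs (e - e') + Rabs (t - t'))) ->
    forall e, Rabs e < r -> continuous f e).
  { intros f C' r' Hr' Hf e He. apply (lip_continuous_1 f C' r'); [lra|].
    intros e1 e2 He1 He2. specialize (Hf e1 e2 0 0 He1 He2).
    rewrite (Rminus_diag 0), Rabs_R0, Rplus_0_r in Hf. exact Hf. }
  assert (Hle : forall r', (forall e, Rabs e < r -> Rabs e < r') -> r <= r').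
  { intros r' H. destruct (Rle_dec r r') as [|Hn]; [assumption|].
    destruct (Rle_dec 0 r') as [Hp|Hp].
    - assert (r' < r) by lra. specialize (H r'). rewrite Rabs_pos_eq in H by lra. lra.
    - specialize (H 0). rewrite Rabs_R0 in H. lra. }
  exists r, (fun e => top_Om a (om e) (h e) e).
  eexists. eexists. eexists.
  split; [exact Hr|]. split; [|split].
  - apply (top_family_waves a mu om h r (Rmax C1 C2) (/ mu / 2)).
    all: try assumption.
    + assert (0 < / mu) by (apply Rinv_0_lt_compat; lra). lra.
    + apply (Hcont1 om C6 r6); [apply Hle; intros; apply Hin; assumption|exact L6].
    + apply (Hcont1 h C7 r7); [apply Hle; intros; apply Hin; assumption|exact L7].
    + apply (Hcont1 (fun e => top_Om a (om e) (h e) e) C5 r5);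
        [apply Hle; intros; apply Hin; assumption|exact L5].
    + intros e He. apply Rgt_not_eq, (P4 e 0). apply Hin, He.
    + intros e t He. apply P3, Hin, He.
    + intros e t He. apply P8, Hin, He.
    + intros e t He. apply Rlt_le, P1, Hin, He.
    + intros e e' t t' He He'. eapply Rle_trans; [apply L1|].
      * apply Rlt_le_trans with s1; [apply Hin, He|exact Hsr1].
      * apply Rlt_le_trans with s1; [apply Hin, He'|exact Hsr1].
      * apply Rmult_le_compat_r; [|apply Rmax_l].
        generalize (Rabs_pos (e - e')) (Rabs_pos (t - t')); lra.
    + intros e e' t t' He He'. eapply Rle_trans; [apply L2|].
      * apply Hin, He.
      * apply Hin, He'.
      * apply Rmult_le_compat_r; [|apply Rmax_r].
        generalize (Rabs_pos (e - e')) (Rabs_pos (t - t')); lra.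
    + intros e He. exact (proj1 (Hper e (proj1 (Hin e He)))).
    + intros e He. exact (proj2 (Hper e (proj1 (Hin e He)))).
  - rewrite Hom0, Hh0, top_Om_0 by lra. ring.
  - intros s. apply (top_family_0 a h0 mu om h r (Rmax C1 C2) (/ mu / 2)); try assumption.
    + assert (0 < / mu) by (apply Rinv_0_lt_compat; lra). lra.
    + intros e t He. apply Rlt_le, P1, Hin, He.
    + intros e e' t t' He He'. eapply Rle_trans; [apply L1|].
      * apply Rlt_le_trans with s1; [apply Hin, He|exact Hsr1].
      * apply Rlt_le_trans with s1; [apply Hin, He'|exact Hsr1].
      * apply Rmult_le_compat_r; [|apply Rmax_l].
        generalize (Rabs_pos (e - e')) (Rabs_pos (t - t')); lra.
Qed.

(** * Pointwise convergence of Fourier series *)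

Lemma RInt_of_derive (H f : R -> R) a b :
  (forall x, is_derive H x (f x)) -> (forall x, continuous f x) ->
  RInt f a b = H b - H a.
Proof.
  intros HH Hf. apply is_RInt_unique.
  apply (is_RInt_derive (V := R_CompleteNormedModule) H f); intros; [apply HH|apply Hf].
Qed.

(** Continuity at every point of the interval from [- PI] to [PI], and the
    integral over it. *)
Definition icont (f : R -> R) : Prop := forall x, - PI <= x <= PI -> continuous f x.
Definition I2 (f : R -> R) : R := RInt f (- PI) PI.

Lemma mPI_le : - PI <= PI.
Proof. generalize PI_RGT_0; lra. Qed.

Lemma icont_RInt f : icont f -> is_RInt f (- PI) PI (I2 f).
Proof.
  intros H. apply (RInt_correct (V := R_CompleteNormedModule)).
  apply (ex_RInt_continuous (V := R_CompleteNormedModule)).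
  intros x. rewrite Rmin_left, Rmax_right by apply mPI_le. apply H.
Qed.

Lemma icont_all f : (forall x, continuous f x) -> icont f.
Proof. intros H x _; apply H. Qed.

Lemma icont_mult f g : icont f -> icont g -> icont (fun x => f x * g x).
Proof. intros Hf Hg x Hx. apply (continuous_mult (K := R_AbsRing)); auto. Qed.

Lemma icont_minus f g : icont f -> icont g -> icont (fun x => f x - g x).
Proof. intros Hf Hg x Hx. apply (continuous_minus (V := R_NormedModule)); auto. Qed.

Lemma icont_plus f g : icont f -> icont g -> icont (fun x => f x + g x).
Proof. intros Hf Hg x Hx. apply (continuous_plus (V := R_NormedModule)); auto. Qed.

Lemma icont_const c : icont (fun _ => c).
Proof. intros x _; apply continuous_const. Qed.

Lemma icont_cmult c f : icont f -> icont (fun x => c * f x).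
Proof. intros Hf. apply icont_mult; [apply icont_const|exact Hf]. Qed.

Lemma I2_plus f g : icont f -> icont g -> I2 (fun x => f x + g x) = I2 f + I2 g.
Proof.
  intros Hf Hg. apply is_RInt_unique.
  apply (is_RInt_plus (V := R_NormedModule)); apply icont_RInt; assumption.
Qed.

Lemma I2_minus f g : icont f -> icont g -> I2 (fun x => f x - g x) = I2 f - I2 g.
Proof.
  intros Hf Hg. apply is_RInt_unique.
  apply (is_RInt_minus (V := R_NormedModule)); apply icont_RInt; assumption.
Qed.

Lemma I2_cmult c f : icont f -> I2 (fun x => c * f x) = c * I2 f.
Proof.
  intros Hf. apply is_RInt_unique.
  apply (is_RInt_scal (V := R_NormedModule)); apply icont_RInt; assumption.
Qed.

Lemma I2_ext f g : (forall x, - PI <= x <= PI -> f x = g x) -> I2 f = I2 g.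
Proof.
  intros H. apply RInt_ext. intros x. rewrite Rmin_left, Rmax_right by apply mPI_le.
  intros Hx. apply H. lra.
Qed.

Lemma I2_const c : I2 (fun _ => c) = 2 * PI * c.
Proof. unfold I2. rewrite RInt_const. change ((PI - - PI) * c = 2 * PI * c). ring. Qed.

Lemma I2_pos f : icont f -> (forall x, 0 <= f x) -> 0 <= I2 f.
Proof.
  intros Hf H. apply RInt_ge_0; [apply mPI_le| |intros; apply H].
  eexists; apply icont_RInt; exact Hf.
Qed.

Section Bessel.

Context (e : nat -> R -> R) (h : R -> R).
Hypothesis He : forall n, icont (e n).
Hypothesis Horth : forall i j, i <> j -> I2 (fun x => e i x * e j x) = 0.
Hypothesis Hnorm : forall i, I2 (fun x => e i x * e i x) = PI.
Hypothesis Hh : icont h.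

Let b (n : nat) : R := / PI * I2 (fun x => h x * e n x).

(** The function [h] minus its first [N] components. *)
Fixpoint bessel_rem (N : nat) (x : R) : R :=
  match N with
  | O => h x
  | S N' => bessel_rem N' x - b N' * e N' x
  end.

Lemma bessel_rem_cont N : icont (bessel_rem N).
Proof.
  induction N as [|N IH]; [exact Hh|].
  apply icont_minus; [exact IH|]. apply icont_cmult, He.
Qed.

Lemma bessel_rem_coef N j : (N <= j)%nat ->
  I2 (fun x => bessel_rem N x * e j x) = PI * b j.
Proof.
  assert (Hpi := PI_RGT_0).
  induction N as [|N IH]; intros Hj.
  - simpl. unfold b. field. lra.
  - rewrite (I2_ext _ (fun x => bessel_rem N x * e j x - b N * (e N x * e j x))).
    + rewrite I2_minus, I2_cmult, Horth, IH by
        (try apply icont_cmult; try apply icont_mult; try apply He;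
         try apply bessel_rem_cont; lia).
      ring.
    + intros x _. simpl. ring.
Qed.

Lemma bessel_rem_norm N :
  I2 (fun x => bessel_rem (S N) x * bessel_rem (S N) x) =
  I2 (fun x => h x * h x) - PI * sum_n (fun n => b n * b n) N.
Proof.
  assert (Step : forall N, I2 (fun x => bessel_rem (S N) x * bessel_rem (S N) x) =
    I2 (fun x => bessel_rem N x * bessel_rem N x) - PI * (b N * b N)).
  { intros K. rewrite (I2_ext _ (fun x => bessel_rem K x * bessel_rem K x
      - (2 * b K) * (bessel_rem K x * e K x) + (b K * b K) * (e K x * e K x))).
    - assert (C1 := bessel_rem_cont K). assert (C2 := He K).
      rewrite I2_plus, I2_minus, !I2_cmult, Hnorm, bessel_rem_coef; try apply le_n;
        repeat first [assumption | apply icont_cmult | apply icont_mult | apply icont_minus].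
      ring.
    - intros x _. simpl. ring. }
  induction N as [|N IH].
  - rewrite Step, sum_O. reflexivity.
  - rewrite Step, IH, sum_Sn. unfold plus; simpl. ring.
Qed.

(** Bessel's inequality forces the coefficients to zero. *)
Lemma bessel_lim : is_lim_seq (fun n => I2 (fun x => h x * e n x)) 0.
Proof.
  assert (Hpi := PI_RGT_0).
  assert (Hb : is_lim_seq (fun n => b n * b n) 0).
  { apply ex_series_lim_0.
    destruct (ex_finite_lim_seq_incr (sum_n (fun n => b n * b n)) (/ PI * I2 (fun x => h x * h x)))
      as [l Hl].
    - intros n. rewrite sum_Sn. unfold plus; simpl. generalize (Rle_0_sqr (b (S n))). unfold Rsqr; lra.
    - intros n. assert (H := bessel_rem_norm n).
      assert (H0 : 0 <= I2 (fun x => bessel_rem (S n) x * bessel_rem (S n) x)).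
      { apply I2_pos; [apply icont_mult; apply bessel_rem_cont|].
        intros x. apply Rle_0_sqr. }
      rewrite H in H0. apply (Rmult_le_reg_l PI); [exact Hpi|].
      rewrite <- Rmult_assoc, Rinv_r, Rmult_1_l by lra. lra.
    - exists l. exact Hl. }
  apply is_lim_seq_abs_0.
  apply (is_lim_seq_ext (fun n => PI * sqrt (b n * b n))).
  { intros n. change (b n * b n) with (Rsqr (b n)). rewrite sqrt_Rsqr_abs.
    rewrite <- (Rabs_pos_eq PI) at 1 by lra. rewrite <- Rabs_mult. f_equal.
    unfold b. field. lra. }
  replace (Finite 0) with (Rbar_mult PI (sqrt 0)) by (rewrite sqrt_0; simpl; f_equal; ring).
  apply is_lim_seq_scal_l. apply (is_lim_seq_continuous sqrt); [|exact Hb].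
  apply continuity_pt_sqrt. lra.
Qed.

End Bessel.

Lemma sin_INR_PI n : sin (INR n * PI) = 0.
Proof. apply sin_eq_0_1. exists (Z.of_nat n). rewrite <- INR_IZR_INZ. reflexivity. Qed.

Lemma continuous_cos_lin c x : continuous (fun u => cos (c * u)) x.
Proof. apply ex_derive_continuous_R. auto_derive; trivial. Qed.

Lemma continuous_sin_lin c x : continuous (fun u => sin (c * u)) x.
Proof. apply ex_derive_continuous_R. auto_derive; trivial. Qed.

Lemma I2_cos n : (0 < n)%nat -> I2 (fun u => cos (INR n * u)) = 0.
Proof.
  intros Hn. apply lt_0_INR in Hn. unfold I2.
  rewrite (RInt_of_derive (fun u => / INR n * sin (INR n * u))).
  - rewrite <- Ropp_mult_distr_r, sin_neg, sin_INR_PI. ring.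
  - intros x. auto_derive; [trivial|]. field. lra.
  - intros; apply continuous_cos_lin.
Qed.

(** The half-integer sines. *)
Definition hsin (n : nat) (u : R) : R := sin ((INR n + / 2) * u).

Lemma hsin_prod i j u : (i <= j)%nat ->
  hsin i u * hsin j u = / 2 * (cos (INR (j - i) * u) - cos (INR (i + j + 1) * u)).
Proof.
  intros H. unfold hsin. rewrite minus_INR, !plus_INR by exact H. simpl (INR 1).
  replace ((INR j - INR i) * u) with ((INR j + / 2) * u - (INR i + / 2) * u) by ring.
  replace ((INR i + INR j + 1) * u) with ((INR j + / 2) * u + (INR i + / 2) * u) by field.
  rewrite cos_minus, cos_plus. field.
Qed.

Lemma icont_cos c : icont (fun u => cos (c * u)).
Proof. apply icont_all. intros; apply continuous_cos_lin. Qed.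

Lemma hsin_orth i j : i <> j -> I2 (fun x => hsin i x * hsin j x) = 0.
Proof.
  assert (Main : forall i j, (i < j)%nat -> I2 (fun x => hsin i x * hsin j x) = 0).
  { clear i j. intros i j H.
    rewrite (I2_ext _ (fun u => / 2 * (cos (INR (j - i) * u) - cos (INR (i + j + 1) * u)))).
    - rewrite I2_cmult, I2_minus, !I2_cos by (try apply icont_minus; try apply icont_cos; lia). ring.
    - intros; apply hsin_prod; lia. }
  intros H. destruct (Nat.lt_gt_cases i j) as [H1 _]. destruct (H1 H) as [Hlt|Hgt].
  - apply Main; exact Hlt.
  - rewrite (I2_ext _ (fun x => hsin j x * hsin i x)); [apply Main; exact Hgt|].
    intros; apply Rmult_comm.
Qed.

Lemma hsin_norm i : I2 (fun x => hsin i x * hsin i x) = PI.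
Proof.
  rewrite (I2_ext _ (fun u => / 2 * (1 - cos (INR (i + i + 1) * u)))).
  - rewrite I2_cmult, I2_minus, I2_cos, I2_const by
      (try apply icont_minus; try apply icont_cos; try apply icont_const; lia). field.
  - intros u _. rewrite hsin_prod by lia. rewrite Nat.sub_diag. simpl (INR 0).
    rewrite Rmult_0_l, cos_0. reflexivity.
Qed.

(** The difference quotient of [f] at [x], completed by [l]. *)
Definition slope (f : R -> R) (l x u : R) : R :=
  if Req_EM_T u 0 then l else (f (x + u) - f x) / u.

Lemma slope_mult f l x u : f (x + u) - f x = slope f l x u * u.
Proof.
  unfold slope. destruct (Req_EM_T u 0) as [->|H].
  - rewrite Rplus_0_r. ring.
  - field. exact H.
Qed.

Lemma slope_cont f f' x u : (forall t, is_derive f t (f' t)) ->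
  continuous (slope f (f' x) x) u.
Proof.
  intros Hf. destruct (Req_dec u 0) as [->|Hu].
  - apply filterlim_locally. intros eps.
    destruct (Hf x) as [_ Hd].
    specialize (Hd x (fun P H => H) (mkposreal (eps / 2) ltac:(generalize (cond_pos eps); lra))).
    destruct Hd as [d Hd]. exists d. intros u0 Hu. set (u := u0 : R). change u0 with u in Hu |- *. clearbody u. clear u0.
    change (Rabs (slope f (f' x) x u - slope f (f' x) x 0) < eps).
    unfold slope at 2. destruct (Req_EM_T 0 0) as [_|K]; [|lra].
    assert (Hp := cond_pos eps).
    unfold slope. destruct (Req_EM_T u 0) as [E|E]; [rewrite Rminus_diag, Rabs_R0; exact Hp|].
    specialize (Hd (x + u)).
    assert (Hb : ball x d (x + u)).
    { change (Rabs (x + u - x) < d). replace (x + u - x) with (u - 0) by ring. exact Hu. }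
    specialize (Hd Hb).
    change (Rabs (f (x + u) - f x - (x + u - x) * f' x) <= eps / 2 * Rabs (x + u - x)) in Hd.
    replace (x + u - x) with u in Hd by ring.
    replace ((f (x + u) - f x) / u - f' x) with ((f (x + u) - f x - u * f' x) / u) by (field; exact E).
    unfold Rdiv. rewrite Rabs_mult, Rabs_inv.
    assert (Hu' : 0 < Rabs u) by (apply Rabs_pos_lt; exact E).
    apply (Rmult_lt_reg_r (Rabs u)); [exact Hu'|].
    rewrite Rmult_assoc, Rinv_l, Rmult_1_r by lra. nra.
  - apply (continuous_ext_loc _ (fun u => (f (x + u) - f x) / u)).
    + assert (Hp : 0 < Rabs u) by (apply Rabs_pos_lt; exact Hu).
      exists (mkposreal _ Hp). intros v0 Hv. set (v := v0 : R). change v0 with v in Hv |- *. clearbody v. clear v0.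
      change (Rabs (v - u) < Rabs u) in Hv.
      unfold slope. destruct (Req_EM_T v 0) as [E|E]; [|reflexivity].
      subst v. rewrite Rminus_0_l, Rabs_Ropp in Hv. lra.
    + apply ex_derive_continuous_R. auto_derive.
      repeat split; try exact Hu. exists (f' (x + u)). apply Hf.
Qed.

(** The Dirichlet kernel, and its product with [2 sin (u / 2)]. *)
Fixpoint dir (N : nat) (u : R) : R :=
  match N with
  | O => / 2
  | S N' => dir N' u + cos (INR N * u)
  end.

Lemma dir_sin N u : 2 * sin (u / 2) * dir N u = hsin N u.
Proof.
  induction N as [|N IH].
  - unfold hsin; simpl. replace ((0 + / 2) * u) with (u / 2) by field. field.
  - change (dir (S N) u) with (dir N u + cos (INR (S N) * u)).
    rewrite Rmult_plus_distr_l, IH. unfold hsin. rewrite S_INR.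
    replace ((INR N + / 2) * u) with ((INR N + 1) * u - u / 2) by field.
    replace ((INR N + 1 + / 2) * u) with ((INR N + 1) * u + u / 2) by field.
    rewrite sin_minus, sin_plus. ring.
Qed.

Lemma dir_cont N : icont (dir N).
Proof.
  induction N as [|N IH]; [apply icont_const|].
  apply icont_plus; [exact IH|apply icont_cos].
Qed.

Lemma I2_dir g N : icont g ->
  I2 (fun u => g u * dir (S N) u) =
  / 2 * I2 g + sum_n (fun k => I2 (fun u => g u * cos (INR (S k) * u))) N.
Proof.
  intros Hg.
  assert (Step : forall N, I2 (fun u => g u * dir (S N) u) =
    I2 (fun u => g u * dir N u) + I2 (fun u => g u * cos (INR (S N) * u))).
  { intros K. rewrite <- I2_plus by (apply icont_mult; [exact Hg|try apply dir_cont; apply icont_cos]).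
    apply I2_ext. intros u _. change (dir (S K) u) with (dir K u + cos (INR (S K) * u)). ring. }
  induction N as [|N IH].
  - rewrite Step, sum_O. f_equal. rewrite <- I2_cmult by exact Hg.
    apply I2_ext. intros; simpl; ring.
  - rewrite Step, IH, sum_Sn. unfold plus; simpl. ring.
Qed.

Lemma I2_dir_1 N : I2 (dir N) = PI.
Proof.
  induction N as [|N IH].
  - simpl. rewrite I2_const. field.
  - change (I2 (fun u => dir N u + cos (INR (S N) * u)) = PI).
    rewrite I2_plus, IH, I2_cos by (try apply dir_cont; try apply icont_cos; lia). ring.
Qed.

(** The quotient [(g (t0 + u) - g t0) / (2 sin (u / 2))] extends continuously to
    [u = 0], so its coefficients on the half-integer sines tend to zero. *)
Lemma dirichlet_lim (g g' : R -> R) t0 : (forall t, is_derive g t (g' t)) ->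
  is_lim_seq (fun N => I2 (fun u => g (t0 + u) * dir N u)) (PI * g t0).
Proof.
  intros Hg.
  pose (q := fun u => slope g (g' t0) t0 u / slope (fun u => 2 * sin (u / 2)) 1 0 u).
  assert (Hpi := PI_RGT_0).
  assert (Hs : forall t, is_derive (fun u => 2 * sin (u / 2)) t (cos (t / 2))).
  { intros t. auto_derive; [trivial|]. unfold Rdiv. field. }
  assert (Hs0 : forall u, - PI <= u <= PI -> slope (fun u => 2 * sin (u / 2)) 1 0 u <> 0).
  { intros u Hu E. unfold slope in E. destruct (Req_EM_T u 0) as [Hz|Hz]; [lra|].
    assert (E2 := slope_mult (fun u => 2 * sin (u / 2)) 1 0 u).
    unfold slope in E2. destruct (Req_EM_T u 0) as [|_]; [lra|]. rewrite E in E2.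
    cbv beta in E2. rewrite Rplus_0_l in E2. unfold Rdiv in E2 at 2. rewrite Rmult_0_l, sin_0 in E2.
    assert (sin (u / 2) = 0) by lra.
    destruct (Rlt_dec 0 u).
    - assert (0 < sin (u / 2)) by (apply sin_gt_0; lra). lra.
    - assert (0 < sin (- (u / 2))) by (apply sin_gt_0; lra). rewrite sin_neg in *. lra. }
  assert (Hq : icont q).
  { intros u Hu. apply (continuous_mult (K := R_AbsRing)).
    - apply slope_cont; exact Hg.
    - apply (continuous_comp (slope (fun u => 2 * sin (u / 2)) 1 0) Rinv).
      + replace 1 with (cos (0 / 2)) by (unfold Rdiv; rewrite Rmult_0_l; apply cos_0).
        apply (slope_cont _ (fun t => cos (t / 2))). exact Hs.
      + apply continuous_Rinv, Hs0, Hu. }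
  assert (Hgc : icont (fun u => g (t0 + u))).
  { apply icont_all. intros x. apply ex_derive_continuous_R.
    auto_derive. exists (g' (t0 + x)). apply Hg. }
  assert (HL := bessel_lim hsin q (fun n => icont_all _ (fun x => continuous_sin_lin _ x))
    hsin_orth hsin_norm Hq).
  apply (is_lim_seq_ext (fun N => I2 (fun x => q x * hsin N x) + PI * g t0)).
  - intros N. rewrite (I2_ext (fun x => q x * hsin N x)
      (fun u => g (t0 + u) * dir N u - g t0 * dir N u)).
    + rewrite I2_minus, I2_cmult, I2_dir_1 by
        (try apply icont_cmult; try apply icont_mult; try apply dir_cont; exact Hgc). ring.
    + intros u Hu. rewrite <- dir_sin.
      assert (E1 := slope_mult g (g' t0) t0 u).
      assert (E2 := slope_mult (fun u => 2 * sin (u / 2)) 1 0 u).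
      cbv beta in E2. rewrite Rplus_0_l in E2. unfold Rdiv in E2 at 2.
      rewrite Rmult_0_l, sin_0, Rmult_0_r, Rminus_0_r in E2.
      rewrite E2, <- Rmult_minus_distr_r, E1. unfold q. field. apply Hs0, Hu.
  - replace (Finite (PI * g t0)) with (Rbar_plus 0 (PI * g t0)) by (simpl; f_equal; ring).
    apply is_lim_seq_plus'; [exact HL|apply is_lim_seq_const].
Qed.

Lemma I2_shift (G : R -> R) t0 : (forall t, continuous G t) ->
  (forall t, G (t + 2 * PI) = G t) -> I2 (fun u => G (t0 + u)) = I2 G.
Proof.
  intros Hc Hp.
  assert (Hsh : forall x, prim G (x + 2 * PI) = prim G x + prim G (2 * PI)).
  { apply (eq_of_derive _ _ G) with (x0 := 0).
    - intros x. apply is_derive_shift. rewrite <- (Hp x). apply prim_derive, Hc.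
    - intros x. replace (G x) with (plus (G x) 0) by apply (plus_zero_r (G x)).
      apply (is_derive_plus (V := R_NormedModule)); [apply prim_derive, Hc|].
      apply (is_derive_const (V := R_NormedModule)).
    - rewrite Rplus_0_l, prim_0. ring. }
  assert (E : forall t, I2 (fun u => G (t + u)) = prim G (2 * PI)).
  { intros t. unfold I2. rewrite (RInt_of_derive (fun u => prim G (u + t))).
    - replace (PI + t) with ((- PI + t) + 2 * PI) by ring. rewrite Hsh. ring.
    - intros x. apply is_derive_shift. rewrite (Rplus_comm t x). apply prim_derive, Hc.
    - intros x. apply (continuous_comp (fun u => t + u) G); [|apply Hc].
      apply ex_derive_continuous_R. auto_derive; trivial. }
  rewrite E, <- (E 0). apply I2_ext. intros; f_equal; ring.
Qed.

Lemma cos_INR_per n t : cos (INR n * (t + 2 * PI)) = cos (INR n * t).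
Proof.
  replace (INR n * (t + 2 * PI)) with (INR n * t + 2 * INR n * PI) by ring. apply cos_period.
Qed.
Lemma sin_INR_per n t : sin (INR n * (t + 2 * PI)) = sin (INR n * t).
Proof.
  replace (INR n * (t + 2 * PI)) with (INR n * t + 2 * INR n * PI) by ring. apply sin_period.
Qed.

(** Pointwise convergence for a differentiable periodic function. *)
Lemma fourier_series (g g' : R -> R) t0 : (forall t, is_derive g t (g' t)) ->
  (forall t, g (t + 2 * PI) = g t) ->
  is_series (fun k => cos (INR (S k) * t0) * I2 (fun t => g t * cos (INR (S k) * t))
                    + sin (INR (S k) * t0) * I2 (fun t => g t * sin (INR (S k) * t)))
    (PI * g t0 - / 2 * I2 g).
Proof.
  intros Hg Hp.
  assert (Hc : forall t, continuous g t).
  { intros t. apply ex_derive_continuous_R.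
    exists (g' t); apply Hg. }
  assert (Hgc : icont (fun u => g (t0 + u))).
  { apply icont_all. intros x. apply ex_derive_continuous_R.
    auto_derive. exists (g' (t0 + x)). apply Hg. }
  assert (HL := dirichlet_lim g g' t0 Hg). apply is_lim_seq_incr_1 in HL.
  change (is_lim_seq (sum_n (fun k => cos (INR (S k) * t0) * I2 (fun t => g t * cos (INR (S k) * t))
                    + sin (INR (S k) * t0) * I2 (fun t => g t * sin (INR (S k) * t))))
    (PI * g t0 - / 2 * I2 g)).
  apply (is_lim_seq_ext (fun N => I2 (fun u => g (t0 + u) * dir (S N) u) - / 2 * I2 g)).
  - intros N. rewrite I2_dir by exact Hgc. rewrite (I2_shift g t0 Hc Hp).
    unfold Rminus. rewrite Rplus_comm, <- Rplus_assoc, Rplus_opp_l, Rplus_0_l.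
    apply sum_n_ext. intros k.
    rewrite <- (I2_cmult (cos (INR (S k) * t0))) by
      (apply icont_mult; [apply icont_all, Hc|apply icont_cos]).
    rewrite <- (I2_cmult (sin (INR (S k) * t0))) by
      (apply icont_mult; [apply icont_all, Hc|apply icont_all; intros; apply continuous_sin_lin]).
    rewrite <- I2_plus by (apply icont_cmult, icont_mult; [apply icont_all, Hc|
       try apply icont_cos; apply icont_all; intros; apply continuous_sin_lin]).
    rewrite <- (I2_shift (fun x => cos (INR (S k) * t0) * (g x * cos (INR (S k) * x)) +
       sin (INR (S k) * t0) * (g x * sin (INR (S k) * x))) t0).
    + apply I2_ext. intros u _.
      replace (INR (S k) * u) with (INR (S k) * (t0 + u) - INR (S k) * t0) by ring.
      rewrite cos_minus. ring.
    + intros t. apply ex_derive_continuous_R. auto_derive.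
      repeat split; exists (g' t); apply Hg.
    + intros t. cbv beta. rewrite Hp, cos_INR_per, sin_INR_per. reflexivity.
  - apply is_lim_seq_minus'; [exact HL|apply is_lim_seq_const].
Qed.

Lemma I2_odd f : icont f -> (forall x, f (- x) = - f x) -> I2 f = 0.
Proof.
  intros Hf Ho. assert (H := icont_RInt f Hf).
  assert (H2 : is_RInt f PI (- PI) (I2 f)).
  { apply (is_RInt_ext (fun y => opp (f (- y)))).
    - intros x _. rewrite Ho. apply Ropp_involutive.
    - apply (is_RInt_comp_opp (V := R_NormedModule)). rewrite Ropp_involutive. exact H. }
  apply (is_RInt_swap (V := R_NormedModule)) in H2.
  assert (E := is_RInt_unique (V := R_CompleteNormedModule) _ _ _ _ H2).
  change (I2 f = - I2 f) in E. lra.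
Qed.

(** * Functions on the circle *)

(** An angle of a point of the circle, between [- PI] and [PI]. *)
Definition angle (w : C) : R :=
  if Rle_dec 0 (Im w) then acos (Re w) else - acos (Re w).

Lemma onT_sqr w : onT w -> Re w ^ 2 + Im w ^ 2 = 1.
Proof.
  unfold onT, Cmod. intros H. unfold Re, Im.
  rewrite <- (sqrt_sqrt (fst w ^ 2 + snd w ^ 2)) by nra. rewrite H. ring.
Qed.

Lemma cis_angle w : onT w -> cis (angle w) = w.
Proof.
  intros H. apply onT_sqr in H. destruct w as [x y]. unfold angle, cis, Re, Im in *; simpl in *.
  assert (Hx : -1 <= x <= 1) by nra.
  assert (Hs : sin (acos x) = Rabs y).
  { rewrite sin_acos by exact Hx. rewrite <- sqrt_Rsqr_abs. f_equal. unfold Rsqr. lra. }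
  destruct (Rle_dec 0 y) as [Hy|Hy].
  - rewrite cos_acos, Hs, Rabs_pos_eq by assumption. reflexivity.
  - rewrite cos_neg, sin_neg, cos_acos, Hs, Rabs_left by lra. f_equal. ring.
Qed.

Lemma angle_bound w : - PI <= angle w <= PI.
Proof.
  generalize (acos_bound (Re w)) PI_RGT_0. unfold angle.
  destruct (Rle_dec 0 (Im w)); lra.
Qed.

Lemma onT_cis s : onT (cis s).
Proof.
  unfold onT, Cmod, cis; simpl. rewrite !Rmult_1_r, Rplus_comm.
  generalize (sin2_cos2 s). unfold Rsqr. intros ->. apply sqrt_1.
Qed.

Lemma cos_eq_1_2PI x : cos x = 1 -> exists k : Z, x = IZR k * (2 * PI).
Proof.
  intros H. assert (Hs : sin (x / 2) = 0).
  { assert (E : cos x = 1 - 2 * sin (x / 2) * sin (x / 2)).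
    { rewrite <- cos_2a_sin. f_equal. field. }
    assert (sin (x / 2) * sin (x / 2) = 0) by lra.
    apply Rmult_integral in H0. destruct H0; assumption. }
  apply sin_eq_0_0 in Hs. destruct Hs as [k Hk]. exists k. lra.
Qed.

Lemma periodic_nat (V : R -> C) P : (forall s, V (s + P) = V s) ->
  forall (n : nat) s, V (s + INR n * P) = V s.
Proof.
  intros HV n. induction n as [|n IH]; intros s.
  - simpl. rewrite Rmult_0_l, Rplus_0_r. reflexivity.
  - rewrite S_INR. replace (s + (INR n + 1) * P) with ((s + INR n * P) + P) by ring.
    rewrite HV. apply IH.
Qed.

Lemma periodic_Z (V : R -> C) P : (forall s, V (s + P) = V s) ->
  forall (k : Z) s, V (s + IZR k * P) = V s.
Proof.
  intros HV k s. destruct (Z_le_gt_dec 0 k) as [Hk|Hk].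
  - rewrite <- (Z2Nat.id k) by lia. rewrite <- INR_IZR_INZ. apply periodic_nat, HV.
  - rewrite <- (periodic_nat V P HV (Z.to_nat (- k)) (s + IZR k * P)).
    f_equal. rewrite INR_IZR_INZ, Z2Nat.id by lia. rewrite opp_IZR. ring.
Qed.

Lemma periodic_angle (V : R -> C) s : (forall s, V (s + 2 * PI) = V s) ->
  V (angle (cis s)) = V s.
Proof.
  intros HV. set (t := angle (cis s)).
  assert (E : cis t = cis s) by (apply cis_angle, onT_cis).
  assert (Ec : cos t = cos s) by exact (f_equal fst E).
  assert (Es : sin t = sin s) by exact (f_equal snd E).
  destruct (cos_eq_1_2PI (t - s)) as [k Hk].
  - rewrite cos_minus, Ec, Es. generalize (sin2_cos2 s). unfold Rsqr. lra.
  - replace t with (s + IZR k * (2 * PI)) by lra. apply (periodic_Z V _ HV).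
Qed.

Lemma Cder_ext f g t l : (forall x, f x = g x) -> Cder f t l -> Cder g t l.
Proof.
  intros E [H1 H2]. split.
  - apply (is_derive_ext (fun x => Re (f x))); [intros; rewrite E; reflexivity|exact H1].
  - apply (is_derive_ext (fun x => Im (f x))); [intros; rewrite E; reflexivity|exact H2].
Qed.

Lemma Cder_shift f s l : Cder f s l -> Cder (fun t => f (s + t)) 0 l.
Proof.
  intros H. eapply Cder_eq.
  - apply (Cder_comp f (fun t => s + t) 0 l 1).
    + rewrite Rplus_0_r. exact H.
    + auto_derive; [trivial|ring].
  - ring.
Qed.

(** [wder] acts as [- i d/ds] in terms of the angle. *)
Lemma wder_eq f V s l : (forall s, f (cis s) = V s) -> Cder V s l ->
  wder f (cis s) = (- Ci * l)%C.
Proof.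
  intros E H. apply Cder_shift in H.
  apply (Cder_ext _ (fun t => f (cis s * cis t)%C)) in H.
  - destruct H as [H1 H2]. unfold wder. f_equal.
    transitivity (Re l, Im l); [|destruct l; reflexivity].
    f_equal; apply is_derive_unique; assumption.
  - intros x. rewrite <- cis_plus, E. reflexivity.
Qed.

Lemma Cder_is_derive (f : R -> C) t l : Cder f t l ->
  is_derive (V := C_R_NormedModule) f t l.
Proof.
  intros [H1 H2]. split; [apply is_linear_scal_l|].
  intros x Hx eps. destruct H1 as [_ H1], H2 as [_ H2].
  assert (He : 0 < eps / 2) by (generalize (cond_pos eps); lra).
  generalize (filter_and _ _ (H1 x Hx (mkposreal _ He)) (H2 x Hx (mkposreal _ He))).
  apply filter_imp. intros y [Hy1 Hy2]. simpl pos in Hy1, Hy2.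
  eapply Rle_trans; [apply (norm_pair_le (U := R_NormedModule) (V := R_NormedModule))|].
  eapply Rle_trans; [apply Rplus_le_compat; [exact Hy1|exact Hy2]|].
  apply Req_le. simpl. field.
Qed.

Lemma C_continuous_pair (f : R -> C) t :
  continuous (fun x => Re (f x)) t -> continuous (fun x => Im (f x)) t ->
  continuous (U := C_R_NormedModule) f t.
Proof.
  intros H1 H2. apply (filterlim_locally (U := C_R_NormedModule)). intros eps.
  assert (L1 := proj1 (filterlim_locally _ _) H1 eps).
  assert (L2 := proj1 (filterlim_locally _ _) H2 eps).
  generalize (filter_and _ _ L1 L2). apply filter_imp.
  intros y [Hy1 Hy2]. split; assumption.
Qed.

Lemma Cder_continuous f t l : Cder f t l ->
  continuous (fun x => Re (f x)) t /\ continuous (fun x => Im (f x)) t.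
Proof.
  intros [H1 H2].
  split; apply ex_derive_continuous_R; eexists; eassumption.
Qed.

Lemma continuous_shift (f : R -> R) s : continuous f s -> continuous (fun t => f (s + t)) 0.
Proof.
  intros H. apply (continuous_comp (fun t => s + t) f).
  - apply ex_derive_continuous_R. auto_derive; trivial.
  - rewrite Rplus_0_r. exact H.
Qed.

Lemma Cpow_cis s n : Cpow (cis s) n = cis (INR n * s).
Proof.
  induction n as [|n IH].
  - simpl. rewrite Rmult_0_l, cis_0. reflexivity.
  - rewrite S_INR. change (Cpow (cis s) (S n)) with (cis s * Cpow (cis s) n)%C.
    rewrite IH, <- cis_plus. f_equal. ring.
Qed.

Lemma Cinv_cis s : Cinv (cis s) = cis (- s).
Proof.
  assert (H : cis s <> 0).
  { intros E. generalize (onT_cis s). unfold onT. rewrite E, Cmod_0. lra. }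
  transitivity (Cinv (cis s) * (cis s * cis (- s)))%C.
  - rewrite cis_mult_neg. ring.
  - field. exact H.
Qed.

Lemma Cpowz_cis s k : Cpowz (cis s) k = cis (IZR k * s).
Proof.
  destruct k as [|p|p]; simpl Cpowz.
  - rewrite Rmult_0_l, cis_0. reflexivity.
  - rewrite Cpow_cis, INR_IZR_INZ, positive_nat_Z. reflexivity.
  - rewrite Cpow_cis, Cinv_cis, INR_IZR_INZ, positive_nat_Z. f_equal.
    change (Zneg p) with (- Zpos p)%Z. rewrite opp_IZR. ring.
Qed.

Lemma is_series_pair (u : nat -> C) (l : C) :
  is_series (fun k => Re (u k)) (Re l) -> is_series (fun k => Im (u k)) (Im l) ->
  is_series (V := C_R_NormedModule) u l.
Proof.
  intros H1 H2.
  assert (E : forall N, sum_n (G := C_R_NormedModule) u N =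
    (sum_n (fun k => Re (u k)) N, sum_n (fun k => Im (u k)) N)).
  { induction N as [|N IH].
    - rewrite !sum_O. destruct (u O); reflexivity.
    - rewrite !sum_Sn, IH. destruct (u (S N)); reflexivity. }
  apply (filterlim_locally (U := C_R_NormedModule)). intros eps.
  assert (L1 := proj1 (filterlim_locally _ _) H1 eps).
  assert (L2 := proj1 (filterlim_locally _ _) H2 eps).
  generalize (filter_and _ _ L1 L2). apply filter_imp.
  intros N [Hy1 Hy2]. rewrite E. split; assumption.
Qed.

(** The mean over the circle of a curve of period [2 PI / m] that commutes with
    conjugation, so that only the real part contributes. *)
Definition cmean (m : nat) (v : R -> C) : R :=
  / (2 * PI) * I2 (fun t => Re (v (t / INR m))).

(** The function on the circle attached to a curve, with its mean removed. *)
Definition circ (m : nat) (v : R -> C) (w : C) : C :=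
  (v (angle w) - RtoC (cmean m v))%C.

Section Curve.

Context (m : nat) (v v1 v2 : R -> C).
Hypothesis Hm : (1 <= m)%nat.
Hypothesis Hv : forall s, Cder v s (v1 s).
Hypothesis Hv1 : forall s, Cder v1 s (v2 s).
Hypothesis Hv2 : forall s, continuous (fun x => Re (v2 x)) s /\ continuous (fun x => Im (v2 x)) s.
Hypothesis Hper : forall s, v (s + 2 * PI / INR m) = v s.
Hypothesis Hconj : forall s, v (- s) = Cconj (v s).

Lemma m_pos : 0 < INR m.
Proof. apply lt_0_INR. lia. Qed.

Lemma v_per s : v (s + 2 * PI) = v s.
Proof.
  generalize m_pos; intros.
  rewrite <- (periodic_nat v _ Hper m s). f_equal. field. lra.
Qed.

Lemma circ_cis s : circ m v (cis s) = (v s - RtoC (cmean m v))%C.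
Proof. unfold circ. rewrite (periodic_angle v s v_per). reflexivity. Qed.

Lemma circ_wder s : wder (circ m v) (cis s) = (- Ci * v1 s)%C.
Proof.
  apply (wder_eq _ (fun s => v s + - RtoC (cmean m v))%C).
  - intros; apply circ_cis.
  - eapply Cder_eq; [apply Cder_plus; [apply Hv|apply Cder_const]|]. ring.
Qed.

Lemma circ_wder2 s : wder (wder (circ m v)) (cis s) = (- v2 s)%C.
Proof.
  rewrite (wder_eq _ (fun s => - Ci * v1 s)%C s (- Ci * v2 s)%C).
  - destruct (v2 s) as [p q]. unfold Ci, Copp, Cmult; simpl. f_equal; ring.
  - intros; apply circ_wder.
  - eapply Cder_eq; [apply Cder_mult; [apply Cder_const|apply Hv1]|]. cbv beta. ring.
Qed.

Lemma circ_C2T : C2T (circ m v).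
Proof.
  intros w Hw. set (s := angle w). replace w with (cis s) by (apply cis_angle, Hw).
  assert (E0 : forall t, circ m v (cis s * cis t)%C = (v (s + t) + - RtoC (cmean m v))%C)
    by (intros; rewrite <- cis_plus; apply circ_cis).
  assert (E1 : forall t, wder (circ m v) (cis s * cis t)%C = (- Ci * v1 (s + t))%C)
    by (intros; rewrite <- cis_plus; apply circ_wder).
  assert (E2 : forall t, wder (wder (circ m v)) (cis s * cis t)%C = (- v2 (s + t))%C)
    by (intros; rewrite <- cis_plus; apply circ_wder2).
  split; [|split].
  - eexists. apply Cder_is_derive.
    apply (Cder_ext (fun t => v (s + t) + - RtoC (cmean m v))%C);
      [intros; symmetry; apply E0|].
    apply Cder_plus; [apply Cder_shift, Hv|apply Cder_const].
  - eexists. apply Cder_is_derive.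
    apply (Cder_ext (fun t => - Ci * v1 (s + t))%C); [intros; symmetry; apply E1|].
    apply Cder_mult; [apply Cder_const|apply Cder_shift, Hv1].
  - destruct (Hv2 s) as [C1 C2]. apply C_continuous_pair.
    + apply (continuous_ext (fun t => - Re (v2 (s + t)))).
      { intros t. rewrite E2. destruct (v2 (s + t)); reflexivity. }
      apply (continuous_opp (V := R_NormedModule)). apply (continuous_shift (fun x => Re (v2 x)) s C1).
    + apply (continuous_ext (fun t => - Im (v2 (s + t)))).
      { intros t. rewrite E2. destruct (v2 (s + t)); reflexivity. }
      apply (continuous_opp (V := R_NormedModule)). apply (continuous_shift (fun x => Im (v2 x)) s C2).
Qed.

Let F1 (t : R) : R := Re (v (t / INR m)).
Let F2 (t : R) : R := Im (v (t / INR m)).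

Lemma F_derive t : is_derive F1 t (/ INR m * Re (v1 (t / INR m))) /\
  is_derive F2 t (/ INR m * Im (v1 (t / INR m))).
Proof.
  destruct (Hv (t / INR m)) as [H1 H2].
  assert (Hd : is_derive (fun t => t / INR m) t (/ INR m)).
  { auto_derive; [trivial|]. ring. }
  split.
  - apply (is_derive_comp (V := R_NormedModule) (fun s => Re (v s)) (fun t => t / INR m)); assumption.
  - apply (is_derive_comp (V := R_NormedModule) (fun s => Im (v s)) (fun t => t / INR m)); assumption.
Qed.

Lemma F_per t : F1 (t + 2 * PI) = F1 t /\ F2 (t + 2 * PI) = F2 t.
Proof.
  unfold F1, F2. replace ((t + 2 * PI) / INR m) with (t / INR m + 2 * PI / INR m).
  - rewrite Hper. split; reflexivity.
  - field. generalize m_pos; lra.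
Qed.

Lemma F_sym t : F1 (- t) = F1 t /\ F2 (- t) = - F2 t.
Proof.
  unfold F1, F2. replace (- t / INR m) with (- (t / INR m)) by (field; generalize m_pos; lra).
  rewrite Hconj. destruct (v (t / INR m)). split; reflexivity.
Qed.

Let coef (n : Z) : R := / (2 * PI) *
  (I2 (fun t => F1 t * cos (IZR n * t)) + I2 (fun t => F2 t * sin (IZR n * t))).

(** By parity the real part of the curve has a cosine series and its imaginary
   part a sine series; the coefficients of both combine into real Fourier
   coefficients. *)
Lemma circ_series s :
  is_series (V := C_R_NormedModule)
    (fun k => let n := Z.of_nat (S k) in
      (RtoC (coef n) * Cpowz (cis s) (n * Z.of_nat m) +
       RtoC (coef (- n)%Z) * Cpowz (cis s) (- n * Z.of_nat m))%C)
    (circ m v (cis s)).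
Proof.
  assert (Hpi := PI_RGT_0). assert (Hmp := m_pos).
  pose (A := fun n : nat => I2 (fun t => F1 t * cos (INR n * t))).
  pose (B := fun n : nat => I2 (fun t => F2 t * sin (INR n * t))).
  assert (D1 : forall t, is_derive F1 t (/ INR m * Re (v1 (t / INR m)))) by (intros; apply F_derive).
  assert (D2 : forall t, is_derive F2 t (/ INR m * Im (v1 (t / INR m)))) by (intros; apply F_derive).
  assert (C1 : icont F1).
  { apply icont_all; intros. apply ex_derive_continuous_R.
    eexists; apply D1. }
  assert (C2 : icont F2).
  { apply icont_all; intros. apply ex_derive_continuous_R.
    eexists; apply D2. }
  assert (Ec : forall k, coef (Z.of_nat (S k)) = / (2 * PI) * (A (S k) + B (S k)) /\
     coef (- Z.of_nat (S k)) = / (2 * PI) * (A (S k) - B (S k))).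
  { intros k. unfold coef. rewrite opp_IZR, <- INR_IZR_INZ. split; [reflexivity|].
    f_equal. unfold Rminus. f_equal.
    - apply I2_ext. intros x _. rewrite <- Ropp_mult_distr_l, cos_neg. reflexivity.
    - replace (- B (S k)) with ((-1) * B (S k)) by ring. unfold B.
      rewrite <- I2_cmult by (apply icont_mult; [exact C2|apply icont_all; intros; apply continuous_sin_lin]).
      apply I2_ext. intros x _. rewrite <- Ropp_mult_distr_l, sin_neg. ring. }
  assert (S1 := fourier_series F1 _ (INR m * s) D1 (fun t => proj1 (F_per t))).
  assert (S2 := fourier_series F2 _ (INR m * s) D2 (fun t => proj2 (F_per t))).
  assert (Z1 : forall n, I2 (fun t => F1 t * sin (INR n * t)) = 0).
  { intros n. apply I2_odd.
    - apply icont_mult; [exact C1|apply icont_all; intros; apply continuous_sin_lin].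
    - intros x. rewrite (proj1 (F_sym x)), <- Ropp_mult_distr_r, sin_neg. ring. }
  assert (Z2 : forall n, I2 (fun t => F2 t * cos (INR n * t)) = 0).
  { intros n. apply I2_odd; [apply icont_mult; [exact C2|apply icont_cos]|].
    intros x. rewrite (proj2 (F_sym x)), <- Ropp_mult_distr_r, cos_neg. ring. }
  assert (Z3 : I2 F2 = 0).
  { apply I2_odd; [exact C2|]. intros x. apply F_sym. }
  assert (EF : v s = (F1 (INR m * s), F2 (INR m * s))).
  { unfold F1, F2. replace (INR m * s / INR m) with s by (field; lra). destruct (v s); reflexivity. }
  rewrite circ_cis, EF. 
  assert (Et : forall k, (let n := Z.of_nat (S k) in
      (RtoC (coef n) * Cpowz (cis s) (n * Z.of_nat m) +
       RtoC (coef (- n)%Z) * Cpowz (cis s) (- n * Z.of_nat m))%C) =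
     (/ PI * (cos (INR (S k) * (INR m * s)) * A (S k)),
      / PI * (sin (INR (S k) * (INR m * s)) * B (S k)))).
  { intros k. cbv zeta. destruct (Ec k) as [-> ->]. rewrite !Cpowz_cis.
    rewrite !mult_IZR, opp_IZR, <- !INR_IZR_INZ.
    replace (- INR (S k) * INR m * s) with (- (INR (S k) * (INR m * s))) by ring.
    replace (INR (S k) * INR m * s) with (INR (S k) * (INR m * s)) by ring.
    generalize (INR (S k) * (INR m * s)) (A (S k)) (B (S k)). intros x p q.
    unfold cis, Cmult, Cplus, RtoC; simpl fst; simpl snd. rewrite cos_neg, sin_neg.
    f_equal; field; lra. }
  apply (is_series_ext (V := C_R_NormedModule) _ _ _ (fun k => eq_sym (Et k))).
  apply is_series_pair.
  - replace (Re ((F1 (INR m * s), F2 (INR m * s)) - RtoC (cmean m v))%C) with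
      (scal (/ PI) (PI * F1 (INR m * s) - / 2 * I2 F1)).
    + apply (is_series_scal (V := R_NormedModule) (/ PI)).
      apply (is_series_ext _ _ _ (fun k => f_equal2 Rplus eq_refl (f_equal (Rmult _) (Z1 (S k))))) in S1.
      apply (is_series_ext (V := R_NormedModule) _
        (fun k => cos (INR (S k) * (INR m * s)) * A (S k))) in S1; [exact S1|].
      intros k. rewrite Rmult_0_r, Rplus_0_r. reflexivity.
    + unfold Re, Cminus, Cplus, Copp, RtoC, cmean; simpl. fold F1.
      unfold scal; simpl; unfold mult; simpl. field. lra.
  - replace (Im ((F1 (INR m * s), F2 (INR m * s)) - RtoC (cmean m v))%C) with
      (scal (/ PI) (PI * F2 (INR m * s) - / 2 * I2 F2)).
    + apply (is_series_scal (V := R_NormedModule) (/ PI)).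
      apply (is_series_ext (V := R_NormedModule) _
        (fun k => sin (INR (S k) * (INR m * s)) * B (S k))) in S2; [exact S2|].
      intros k. rewrite Z2, Rmult_0_r, Rplus_0_l. reflexivity.
    + rewrite Z3. unfold Im, Cminus, Cplus, Copp, RtoC; simpl.
      unfold scal; simpl; unfold mult; simpl. field. lra.
Qed.

Lemma circ_X : X m (circ m v).
Proof.
  split; [exact circ_C2T|]. exists coef. intros w Hw.
  rewrite <- (cis_angle w Hw). apply circ_series.
Qed.

End Curve.

(** * From families of waves to bifurcating curves *)

(** Joint continuity gives uniform closeness over a compact interval. *)
Lemma jcont_uniform (f : R -> R -> R) e0 a b : (forall s, jcont f e0 s) ->
  forall eps, 0 < eps -> locally e0 (fun e => forall s, a <= s <= b ->
    Rabs (f e s - f e0 s) < eps).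
Proof.
  intros Hf eps Heps.
  assert (He2 : 0 < eps / 2) by lra.
  assert (Hd : forall s, exists d : posreal, forall e' s', Rabs (e' - e0) < d ->
    Rabs (s' - s) < d -> Rabs (f e' s' - f e0 s) < eps / 2).
  { intros s. assert (L := proj1 (filterlim_locally _ _) (Hf s) (mkposreal _ He2)).
    destruct L as [d Hd]. exists d. intros e' s' H1 H2.
    apply (Hd (e', s')). split; assumption. }
  pose (delta := fun s => proj1_sig (constructive_indefinite_description _ (Hd s))).
  assert (Hdelta : forall s e' s', Rabs (e' - e0) < delta s ->
    Rabs (s' - s) < delta s -> Rabs (f e' s' - f e0 s) < eps / 2).
  { intros s. exact (proj2_sig (constructive_indefinite_description _ (Hd s))). }
  destruct (compactness_value_1d a b delta) as [d H].
  exists d. intros e He s Hs. apply NNPP. intros HN. apply (H s Hs).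
  intros [t [_ [Ht1 Ht2]]]. apply HN.
  change (Rabs (e - e0) < d) in He.
  assert (K1 := Hdelta t e s ltac:(lra) Ht1).
  assert (K2 := Hdelta t e0 s ltac:(rewrite Rminus_diag, Rabs_R0; apply cond_pos) Ht1).
  replace (f e s - f e0 s) with ((f e s - f e0 t) - (f e0 s - f e0 t)) by ring.
  eapply Rle_lt_trans; [apply Rabs_triang|]. rewrite Rabs_Ropp. lra.
Qed.

Lemma Cmod_le_sum (x : C) : Cmod x <= Rabs (Re x) + Rabs (Im x).
Proof.
  unfold Cmod, Re, Im. generalize (Rabs_pos (fst x)) (Rabs_pos (snd x)); intros.
  apply Rsqr_incr_0_var; [|lra]. rewrite Rsqr_sqrt by nra.
  rewrite <- (pow2_abs (fst x)), <- (pow2_abs (snd x)). unfold Rsqr. nra.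
Qed.

Lemma jcontC_uniform (f : R -> R -> C) e0 a b : (forall s, jcontC f e0 s) ->
  forall eps, 0 < eps -> locally e0 (fun e => forall s, a <= s <= b ->
    Cmod (f e s - f e0 s)%C < eps).
Proof.
  intros Hf eps Heps. assert (He2 : 0 < eps / 2) by lra.
  generalize (filter_and _ _
    (jcont_uniform (fun e s => Re (f e s)) e0 a b (fun s => proj1 (Hf s)) _ He2)
    (jcont_uniform (fun e s => Im (f e s)) e0 a b (fun s => proj2 (Hf s)) _ He2)).
  apply filter_imp. intros e [H1 H2] s Hs. specialize (H1 s Hs). specialize (H2 s Hs).
  eapply Rle_lt_trans; [apply Cmod_le_sum|].
  destruct (f e s) as [x y], (f e0 s) as [x' y'].
  unfold Re, Im, Rminus in *; simpl in *. lra.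
Qed.

Section Bifurcation.


Context (a Rs r : R) (m : nat) (Om : R -> R) (z z1 z2 : R -> R -> C).
Hypothesis Hm : (1 <= m)%nat.
Hypothesis Hr : 0 < r.
Hypothesis HRs : 0 < Rs.
Hypothesis HF : wave_family a (INR m) r Om z z1 z2.
Hypothesis HOm0 : Om 0 = Omega_R a Rs.
Hypothesis Hz0 : forall s, z 0 s = (RtoC Rs * cis s)%C.

(** The wave in the frame rotating along the circle. *)
Let v (e s : R) : C := (cis (- s) * z e s)%C.
Let v1 (e s : R) : C := (cis (- s) * (z1 e s - Ci * z e s))%C.
Let v2 (e s : R) : C := (cis (- s) * (z2 e s - RtoC 2 * Ci * z1 e s - z e s))%C.
Let Rc (e : R) : R := cmean m (v e).
Let lamc (e : R) : R := Om e - Omega_R a (Rc e).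
Let fc (e : R) : C -> C := circ m (v e).

Lemma Cconj_RtoC (x : R) : Cconj (RtoC x) = RtoC x.
Proof. unfold Cconj, RtoC; simpl. rewrite Ropp_0. reflexivity. Qed.

Lemma Ci_sqr : (Ci * Ci = - RtoC 1)%C.
Proof. unfold Ci, RtoC, Cmult, Copp; simpl. f_equal; ring. Qed.

Lemma cis_neg_derive s : Cder (fun s => cis (- s)) s (- Ci * cis (- s))%C.
Proof.
  eapply Cder_eq.
  - apply (Cder_comp cis (fun s => - s) s (Ci * cis (- s))%C (-1)); [apply Cder_cis|].
    auto_derive; [trivial|ring].
  - replace (RtoC (-1)) with (- RtoC 1)%C by (unfold Copp, RtoC; simpl; f_equal; ring). ring.
Qed.

Lemma v_derive e s : Rabs e < r -> Cder (v e) s (v1 e s).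
Proof.
  intros He. destruct (HF e He) as [_ [H _]]. destruct (H s) as [H1 _].
  eapply Cder_eq; [apply Cder_mult; [apply cis_neg_derive|exact H1]|].
  unfold v1. ring.
Qed.

Lemma v1_derive e s : Rabs e < r -> Cder (v1 e) s (v2 e s).
Proof.
  intros He. destruct (HF e He) as [_ [H _]]. destruct (H s) as [H1 [H2 _]].
  apply (Cder_ext (fun s => cis (- s) * (z1 e s + - Ci * z e s))%C).
  { intros x. unfold v1. ring. }
  eapply Cder_eq.
  - apply Cder_mult; [apply cis_neg_derive|].
    apply Cder_plus; [exact H2|]. apply Cder_mult; [apply Cder_const|exact H1].
  - unfold v2. cbv beta.
    replace (- Ci * cis (- s) * (z1 e s + - Ci * z e s))%C with
      (cis (- s) * (- Ci * z1 e s + Ci * Ci * z e s))%C by ring.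
    rewrite Ci_sqr.
    replace (RtoC 2) with (RtoC 1 + RtoC 1)%C by (rewrite <- RtoC_plus; f_equal; ring). ring.
Qed.

Lemma v_jcont e s : Rabs e < r -> jcontC v e s /\ jcontC v1 e s /\ jcontC v2 e s.
Proof.
  intros He. destruct (HF e He) as [_ [_ [H _]]]. destruct (H s) as [H1 [H2 H3]].
  assert (Hc : jcontC (fun _ s => cis (- s)) e s).
  { apply jcontC_cis. apply (jcont_var (fun s => - s)).
    apply ex_derive_continuous_R. auto_derive; trivial. }
  split; [apply jcontC_mult; assumption|split].
  - apply jcontC_mult; [exact Hc|]. apply jcontC_minus; [exact H2|].
    apply jcontC_mult; [apply jcontC_const|exact H1].
  - apply jcontC_mult; [exact Hc|]. apply jcontC_minus; [|exact H1].
    apply jcontC_minus; [exact H3|]. apply jcontC_mult; [apply jcontC_const|exact H2].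
Qed.

Lemma wave_per e s : Rabs e < r -> v e (s + 2 * PI / INR m) = v e s.
Proof.
  intros He. destruct (HF e He) as [_ [_ [_ [H _]]]].
  unfold v. rewrite H. set (p := 2 * PI / INR m).
  replace (- (s + p)) with (- s + - p) by ring. rewrite cis_plus.
  transitivity (cis (- s) * (cis p * cis (- p)) * z e s)%C; [ring|].
  rewrite cis_mult_neg. ring.
Qed.

Lemma v_conj e s : Rabs e < r -> v e (- s) = Cconj (v e s).
Proof.
  intros He. destruct (HF e He) as [_ [_ [_ [_ [H _]]]]].
  unfold v. rewrite H, Cmult_conj, cis_conj. reflexivity.
Qed.

Lemma jcontC_section f e s : jcontC f e s ->
  continuous (fun x => Re (f e x)) s /\ continuous (fun x => Im (f e x)) s.
Proof.
  intros [H1 H2].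
  assert (K : forall g : R -> R -> R, jcont g e s -> continuous (g e) s).
  { intros g Hg. apply filterlim_locally. intros eps.
    destruct (proj1 (filterlim_locally _ _) Hg eps) as [d Hd].
    exists d. intros y Hy. apply (Hd (e, y)). split; [apply ball_center|exact Hy]. }
  split; [exact (K _ H1)|exact (K _ H2)].
Qed.

Lemma v2_cont e s : Rabs e < r ->
  continuous (fun x => Re (v2 e x)) s /\ continuous (fun x => Im (v2 e x)) s.
Proof. intros He. apply jcontC_section, v_jcont, He. Qed.

Lemma Rc_cont e : Rabs e < r -> continuous Rc e.
Proof.
  intros He. assert (Hpi := PI_RGT_0).
  assert (Hmp : 1 <= INR m) by (apply (le_INR 1); exact Hm).
  apply filterlim_locally. intros eps.
  assert (He2 : 0 < eps / 2) by (generalize (cond_pos eps); lra).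
  assert (L : locally e (fun e' => Rabs e' < r)).
  { assert (Hg : 0 < r - Rabs e) by lra. exists (mkposreal _ Hg). intros y0 Hy.
    set (y := y0 : R). change (Rabs (y - e) < r - Rabs e) in Hy. change (Rabs y < r).
    replace y with ((y - e) + e) by ring. eapply Rle_lt_trans; [apply Rabs_triang|]. lra. }
  generalize (filter_and _ _ L (jcont_uniform (fun e s => Re (v e s)) e (- PI) PI
    (fun s => proj1 (proj1 (v_jcont e s He))) _ He2)).
  apply filter_imp. intros e' [He' H].
  change (Rabs (Rc e' - Rc e) < eps). unfold Rc, cmean.
  assert (Hc : forall e, Rabs e < r -> icont (fun t => Re (v e (t / INR m)))).
  { intros e1 He1. apply icont_all. intros t.
    apply (continuous_comp (fun t => t / INR m) (fun s => Re (v e1 s))).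
    - apply ex_derive_continuous_R. auto_derive; trivial.
    - apply (Cder_continuous _ _ _ (v_derive e1 (t / INR m) He1)). }
  rewrite <- Rmult_minus_distr_l, <- I2_minus by (apply Hc; assumption).
  rewrite Rabs_mult, Rabs_pos_eq by (apply Rlt_le, Rinv_0_lt_compat; lra).
  apply Rle_lt_trans with (eps / 2); [|lra].
  replace (eps / 2) with (/ (2 * PI) * ((PI - - PI) * (eps / 2))) by (field; lra).
  apply Rmult_le_compat_l; [apply Rlt_le, Rinv_0_lt_compat; lra|].
  apply abs_RInt_le_const; [apply mPI_le| |].
  - eexists. apply icont_RInt, icont_minus; apply Hc; assumption.
  - intros t Ht. apply Rlt_le, H.
    assert (Ht' : Rabs (t / INR m) <= PI).
    { unfold Rdiv. rewrite Rabs_mult, Rabs_inv, (Rabs_pos_eq (INR m)) by lra.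
      assert (Ha : Rabs t <= PI) by (apply Rabs_le; lra).
      assert (Hi : 0 < / INR m <= 1).
      { split; [apply Rinv_0_lt_compat; lra|]. rewrite <- Rinv_1. apply Rinv_le_contravar; lra. }
      generalize (Rabs_pos t). nra. }
    apply Rabs_le_between in Ht'. lra.
Qed.

Lemma v_0 s : v 0 s = RtoC Rs.
Proof.
  unfold v. rewrite Hz0. transitivity (RtoC Rs * (cis s * cis (- s)))%C; [ring|].
  rewrite cis_mult_neg. ring.
Qed.

Lemma Rc_0 : Rc 0 = Rs.
Proof.
  unfold Rc, cmean. rewrite (I2_ext _ (fun _ => Rs)).
  - rewrite I2_const. field. generalize PI_RGT_0; lra.
  - intros x _. rewrite v_0. reflexivity.
Qed.

Lemma zero_in_range : Rabs 0 < r.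
Proof. rewrite Rabs_R0. exact Hr. Qed.

Lemma fc_cis e s : Rabs e < r -> fc e (cis s) = (v e s - RtoC (Rc e))%C.
Proof. intros He. apply circ_cis; [exact Hm|]. intros; apply wave_per, He. Qed.

Lemma fc_wder e s : Rabs e < r -> wder (fc e) (cis s) = (- Ci * v1 e s)%C.
Proof.
  intros He. apply circ_wder; [exact Hm| |].
  - intros; apply v_derive, He.
  - intros; apply wave_per, He.
Qed.

Lemma fc_w2der2 e s : Rabs e < r ->
  w2der2 (fc e) (cis s) = (- v2 e s + Ci * v1 e s)%C.
Proof.
  intros He. unfold w2der2. rewrite fc_wder by exact He.
  unfold fc. rewrite (circ_wder2 m (v e) (v1 e) (v2 e)); [ring|exact Hm| | |].
  - intros; apply v_derive, He.
  - intros; apply v1_derive, He.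
  - intros; apply wave_per, He.
Qed.

Lemma fc_G e s : Rabs e < r -> G a (Rc e) (lamc e) (fc e) (cis s) = RtoC 0.
Proof.
  intros He. destruct (HF e He) as [_ [H _]]. destruct (H s) as [_ [_ Hw]].
  unfold G. rewrite fc_cis, fc_wder, fc_w2der2 by exact He.
  unfold lamc. replace (Omega_R a (Rc e) + (Om e - Omega_R a (Rc e))) with (Om e) by ring.
  rewrite Cminus_conj, Cconj_RtoC.
  set (R0 := RtoC (Rc e)). set (c := cis (- s)).
  assert (Ec : (c * Cconj c)%C = RtoC 1).
  { unfold c. rewrite cis_conj. apply cis_mult_neg. }
  assert (EN : (v e s * Cconj (v e s))%C = (z e s * Cconj (z e s))%C).
  { unfold v. fold c. rewrite Cmult_conj.
    transitivity ((c * Cconj c) * (z e s * Cconj (z e s)))%C; [ring|]. rewrite Ec. ring. }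
  assert (E1 : (R0 + (Cconj (v e s) - R0))%C = (Cconj c * Cconj (z e s))%C).
  { unfold v. fold c. rewrite Cmult_conj. ring. }
  assert (E2 : (R0 + (v e s - R0) + - Ci * v1 e s)%C = (- (c * Ci * z1 e s))%C).
  { unfold v, v1. fold c.
    transitivity (c * (z e s - Ci * z1 e s + Ci * Ci * z e s))%C; [ring|].
    rewrite Ci_sqr. ring. }
  assert (E3 : (RtoC 1 + Cpow R0 2 + R0 * (v e s - R0) + R0 * (Cconj (v e s) - R0)
     + (v e s - R0) * (Cconj (v e s) - R0))%C = (RtoC 1 + z e s * Cconj (z e s))%C).
  { rewrite <- EN. simpl. ring. }
  rewrite E1, E2, E3. unfold wave_eq in Hw.
  transitivity (c * (RtoC (Om e) * z e s + Ci * RtoC a * z1 e s - z2 e s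
     + RtoC 2 * Cconj (z e s) * z1 e s ^ 2 / (RtoC 1 + z e s * Cconj (z e s))))%C;
    [|rewrite Hw; ring].
  set (I1 := (/ (RtoC 1 + z e s * Cconj (z e s)))%C). unfold Cdiv.  fold I1.
  unfold v, v1, v2. fold c. rewrite !RtoC_minus. simpl Cpow.
  replace (RtoC 3) with (RtoC 1 + RtoC 1 + RtoC 1)%C by (rewrite <- !RtoC_plus; f_equal; ring).
  replace (RtoC 2) with (RtoC 1 + RtoC 1)%C by (rewrite <- !RtoC_plus; f_equal; ring).
  set (zb := Cconj (z e s)).
  (* Both sides agree modulo [i^2 = -1] and [|c| = 1]; the corrections are the
     explicit multiples of these relations. *)
  match goal with |- ?A = ?B => transitivity (B
    + (Ci * Ci + RtoC 1) * (c * (RtoC 1 + RtoC 1 - RtoC a) * z e s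
         - (RtoC 1 + RtoC 1) * c * zb * z1 e s * z1 e s * I1)
    + (RtoC 1 - c * Cconj c) * ((RtoC 1 + RtoC 1) * c * Ci * Ci * zb * z1 e s * z1 e s * I1))%C end.
  - ring.
  - rewrite Ec, Ci_sqr. ring.
Qed.

(** A family of waves starting from the circle of radius [Rs] yields a
    bifurcating curve, parametrised by the amplitude: the radius is the mean of
    the wave. *)
Lemma bifurcates_of_family : bifurcates a m Rs.
Proof.
  assert (Hloc : forall e, Rabs e < r -> locally e (fun e' => Rabs e' < r)).
  { intros e He. assert (Hg : 0 < r - Rabs e) by lra. exists (mkposreal _ Hg). intros y0 Hy.
    set (y := y0 : R). change (Rabs (y - e) < r - Rabs e) in Hy. change (Rabs y < r).
    replace y with ((y - e) + e) by ring. eapply Rle_lt_trans; [apply Rabs_triang|]. lra. }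
  destruct (near_lt Rc 0) as [d [Hd Hpos]].
  { apply Rc_cont, zero_in_range. }
  { rewrite Rc_0. exact HRs. }
  exists (Finite (- Rmin d r)), (Finite (Rmin d r)), Rc, lamc, fc.
  assert (Hmin : 0 < Rmin d r) by (apply Rmin_pos; assumption).
  assert (Hin : forall e : R, Rbar_lt (- Rmin d r) e /\ Rbar_lt e (Rmin d r) ->
    Rabs e < d /\ Rabs e < r).
  { intros e [H1 H2].
    assert (He : Rabs e < Rmin d r) by (apply Rabs_def1; [exact H2|exact H1]).
    apply Rmin_Rgt_l in He. destruct He; split; assumption. }
  split; [|split; [|split; [|split]]].
  - simpl. lra.
  - intros e HI. destruct (Hin e HI) as [Hed He].
    split; [apply Hpos; rewrite Rminus_0_r; exact Hed|].
    split.
    { apply (circ_X m (v e) (v1 e) (v2 e)); [exact Hm| | | | |].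
      - intros; apply v_derive, He.
      - intros; apply v1_derive, He.
      - intros; apply v2_cont, He.
      - intros; apply wave_per, He.
      - intros; apply v_conj, He. }
    assert (HRc := Rc_cont e He).
    split; [exact HRc|]. split.
    { apply (continuous_minus (V := R_NormedModule)); [exact (proj1 (HF e He))|].
      apply (continuous_comp Rc (Omega_R a)); [exact HRc|].
      apply ex_derive_continuous_R.
      unfold Omega_R. auto_derive. nra. }
    intros eps Heps. assert (He2 : 0 < eps / 2) by lra.
    assert (LR : locally e (fun e' => Rabs (Rc e' - Rc e) < eps / 2)).
    { apply (proj1 (filterlim_locally _ _) HRc (mkposreal _ He2)). }
    generalize (filter_and _ _ (filter_and _ _ (Hloc e He) LR)
      (filter_and _ _ (jcontC_uniform v e (- PI) PI (fun s => proj1 (v_jcont e s He)) _ He2)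
      (filter_and _ _
        (jcontC_uniform v1 e (- PI) PI (fun s => proj1 (proj2 (v_jcont e s He))) _ He2)
        (jcontC_uniform v2 e (- PI) PI (fun s => proj2 (proj2 (v_jcont e s He))) _ He2)))).
    apply filter_imp. intros e' [[He' HR'] [H0 [H1 H2]]] w Hw.
    assert (Hb := angle_bound w). set (s := angle w) in *.
    replace w with (cis s) by (apply cis_angle, Hw).
    specialize (H0 s Hb). specialize (H1 s Hb). specialize (H2 s Hb).
    rewrite !fc_cis, !fc_wder, !fc_w2der2 by assumption.
    assert (HCi : Cmod Ci = 1).
    { unfold Cmod, Ci; simpl. replace (0 * (0 * 1) + 1 * (1 * 1)) with 1 by ring. apply sqrt_1. }
    split; [|split].
    + replace (v e' s - RtoC (Rc e') - (v e s - RtoC (Rc e)))%C with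
        ((v e' s - v e s) + - RtoC (Rc e' - Rc e))%C by (rewrite RtoC_minus; ring).
      eapply Rle_lt_trans; [apply Cmod_triangle|]. rewrite Cmod_opp, Cmod_R. lra.
    + replace (- Ci * v1 e' s - - Ci * v1 e s)%C with (- (Ci * (v1 e' s - v1 e s)))%C by ring.
      rewrite Cmod_opp, Cmod_mult, HCi. lra.
    + replace (- v2 e' s + Ci * v1 e' s - (- v2 e s + Ci * v1 e s))%C with
        (- (v2 e' s - v2 e s) + Ci * (v1 e' s - v1 e s))%C by ring.
      eapply Rle_lt_trans; [apply Cmod_triangle|]. rewrite Cmod_opp, Cmod_mult, HCi. lra.
  - split; [apply Rc_0|split].
    + unfold lamc. rewrite Rc_0, HOm0. ring.
    + intros w Hw. rewrite <- (cis_angle w Hw), fc_cis, v_0, Rc_0 by exact zero_in_range. ring.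
  - intros e HI w Hw. destruct (Hin e HI) as [_ He].
    rewrite <- (cis_angle w Hw). apply fc_G, He.
  - intros e HI He0 [_ Hf]. destruct (Hin e HI) as [_ He].
    destruct (HF e He) as [_ [_ [_ [_ [_ Hn]]]]]. destruct (Hn He0) as [s Hs]. apply Hs.
    assert (Hmod : forall s, Cmod (z e s) = Cmod (RtoC (Rc e))).
    { intros t. specialize (Hf (cis t) (onT_cis t)). rewrite fc_cis in Hf by exact He.
      assert (E : v e t = RtoC (Rc e)).
      { transitivity (v e t - RtoC (Rc e) + RtoC (Rc e))%C; [ring|]. rewrite Hf. ring. }
      rewrite <- E. unfold v. rewrite Cmod_mult, onT_cis. ring. }
    rewrite !Hmod. reflexivity.
Qed.

End Bifurcation.

(** * Tilted circles *)

Lemma C_norm2_pos (z : C) : z <> RtoC 0 -> 0 < Re z ^ 2 + Im z ^ 2.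
Proof.
  intros H. destruct z as [x y]. unfold Re, Im; simpl.
  destruct (Req_dec x 0) as [->|Hx]; [destruct (Req_dec y 0) as [->|Hy]|].
  - destruct H. reflexivity.
  - assert (0 < y * y) by (apply Rsqr_pos_lt; exact Hy). nra.
  - assert (0 < x * x) by (apply Rsqr_pos_lt; exact Hx). nra.
Qed.

Lemma is_derive_sqr (g : R -> R) t d : is_derive g t d ->
  is_derive (fun x => g x ^ 2) t (2 * g t * d).
Proof.
  intros H. eapply is_derive_eq; [auto_derive; [exists d; exact H|reflexivity]|].
  change (Derive (fun x => g x) t) with (Derive g t).
  rewrite (is_derive_unique g t d H). ring.
Qed.

Lemma Cder_inv f t l : Cder f t l -> f t <> RtoC 0 ->
  Cder (fun x => / f x)%C t (- l / (f t * f t))%C.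
Proof.
  intros [H1 H2] H0. assert (Hp := C_norm2_pos _ H0).
  assert (Hd : is_derive (fun x => Re (f x) ^ 2 + Im (f x) ^ 2) t
    (2 * Re (f t) * Re l + 2 * Im (f t) * Im l)).
  { apply (is_derive_plus (V := R_NormedModule)); apply is_derive_sqr; assumption. }
  split.
  - eapply is_derive_eq.
    + apply (is_derive_div (fun x => Re (f x)) _ t _ _ H1 Hd). lra.
    + destruct (f t) as [x y], l as [p q]. unfold Re, Im in *; simpl in *.
      field. repeat split; nra.
  - eapply is_derive_eq.
    + apply (is_derive_div (fun x => - Im (f x)) _ t _ _
        (is_derive_opp (V := R_NormedModule) _ _ _ H2) Hd). lra.
    + destruct (f t) as [x y], l as [p q]. unfold Re, Im, opp in *; simpl in *.
      field. repeat split; nra.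
Qed.

Lemma jcontC_inv f e s : jcontC f e s -> f e s <> RtoC 0 ->
  jcontC (fun e s => / f e s)%C e s.
Proof.
  intros [H1 H2] H0. assert (Hp := C_norm2_pos _ H0).
  assert (Hn : jcont (fun e s => Re (f e s) ^ 2 + Im (f e s) ^ 2) e s).
  { apply jcont_plus; apply jcont_pow2; assumption. }
  split.
  - apply (jcont_div (fun e s => Re (f e s))); [exact H1|exact Hn|apply Rgt_not_eq; exact Hp].
  - apply (jcont_div (fun e s => - Im (f e s))); [apply jcont_opp, H2|exact Hn|apply Rgt_not_eq; exact Hp].
Qed.

Section Circles.

Context (a Rs : R).
Hypothesis HRs : 0 < Rs.
Hypothesis Ha : a = (1 - Rs ^ 2) / (1 + Rs ^ 2).

(** The curve [cc_z] is the image of the circle of radius [Rs] under the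
    rotation [z |-> (z + e) / (1 - e z)] of the sphere, with denominator
    [cc_den]; [cc_z1] and [cc_z2] are its derivatives.  Under
    [Ha] the circle of radius [Rs] is a wave with angular velocity zero, and
    rotations of the sphere preserve such waves. *)
Definition cc_den (e s : R) : C := (RtoC 1 - RtoC (e * Rs) * cis s)%C.
Definition cc_z (e s : R) : C := ((RtoC Rs * cis s + RtoC e) * / cc_den e s)%C.
Definition cc_z1 (e s : R) : C :=
  (Ci * (RtoC (Rs * (1 + e ^ 2)) * cis s) * (/ cc_den e s * / cc_den e s))%C.
Definition cc_z2 (e s : R) : C :=
  (- (RtoC (Rs * (1 + e ^ 2)) * cis s) * (RtoC 1 + RtoC (e * Rs) * cis s)
   * (/ cc_den e s * (/ cc_den e s * / cc_den e s)))%C.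

Lemma cc_small e : Rabs e < / Rs -> Rabs (e * Rs) < 1.
Proof.
  intros H. rewrite Rabs_mult, (Rabs_pos_eq Rs) by lra.
  apply (Rmult_lt_compat_r Rs) in H; [|exact HRs]. rewrite Rinv_l in H by lra. exact H.
Qed.

Lemma cc_den_neq e s : Rabs e < / Rs -> cc_den e s <> RtoC 0.
Proof.
  intros H E. apply cc_small in H.
  assert (E2 : (RtoC (e * Rs) * cis s)%C = RtoC 1).
  { transitivity (RtoC 1 - cc_den e s)%C; [unfold cc_den; ring|]. rewrite E. ring. }
  apply (f_equal Cmod) in E2. rewrite Cmod_mult, onT_cis, Cmod_R, Cmod_1 in E2. lra.
Qed.

Lemma cc_den_derive e s : Cder (cc_den e) s (- RtoC (e * Rs) * (Ci * cis s))%C.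
Proof.
  apply (Cder_ext (fun s => RtoC 1 + - RtoC (e * Rs) * cis s)%C).
  { intros; unfold cc_den; ring. }
  eapply Cder_eq.
  - apply Cder_plus; [apply Cder_const|]. apply Cder_mult; [apply Cder_const|apply Cder_cis].
  - cbv beta. ring.
Qed.

Lemma cc_z_derive e s : Rabs e < / Rs -> Cder (cc_z e) s (cc_z1 e s).
Proof.
  intros He. assert (Hn := cc_den_neq e s He).
  eapply Cder_eq.
  - apply Cder_mult.
    + apply Cder_plus; [apply Cder_mult; [apply Cder_const|apply Cder_cis]|apply Cder_const].
    + apply Cder_inv; [apply cc_den_derive|exact Hn].
  - unfold cc_z1. cbv beta. rewrite !RtoC_mult, RtoC_plus, RtoC_pow. 
    unfold cc_den in *. rewrite RtoC_mult in *. field. exact Hn.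
Qed.

Lemma cc_z1_derive e s : Rabs e < / Rs -> Cder (cc_z1 e) s (cc_z2 e s).
Proof.
  intros He. assert (Hn := cc_den_neq e s He).
  eapply Cder_eq.
  - apply Cder_mult.
    + apply Cder_mult; [apply Cder_const|apply Cder_mult; [apply Cder_const|apply Cder_cis]].
    + apply Cder_mult; (apply Cder_inv; [apply cc_den_derive|exact Hn]).
  - unfold cc_z2. cbv beta.
    set (A := RtoC (Rs * (1 + e ^ 2))). set (B := RtoC (e * Rs)). set (w := cis s).
    set (d := cc_den e s) in *.
    assert (Ed : RtoC 1 = (d + B * w)%C) by (unfold d, cc_den, B, w; ring).
    transitivity ((Ci * Ci) * (A * w) * (d + B * w + B * w) * (/ d * (/ d * / d)))%C.
    + field. exact Hn.
    + rewrite <- Ed, Ci_sqr. ring.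
Qed.

Lemma cc_conj_den e s : Cconj (cc_den e s) = cc_den e (- s).
Proof. unfold cc_den. rewrite Cminus_conj, Cmult_conj, !Cconj_RtoC, cis_conj. reflexivity. Qed.

Lemma Cconj_inv (z : C) : z <> RtoC 0 -> Cconj (/ z)%C = (/ Cconj z)%C.
Proof.
  intros H. apply C_norm2_pos in H. destruct z as [x y]. unfold Re, Im in H; simpl in H.
  unfold Cconj, Cinv; simpl. f_equal; field; try split; nra.
Qed.

Lemma cc_conj e s : Rabs e < / Rs -> cc_z e (- s) = Cconj (cc_z e s).
Proof.
  intros He. assert (Hn := cc_den_neq e s He).
  unfold cc_z. rewrite Cmult_conj, Cconj_inv by exact Hn.
  rewrite Cplus_conj, Cmult_conj, !Cconj_RtoC, cis_conj, cc_conj_den. reflexivity.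
Qed.

Lemma cc_wave e s : Rabs e < / Rs -> wave_eq a 0 (cc_z e s) (cc_z1 e s) (cc_z2 e s).
Proof.
  intros He. assert (Hn := cc_den_neq e s He). assert (Hn' := cc_den_neq e (- s) He).
  unfold wave_eq. rewrite <- (cc_conj e s He).
  set (u := RtoC Rs). set (t := RtoC e).
  set (w := cis s). set (w' := cis (- s)).
  assert (Hw : (w * w')%C = RtoC 1) by apply cis_mult_neg.
  set (d := cc_den e s) in *. set (d' := cc_den e (- s)) in *.
  assert (Ed : d = (RtoC 1 - t * u * w)%C) by (unfold d, cc_den, t, u, w; rewrite RtoC_mult; reflexivity).
  assert (Ed' : d' = (RtoC 1 - t * u * w')%C) by (unfold d', cc_den, t, u, w'; rewrite RtoC_mult; reflexivity).
  assert (Ez : cc_z e s = ((u * w + t) / d)%C) by reflexivity.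
  assert (Ez' : cc_z e (- s) = ((u * w' + t) / d')%C) by reflexivity.
  assert (HA : RtoC (Rs * (1 + e ^ 2)) = (u * (RtoC 1 + t * t))%C).
  { unfold u, t. rewrite RtoC_mult, RtoC_plus. f_equal. f_equal. simpl. rewrite !RtoC_mult. ring. }
  assert (Ez1 : cc_z1 e s = (Ci * (u * (RtoC 1 + t * t) * w) / (d * d))%C).
  { unfold cc_z1. fold d w. rewrite HA. field. exact Hn. }
  assert (Ez2 : cc_z2 e s = (- (u * (RtoC 1 + t * t) * w) * (RtoC 1 + t * u * w) / (d * d * d))%C).
  { unfold cc_z2. fold d w. rewrite HA. rewrite RtoC_mult. fold t u. field. exact Hn. }
  assert (Hu : (RtoC 1 + u * u)%C <> RtoC 0).
  { unfold u. rewrite <- RtoC_mult, <- RtoC_plus. intros K. apply RtoC_inj in K. nra. }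
  assert (Ht : (RtoC 1 + t * t)%C <> RtoC 0).
  { unfold t. rewrite <- RtoC_mult, <- RtoC_plus. intros K. apply RtoC_inj in K. nra. }
  assert (EN : (RtoC 1 + cc_z e s * cc_z e (- s))%C = ((RtoC 1 + u * u) * (RtoC 1 + t * t) / (d * d'))%C).
  { rewrite Ez, Ez'.
    transitivity ((d * d' + (u * w + t) * (u * w' + t)) / (d * d'))%C.
    - field. split; assumption.
    - f_equal. rewrite Ed, Ed'.
      transitivity (RtoC 1 + t * t + u * u * (w * w') + t * t * u * u * (w * w'))%C; [ring|].
      rewrite Hw. ring. }
  rewrite EN, Ez', Ez1, Ez2, Ez.
  assert (Ea : RtoC a = ((RtoC 1 - u * u) / (RtoC 1 + u * u))%C).
  { rewrite Ha. unfold u. rewrite RtoC_div by nra. rewrite RtoC_minus, RtoC_plus.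
    f_equal; f_equal; simpl; rewrite !RtoC_mult; ring. }
  rewrite Ea.
  transitivity ((RtoC 1 + t * t) * u / (d * d * d * (RtoC 1 + u * u)) *
    (Ci * Ci * ((RtoC 1 - u * u) * w * d + RtoC 2 * w * (u * (w * w') + t * w) * u)
      + w * (RtoC 1 + t * u * w) * (RtoC 1 + u * u)))%C.
  - field. repeat split; assumption.
  - rewrite Ci_sqr, Hw, Ed. replace (RtoC 2) with (RtoC 1 + RtoC 1)%C by (rewrite <- RtoC_plus; f_equal; ring).
    unfold Cdiv. ring.
Qed.

Lemma circles_waves :
  wave_family a (INR 1) (/ Rs) (fun _ => 0) cc_z cc_z1 cc_z2.
Proof.
  intros e He. 
  assert (Jc : forall s, jcontC (fun _ s => cis s) e s).
  { intros s. apply jcontC_cis. apply (jcont_var (fun s => s)), continuous_id. }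
  assert (Jp : forall (f : R -> R) s, ex_derive f e -> jcontC (fun e _ => RtoC (f e)) e s).
  { intros f s Hf. apply jcontC_RtoC, jcont_param.
    apply ex_derive_continuous_R. exact Hf. }
  assert (Jd : forall s, jcontC (fun e s => / cc_den e s)%C e s).
  { intros s. apply jcontC_inv; [|apply cc_den_neq, He].
    apply jcontC_minus; [apply jcontC_const|]. apply jcontC_mult; [|apply Jc].
    apply (Jp (fun e => e * Rs)). auto_derive; trivial. }
  split; [apply continuous_const|]. split; [|split; [|split; [|split]]].
  - intros s. split; [apply cc_z_derive, He|]. split; [apply cc_z1_derive, He|apply cc_wave, He].
  - intros s.
    assert (JA : jcontC (fun e s => RtoC (Rs * (1 + e ^ 2)) * cis s)%C e s).
    { apply jcontC_mult; [|apply Jc]. apply (Jp (fun e => Rs * (1 + e ^ 2))). auto_derive; trivial. }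
    split; [|split].
    + apply jcontC_mult; [|apply Jd]. apply jcontC_plus.
      * apply jcontC_mult; [apply jcontC_const|apply Jc].
      * apply (Jp (fun e => e)). auto_derive; trivial.
    + apply jcontC_mult; [apply jcontC_mult; [apply jcontC_const|exact JA]|].
      apply jcontC_mult; apply Jd.
    + apply jcontC_mult; [|apply jcontC_mult; [apply Jd|apply jcontC_mult; apply Jd]].
      apply jcontC_mult.
      * destruct JA as [J1 J2].
        split; [apply (jcont_opp _ _ _ J1)|apply (jcont_opp _ _ _ J2)].
      * apply jcontC_plus; [apply jcontC_const|]. apply jcontC_mult; [|apply Jc].
        apply (Jp (fun e => e * Rs)). auto_derive; trivial.
  - intros s. simpl INR. replace (2 * PI / 1) with (2 * PI) by field.
    assert (E1 : cis (2 * PI) = RtoC 1) by (unfold cis; rewrite cos_2PI, sin_2PI; reflexivity).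
    assert (E2 : cis (s + 2 * PI) = cis s) by (rewrite cis_plus, E1; ring).
    unfold cc_z, cc_den. rewrite E1, E2. ring.
  - intros s. apply cc_conj, He.
  - intros He0. exists PI.
    assert (Hs := cc_small e He). apply Rabs_def2 in Hs.
    assert (Hv : forall s x, cis s = RtoC x -> 1 - e * Rs * x <> 0 ->
      Cmod (cc_z e s) = Rabs ((Rs * x + e) / (1 - e * Rs * x))).
    { intros s x Hc Hx. unfold cc_z, cc_den. rewrite Hc.
      rewrite <- !RtoC_mult, <- RtoC_plus, <- RtoC_minus.
      rewrite <- RtoC_inv, <- RtoC_mult by exact Hx. rewrite Cmod_R. reflexivity. }
    rewrite (Hv PI (-1)), (Hv 0 1); try lra.
    + intros E. apply (f_equal (fun x => x ^ 2)) in E. rewrite !pow2_abs in E.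
      apply (Rmult_eq_compat_r ((1 - e * Rs * -1) ^ 2 * (1 - e * Rs * 1) ^ 2)) in E.
      field_simplify in E; [|lra|lra]. 
      assert (K : 4 * e * (Rs * (1 + Rs ^ 2) * (1 + e ^ 2)) = 0) by lra.
      assert (0 < Rs * (1 + Rs ^ 2) * (1 + e ^ 2)).
      { apply Rmult_lt_0_compat; [apply Rmult_lt_0_compat; [exact HRs|nra]|nra]. }
      apply He0. nra.
    + unfold cis. rewrite cos_0, sin_0. reflexivity.
    + unfold cis. rewrite cos_PI, sin_PI. reflexivity.
Qed.

Lemma circles_bifurcate : bifurcates a 1 Rs.
Proof.
  apply (bifurcates_of_family a Rs (/ Rs) 1 (fun _ => 0) cc_z cc_z1 cc_z2).
  - lia.
  - apply Rinv_0_lt_compat, HRs.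
  - exact HRs.
  - exact circles_waves.
  - unfold Omega_R. rewrite Ha. field. nra.
  - intros s. unfold cc_z, cc_den. rewrite Rmult_0_l.
    replace (RtoC 1 - RtoC 0 * cis s)%C with (RtoC 1) by ring. field.
Qed.

End Circles.

(** * Bifurcation at a nondegenerate radius *)

Lemma tops_bifurcate (a h0 : R) (m : nat) : (1 <= m)%nat -> 0 < 1 - h0 ^ 2 ->
  3 * h0 ^ 2 - 4 * a * h0 + a ^ 2 + 1 = INR m ^ 2 -> 3 * h0 <> 2 * a ->
  bifurcates a m (sqrt ((1 - h0) / (1 + h0))).
Proof.
  intros Hm Hh Hd Hs.
  assert (Hm0 : 0 < INR m) by (apply lt_0_INR; lia).
  destruct (ex_top_family a h0 (INR m) Hm0 Hh Hd Hs)
    as [r [Om [z [z1 [z2 [Hr [HF [HOm Hz]]]]]]]].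
  assert (H1 : 0 < 1 - h0) by nra. assert (H2 : 0 < 1 + h0) by nra.
  assert (Hq : 0 < (1 - h0) / (1 + h0)) by (apply Rdiv_lt_0_compat; assumption).
  apply (bifurcates_of_family a _ r m Om z z1 z2 Hm Hr); [apply sqrt_lt_R0, Hq|exact HF| |exact Hz].
  rewrite HOm. unfold Omega_R. rewrite pow2_sqrt by lra. field. lra.
Qed.

Theorem theorem1p1 (a : R) (ha : 0 <= a) :
  (a < 1 -> Tr a 1 (R1_e_plus a) -> bifurcates a 1 (R1_e_plus a)) /\
  (forall m : nat, (1 <= m)%nat ->
     (sqrt 2 < a -> sqrt (a ^ 2 - 2) < INR m /\ INR m < a + 2) ->
     (a <= sqrt 2 -> INR m < a + 2) ->
     Tr a m (Rm_e_minus a m) ->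
     bifurcates a m (Rm_e_minus a m)).
Proof.
  split.
  - intros Ha1 _.
    assert (E : (-3 + a ^ 2 + 2 * a) / (-3 - 4 * a - a ^ 2) = (1 - a) / (1 + a)).
    { field. split; nra. }
    assert (Hp : 0 < (1 - a) / (1 + a)) by (apply Rdiv_lt_0_compat; lra).
    unfold R1_e_plus. rewrite E. apply circles_bifurcate; [apply sqrt_lt_R0, Hp|].
    rewrite pow2_sqrt by lra. field. lra.
  - intros m Hm Hbig Hsmall _.
    assert (Hm1 : 1 <= INR m) by (apply (le_INR 1); exact Hm).
    assert (Hlt : INR m < a + 2).
    { destruct (Rlt_dec (sqrt 2) a) as [H|H]; [apply Hbig, H|apply Hsmall; lra]. }
    set (mu := INR m) in *.
    set (D := sqrt (3 * mu ^ 2 - 3 + a ^ 2)).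
    assert (HD0 : 0 <= D) by apply sqrt_pos.
    assert (HD2 : D ^ 2 = 3 * mu ^ 2 - 3 + a ^ 2).
    { unfold D. apply pow2_sqrt. nra. }
    assert (Hup : D < 3 + 2 * a) by nra.
    assert (Hlow : 0 < 3 - 2 * a + D).
    { destruct (Rlt_dec (2 * a) 3) as [H|H]; [lra|].
      assert (Hs2 : sqrt 2 < a).
      { assert (Hq : sqrt 2 < 3 / 2); [|lra].
        apply Rsqr_incrst_0; [|apply sqrt_pos|lra]. rewrite Rsqr_sqrt by lra. unfold Rsqr. lra. }
      destruct (Hbig Hs2) as [Hb _].
      assert (Hm2 : a ^ 2 - 2 < mu ^ 2).
      { rewrite <- (pow2_sqrt (a ^ 2 - 2)) by nra.
        generalize (sqrt_pos (a ^ 2 - 2)). nra. }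
      nra. }
    pose (h0 := (2 * a - D) / 3).
    assert (E : (mu ^ 2 + 2 - a ^ 2 + 2 * D) / (4 + 4 * a + a ^ 2 - mu ^ 2)
      = (1 - h0) / (1 + h0)).
    { transitivity (((3 - 2 * a + D) * (3 + 2 * a + D)) / ((3 + 2 * a - D) * (3 + 2 * a + D))).
      - replace ((3 - 2 * a + D) * (3 + 2 * a + D)) with (3 * (mu ^ 2 + 2 - a ^ 2 + 2 * D)) by nra.
        replace ((3 + 2 * a - D) * (3 + 2 * a + D)) with (3 * (4 + 4 * a + a ^ 2 - mu ^ 2)) by nra.
        field. nra.
      - unfold h0. field. lra. }
    unfold Rm_e_minus. fold mu. fold D. rewrite E.
    destruct (Req_dec D 0) as [HDz|HDz].
    + (* The linearised frequency is stationary at this height.  This happens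
         only for [a = 0] and [m = 1]; then the angular velocity vanishes and the
         great circle can be tilted. *)
      assert (Ha0 : a = 0) by (rewrite HDz in HD2; nra).
      assert (Hmu : mu = 1) by (rewrite HDz, Ha0 in HD2; nra).
      assert (Em : m = 1%nat) by (apply INR_eq; exact Hmu).
      assert (Eh : h0 = 0) by (unfold h0; rewrite HDz, Ha0; field).
      rewrite Eh, Em, Ha0. replace ((1 - 0) / (1 + 0)) with 1 by field. rewrite sqrt_1.
      apply circles_bifurcate; [lra|field].
    + apply tops_bifurcate; [exact Hm| | |].
      * unfold h0. nra.
      * fold mu. unfold h0. 
        replace (3 * ((2 * a - D) / 3) ^ 2 - 4 * a * ((2 * a - D) / 3) + a ^ 2 + 1)
          with ((D ^ 2 - a ^ 2) / 3 + 1) by field. rewrite HD2. field.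
      * unfold h0. lra.
Qed.
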